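(* Let $r,s\ge1$ be integers, $p=r+s$, let $\mathcal D$ be the open unit ball of the $r\times s$ complex matrices in the operator norm, and let $\boldsymbol B_{\mathcal D}$ be its Bergman kernel. Let $\lambda>0$ be such that $\boldsymbol B_{\mathcal D}^\lambda$ is a positive definite kernel on $\mathcal D$, and put $\nu=\lambda p$. If $1\le\nu<s$, then the homomorphism $\rho_{\boldsymbol N^{(\lambda)}(w)}$ is contractive for every $w\in\mathcal D$, while the homomorphism induced by the commuting tuple of multiplications by the coordinate functions on the twisted Bergman space $\mathbb A^{(\lambda)}(\mathcal D)$ is not contractive.
   Context: $\mathcal D=\{Z: I-ZZ^*>0\}$ is viewed as a domain in $\mathbb C^{rs}$ with coordinates ordered $z_{11},\ldots,z_{1s},\ldots,z_{r1},\ldots,z_{rs}$. With normalized volume measure, $\boldsymbol B_{\mathcal D}(Z,W)=\det(I-ZW^* )^{-p}$, and $\boldsymbol B_{\mathcal D}^\lambda(Z,W)=\det(I-ZW^* )^{-\lambda p}$ is the polarization of $\boldsymbol B_{\mathcal D}(W,W)^\lambda$. The twisted Bergman space $\mathbb A^{(\lambda)}(\mathcal D)$ is the Hilbert space of holomorphic functions with reproducing kernel $\boldsymbol B_{\mathcal D}^\lambda$. $\mathcal O(\mathcal D)$ is the algebra of functions holomorphic in a neighborhood of $\overline{\mathcal D}$. The homomorphism induced by the multiplication tuple sends $f$ to multiplication by $f$; that it is not contractive means that it is not the case that for every $f\in\mathcal O(\mathcal D)$ multiplication by $f$ is a bounded operator on $\mathbb A^{(\lambda)}(\mathcal D)$ of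 norm at most $\sup_{\mathcal D}|f|$. Let $\mathcal K^{(\lambda)}(w)=-\big(\frac{\partial^2}{\partial w_i\partial\bar w_j}\log\boldsymbol B_{\mathcal D}(w,w)^\lambda\big)_{i,j=1}^{rs}$, and let $A(w)$ be an $rs\times rs$ matrix with $A(w)^{\rm t}\overline{A(w)}=(-\mathcal K^{(\lambda)}(w)^{\rm t})^{-1}$, with columns $\boldsymbol\alpha_1(w),\ldots,\boldsymbol\alpha_{rs}(w)$. Then $\boldsymbol N^{(\lambda)}(w)$ is the commuting tuple of $(rs+1)\times(rs+1)$ matrices $\left(\begin{smallmatrix}w_k&\boldsymbol\alpha_k(w)^{\rm t}\\0&w_kI_{rs}\end{smallmatrix}\right)$, $1\le k\le rs$ (different choices of $A(w)$ give unitarily equivalent tuples), and $\rho_{\boldsymbol N^{(\lambda)}(w)}(f)=\left(\begin{smallmatrix}f(w)&\nabla f(w)A(w)^{\rm t}\\0&f(w)I_{rs}\end{smallmatrix}\right)$ for $f\in\mathcal O(\mathcal D)$. It is contractive if $\|\rho_{\boldsymbol N^{(\lambda)}(w)}(f)\|\le\sup_{\mathcal D}|f|$ for all $f\in\mathcal O(\mathcal D)$. *)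

(* Defs.v *)
From HB Require Import structures.
From mathcomp Require Import all_boot all_order all_algebra.
From mathcomp Require Import complex.
From mathcomp Require Import all_classical all_reals all_analysis.

Set Implicit Arguments.
Unset Strict Implicit.
Unset Printing Implicit Defensive.
Import Order.TTheory GRing.Theory Num.Theory Num.Def.
Import numFieldNormedType.Exports.
Local Open Scope classical_set_scope.
Local Open Scope ring_scope.
Local Open Scope sesquilinear_scope.
Local Open Scope complex_scope.

(* The complex plane with its usual topology, as a normed space over itself. *)
HB.instance Definition _ (R : rcfType) := PseudoPointedMetric.copy R[i] R[i]^o.
HB.instance Definition _ (R : rcfType) := GRing.ComAlgebra.copy R[i] R[i]^o.
HB.instance Definition _ (R : rcfType) := Vector.copy R[i] R[i]^o.
HB.instance Definition _ (R : rcfType) := NormedModule.copy R[i] R[i]^o.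

Section Norms.
Context {R : realType}.

Definition cmod (z : R[i]) : R := ComplexField.Normc.normc z.

Definition l2norm {n : nat} (x : 'cV[R[i]]_n) : R :=
  Num.sqrt (\sum_i cmod (x i 0) ^+ 2).

Definition opnorm {m n : nat} (M : 'M[R[i]]_(m, n)) : R :=
  sup [set l2norm (M *m x) | x in [set x : 'cV[R[i]]_n | l2norm x <= 1]].

End Norms.

Section Domain.
Context {R : realType} {r s : nat}.
Local Notation C := R[i].
Local Notation M := 'M[C]_(r, s).

(* I - ZZ^* > 0 in the sense of positive definite Hermitian matrices; the
   strict order of R[i] forces the value of the form to be real. *)
Definition matrix_ball : set M :=
  [set Z | forall x : 'rV[C]_r, x != 0 ->
     0 < (x *m (1%:M - Z *m Z ^t*) *m x ^t*) 0 0].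

(* mxvec is row-major, so the k-th basis vector follows the ordering
   z_11, ..., z_1s, ..., z_r1, ..., z_rs of the coordinates. *)
Definition coord_dir (k : 'I_(r * s)) : M := vec_mx (delta_mx 0 k).

(* Differentiability is over the field R[i], i.e. complex (Frechet)
   differentiability; the values of f outside U are irrelevant for open U. *)
Definition holomorphic_on (U : set M) (f : M -> C) : Prop :=
  forall Z, U Z -> differentiable f Z.

Definition holo_nbhd_closure (f : M -> C) : Prop :=
  exists U : set M,
    [/\ open U, closure matrix_ball `<=` U & holomorphic_on U f].

Definition sup_norm (f : M -> C) : R := sup [set cmod (f Z) | Z in matrix_ball].

Definition gradient (f : M -> C) (w : M) : 'rV[C]_(r * s) :=
  \row_k 'D_(coord_dir k) f w.

Definition real_dir_deriv (v : M) (g : M -> C) (w : M) : C :=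
  Complex (derive1 (fun t : R => complex.Re (g (w + t%:C *: v))) 0)
    (derive1 (fun t : R => complex.Im (g (w + t%:C *: v))) 0).

Definition wirtinger (k : 'I_(r * s)) (g : M -> C) (w : M) : C :=
  (real_dir_deriv (coord_dir k) g w
   - 'i * real_dir_deriv ('i *: coord_dir k) g w) / 2%:R.

Definition wirtinger_bar (k : 'I_(r * s)) (g : M -> C) (w : M) : C :=
  (real_dir_deriv (coord_dir k) g w
   + 'i * real_dir_deriv ('i *: coord_dir k) g w) / 2%:R.

(* Bergman kernel of the ball for the normalized volume measure. *)
Definition bergman (Z W : M) : C := (\det (1%:M - Z *m W ^t*)) ^- (r + s).

(* bergman W W is a positive real number for W in the ball. *)
Definition bergman_diag_pow (lambda : R) (W : M) : R :=
  (complex.Re (bergman W W)) `^ lambda.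

(* K is holomorphic in the first and antiholomorphic in the second variable,
   jointly: (Z, Y) |-> K Z (conj Y) is holomorphic on the product. *)
Definition is_polarization (g : M -> R) (K : M -> M -> C) : Prop :=
  (forall Z W, matrix_ball Z -> matrix_ball W ->
     differentiable (fun P : M * M => K P.1 (map_mx conjC P.2))
       (Z, map_mx conjC W))
  /\ (forall W, matrix_ball W -> K W W = (g W)%:C).

Definition positive_definite_kernel (K : M -> M -> C) : Prop :=
  forall (n : nat) (Z : 'I_n -> M) (c : 'I_n -> C),
    (forall i, matrix_ball (Z i)) ->
    0 <= \sum_i \sum_j c i * conjC (c j) * K (Z i) (Z j).

(* The Hilbert space of holomorphic functions on the ball with reproducing
   kernel K. A vector h is identified with the function fhs_eval h restricted
   to the ball; only values on the ball matter. *)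
Record holo_rkhs (K : M -> M -> C) := HoloRKHS {
  fhs_space :> completeNormedModType C;
  fhs_dot : {dot fhs_space for conjC};
  fhs_normE : forall h : fhs_space, `|h| ^+ 2 = fhs_dot h h;
  fhs_eval : fhs_space -> M -> C;
  fhs_eval_linear : forall Z, matrix_ball Z -> scalar (fhs_eval ^~ Z);
  fhs_eval_inj : forall h : fhs_space,
    (forall Z, matrix_ball Z -> fhs_eval h Z = 0) -> h = 0;
  fhs_eval_holo : forall h : fhs_space, holomorphic_on matrix_ball (fhs_eval h);
  fhs_ker : M -> fhs_space;
  fhs_kerE : forall Z W, matrix_ball Z -> matrix_ball W ->
    fhs_eval (fhs_ker W) Z = K Z W;
  fhs_reproducing : forall (h : fhs_space) W, matrix_ball W ->
    fhs_eval h W = fhs_dot h (fhs_ker W)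
}.

Definition mult_bounded_by (K : M -> M -> C) (H : holo_rkhs K)
    (f : M -> C) (c : R) : Prop :=
  forall h : H, exists g : H,
    (forall Z, matrix_ball Z -> fhs_eval g Z = f Z * fhs_eval h Z)
    /\ `|g| <= c%:C * `|h|.

Definition mult_hom_contractive (K : M -> M -> C) (H : holo_rkhs K) : Prop :=
  forall f, holo_nbhd_closure f -> mult_bounded_by H f (sup_norm f).

Definition curvature (lambda : R) (w : M) : 'M[C]_(r * s) :=
  - \matrix_(i, j) wirtinger i
      (wirtinger_bar j (fun W => (ln (bergman_diag_pow lambda W))%:C)) w.

Definition curvature_factor (lambda : R) (w : M) (A : 'M[C]_(r * s)) : Prop :=
  A^T *m map_mx conjC A = invmx (- (curvature lambda w)^T).

Definition N_tuple (A : 'M[C]_(r * s)) (w : M) (k : 'I_(r * s)) :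
    'M[C]_(1 + r * s) :=
  block_mx (mxvec w 0 k)%:M (col k A)^T 0 (mxvec w 0 k)%:M.

Definition rho_N (A : 'M[C]_(r * s)) (w : M) (f : M -> C) :
    'M[C]_(1 + r * s) :=
  block_mx (f w)%:M (gradient f w *m A^T) 0 (f w)%:M.

(* rho_N is the homomorphism sending the k-th coordinate function to the k-th
   member of the tuple. *)
Lemma rho_N_coord (A : 'M[C]_(r * s)) (w : M) (k : 'I_(r * s)) :
  rho_N A w (fun Z => mxvec Z 0 k) = N_tuple A w k.
Proof.
rewrite /rho_N /N_tuple; congr block_mx.
have -> : gradient (fun Z : M => mxvec Z 0 k) w = delta_mx 0 k.
  apply/rowP => j; rewrite !mxE /derive.
  apply: cvg_lim; first exact: norm_hausdorff.
  apply: cvg_near_cst; near=> h.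
  have h0 : h != 0 by near: h; exact: nbhs_dnbhs_neq.
  rewrite /= addrC /coord_dir linearP /= vec_mxK !mxE eqxx /= addrC addrK.
  by rewrite scalerA mulVf // scale1r eq_sym.
by rewrite -rowE tr_col.
Unshelve. all: by end_near. Qed.

Definition rho_contractive (A : 'M[C]_(r * s)) (w : M) : Prop :=
  forall f, holo_nbhd_closure f -> opnorm (rho_N A w f) <= sup_norm f.

End Domain.

(* Main.v *)
Require Import Defs.
From mathcomp Require Import all_boot all_order all_algebra.
From mathcomp Require Import fingroup perm cyclic separable cyclotomic.
From mathcomp Require Import complex ring lra.
From mathcomp Require Import all_classical all_reals all_analysis.

(** Write [P = 1 - w w'] and [Q = 1 - w' w], with a prime for the adjoint. The
    curvature at [w] is [nu] times the map [Y |-> P^-1 Y Q^-1], so that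
    [nabla f(w) A(w)^t] has squared norm [tr (P F Q F') / nu], where [F] is the
    conjugate of the gradient of [f]. If [U] is the multiple of [P F] given by
    this trace, the disc [t |-> (1 + t U w')^-1 (w + t U)] stays in the ball, and
    the Schwarz-Pick inequality for [f] along it is the required contractivity
    when [nu = 1]; it only improves when [nu >= 1].

    For the multiplication operators take [f = sum_al eps_al sqrt (n!/al!) z^al],
    over the exponents of degree [n], in the variables [z] of the first row. When
    the phases [eps_al] are random roots of unity of order [k + 1], expanding
    [f^k] gives a choice with [sup |f|^(2k) <= k^k (nk + 1)^s]. On the other hand
    multiplication by [f], applied to the kernel function at the origin and tested
    on combinations of kernel functions at points tending to the origin, has
    squared norm at least the number of exponents divided by
    [nu (nu + 1) ... (nu + n - 1) / n!], which grows like [n^(s - nu)]. The two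
    bounds are incompatible for large [n] once [k (s - nu) > s]. The values of the
    kernel off the diagonal come from [K(z, w) = h(-i)], where
    [h(t) = K(u + t v, u + t^* v)], [u = (z + w) / 2], [v = i (z - w) / 2]: the
    function [h] is holomorphic and its values at real [t] are on the diagonal. *)

Set Implicit Arguments.
Unset Strict Implicit.
Unset Printing Implicit Defensive.
Import Order.TTheory GRing.Theory Num.Theory.
Import numFieldNormedType.Exports.
Local Open Scope classical_set_scope.
Local Open Scope ring_scope.
Local Open Scope sesquilinear_scope.
Local Open Scope complex_scope.
Local Notation Re := (@complex.Re _).
Local Notation Im := (@complex.Im _).

(** * Complex modulus and derivatives *)

(** On the first row the kernel has the coefficients [rising nu m], while the exponents of degree
    [n] number [rising s n]. One sequence is thus compared at the parameters [s] and [nu], and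
    [nu < s] makes the quotient grow. The power [2 k] is needed because [k = 1] bounds [sup |f|^2]
    only by [n^s] up to a constant; a large [k] gives [n^(s/k)].

    The obstacle is that the kernel is given only by its diagonal and its polarization, with no
    orthogonal basis at hand. Monomials are imitated by discrete Fourier weights on a grid of radius
    [rho]. These weights have size [rho^-n] and enter the Gram matrix twice, so the kernel is needed
    up to [rho^(2n+2)]. It is compared with a truncated series, so agreement at real [t] is only
    approximate, and interpolation replaces the identity theorem in passing to [-i].

    For contractivity, the gradient row matters only through its length, so the block matrix is
    compared with a triangular Toeplitz matrix of size 2. The first two terms of Parseval's formula
    control its norm. *)

Section Cmod.
Context {R : realType}.
Implicit Types z w : R[i].

Lemma normE z : `|z| = (cmod z)%:C. Proof. by []. Qed.
Lemma cmod_ge0 z : 0 <= cmod z. Proof. by rewrite -ler0c -normE. Qed.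
Lemma cmod0 : cmod (0 : R[i]) = 0. Proof. exact: ComplexField.Normc.normc0. Qed.
Lemma cmod1 : cmod (1 : R[i]) = 1. Proof. exact: ComplexField.Normc.normc1. Qed.
Lemma cmodM z w : cmod (z * w) = cmod z * cmod w. Proof. exact: ComplexField.Normc.normcM. Qed.
Lemma cmodV z : cmod z^-1 = (cmod z)^-1. Proof. exact: ComplexField.Normc.normcV. Qed.
Lemma cmodN z : cmod (- z) = cmod z. Proof. exact: normcN. Qed.
Lemma cmodBC z w : cmod (z - w) = cmod (w - z). Proof. by rewrite -opprB cmodN. Qed.
Lemma cmodD z w : cmod (z + w) <= cmod z + cmod w. Proof. exact: le_normcD. Qed.
Lemma cmodB z w : cmod (z - w) <= cmod z + cmod w.
Proof. by rewrite -(cmodN w) cmodD. Qed.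
Lemma cmodX z n : cmod (z ^+ n) = cmod z ^+ n.
Proof. by elim: n => [|n IH]; rewrite ?expr0 ?cmod1 // !exprS cmodM IH. Qed.
Lemma cmod_eq0 z : (cmod z == 0) = (z == 0).
Proof. by apply/eqP/eqP => [/ComplexField.Normc.eq0_normc//|->]; rewrite cmod0. Qed.
Lemma cmod_gt0 z : (0 < cmod z) = (z != 0).
Proof. by rewrite lt_def cmod_ge0 andbT cmod_eq0. Qed.
Lemma cmod_sum (I : Type) (r : seq I) (P : pred I) (F : I -> R[i]) :
  cmod (\sum_(i <- r | P i) F i) <= \sum_(i <- r | P i) cmod (F i).
Proof.
elim/big_rec2: _ => [|i y z _ h]; first by rewrite cmod0.
by apply: le_trans (cmodD _ _) _; rewrite lerD2l.
Qed.
Lemma cmod_prod (I : Type) (r : seq I) (P : pred I) (F : I -> R[i]) :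
  cmod (\prod_(i <- r | P i) F i) = \prod_(i <- r | P i) cmod (F i).
Proof. exact: (big_morph cmod cmodM cmod1). Qed.
Lemma cmod_real (x : R) : cmod x%:C = `|x|.
Proof. by rewrite /cmod /= expr0n /= addr0 sqrtr_sqr. Qed.
Lemma cmod_i : cmod ('i : R[i]) = 1.
Proof. by rewrite /cmod /= expr0n /= add0r expr1n sqrtr1. Qed.
Lemma sqr_cmod z : cmod z ^+ 2 = Re z ^+ 2 + Im z ^+ 2.
Proof. by case: z => a b; rewrite /cmod /= sqr_sqrtr // addr_ge0 ?sqr_ge0. Qed.
Lemma Re_le_cmod z : `|Re z| <= cmod z.
Proof. by rewrite -lecR; exact: normc_ge_Re. Qed.
Lemma Im_le_cmod z : `|Im z| <= cmod z.
Proof.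
by rewrite -ler_sqr ?nnegrE ?cmod_ge0 // real_normK ?num_real // sqr_cmod lerDr sqr_ge0.
Qed.
Lemma cmod_le_ReIm z : cmod z <= `|Re z| + `|Im z|.
Proof.
rewrite {1}[z]complexE; apply: le_trans (cmodD _ _) _.
by rewrite cmodM cmod_i mul1r !cmod_real.
Qed.
Lemma conjCE z : z^*%R = z^*%C.
Proof.
case: (eqVneq z 0) => [->|z0]; first by rewrite !rmorph0.
by apply: (mulfI z0); rewrite -normCK sqr_normc.
Qed.
Lemma cmod_conj z : cmod z^*%R = cmod z.
Proof. by rewrite conjCE; case: z => a b; rewrite /cmod /= sqrrN. Qed.
Lemma mulC_conj z : z * z^*%R = (cmod z ^+ 2)%:C.
Proof. by rewrite -normCK normE -rmorphXn. Qed.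
Lemma Re_add z w : Re (z + w) = Re z + Re w. Proof. by case: z w => a b [c d]. Qed.
Lemma Im_add z w : Im (z + w) = Im z + Im w. Proof. by case: z w => a b [c d]. Qed.
Lemma Re_opp z : Re (- z) = - Re z. Proof. by case: z. Qed.
Lemma Im_opp z : Im (- z) = - Im z. Proof. by case: z. Qed.
Lemma Re_mul z w : Re (z * w) = Re z * Re w - Im z * Im w. Proof. by case: z w => a b [c d]. Qed.
Lemma Im_mul z w : Im (z * w) = Re z * Im w + Im z * Re w. Proof. by case: z w => a b [c d]. Qed.
Lemma Re_conj z : Re z^*%R = Re z. Proof. by rewrite conjCE; case: z. Qed.
Lemma Im_conj z : Im z^*%R = - Im z. Proof. by rewrite conjCE; case: z. Qed.
Lemma conj_realC (x : R) : (x%:C)^*%R = x%:C. Proof. by rewrite conjCE conjc_real. Qed.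
Lemma complex_eq z w : Re z = Re w -> Im z = Im w -> z = w.
Proof. by case: z w => a b [c d] /= -> ->. Qed.

Lemma cnearP z (P : R[i] -> Prop) :
  (\forall x \near z, P x) <-> exists2 e : R, 0 < e & forall x, cmod (x - z) < e -> P x.
Proof.
split=> [/nbhs_ballP[e /= e0 h]|[e e0 h]].
  have eR : e = (Re e)%:C.
    by move: e0; case: (e) => a b; rewrite ltcE /= => /andP[/eqP -> _].
  exists (Re e); first by rewrite -ltcR -eR.
  by move=> x hx; apply: h; rewrite -ball_normE /= normE eR ltcR cmodBC.
apply/nbhs_ballP; exists e%:C => /=; first by rewrite ltcR.
by move=> x; rewrite -ball_normE /= normE ltcR => hx; apply: h; rewrite cmodBC.
Qed.

Lemma ccvgP {T : Type} (F : set_system T) {FF : Filter F} (g : T -> R[i]) l :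
  g @ F --> l <-> forall e : R, 0 < e -> \forall x \near F, cmod (g x - l) < e.
Proof.
split=> [h e e0|h].
  have /cvgrPdist_lt/(_ e%:C) := h; rewrite ltcR => /(_ e0).
  by apply: filterS => x; rewrite normE ltcR cmodBC.
apply/cvgrPdist_lt => e e0.
have eR : e = (Re e)%:C.
  by move: e0; case: (e) => a b; rewrite ltcE /= => /andP[/eqP -> _].
move: e0; rewrite eR ltcR => /h; apply: filterS => x.
by rewrite normE ltcR cmodBC.
Qed.

Lemma ccontP (g : R[i] -> R[i]) z :
  {for z, continuous g} <->
  forall e : R, 0 < e -> exists2 d : R, 0 < d & forall x, cmod (x - z) < d -> cmod (g x - g z) < e.
Proof.
split=> [/ccvgP h e e0|h]; first by apply/(cnearP z); exact: h.
by apply/(@ccvgP _ (nbhs z)) => e /h hh; apply/(cnearP z).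
Qed.

Lemma rcontP (g : R -> R[i]) t :
  {for t, continuous g} <->
  forall e : R, 0 < e -> exists2 d : R, 0 < d & forall x, `|x - t| < d -> cmod (g x - g t) < e.
Proof.
split=> [/ccvgP h e /h /nbhs_ballP[d /= d0 hd]|h].
  by exists d => // x hx; apply: hd; rewrite -ball_normE /= distrC.
apply/(@ccvgP _ (nbhs t)) => e /h [d d0 hd]; apply/nbhs_ballP; exists d => //= x.
by rewrite -ball_normE /= => hx; apply: hd; rewrite distrC.
Qed.

Lemma Re_continuous (g : R -> R[i]) t : {for t, continuous g} -> {for t, continuous (Re \o g)}.
Proof.
move=> /rcontP h; apply/cvgrPdist_lt => e /h [d d0 hd].
apply/nbhs_ballP; exists d => //= x; rewrite /= distrC => /hd.
by apply: le_lt_trans; rewrite distrC -Re_opp -Re_add Re_le_cmod.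
Qed.

Lemma Im_continuous (g : R -> R[i]) t : {for t, continuous g} -> {for t, continuous (Im \o g)}.
Proof.
move=> /rcontP h; apply/cvgrPdist_lt => e /h [d d0 hd].
apply/nbhs_ballP; exists d => //= x; rewrite /= distrC => /hd.
by apply: le_lt_trans; rewrite distrC -Im_opp -Im_add Im_le_cmod.
Qed.


(** Clearing the denominator [x - z] lets the estimate include the point [x = z], so that later uses
    need no case distinction. The converse starts from [e / 2] to recover a strict inequality. *)
Lemma is_deriveCP (g : R[i] -> R[i]) z (d : R[i]) :
  is_derive z 1 g d <->
  forall e : R, 0 < e -> exists2 del : R, 0 < del &
    forall x, cmod (x - z) < del -> cmod (g x - g z - d * (x - z)) <= e * cmod (x - z).
Proof.
have key : is_derive z 1 g d <-> (fun h => h^-1 *: ((g \o shift z) (h *: 1) - g z)) @ 0^' --> d.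
  split=> [[dg <-]//|h]; split; first by apply/cvg_ex; exists d.
  exact: (cvg_lim (@norm_hausdorff _ _) h).
have alg h : h != 0 -> h^-1 *: ((g \o shift z) (h *: 1) - g z) - d =
    h^-1 * (g (h + z) - g z - d * h).
  by move=> h0; rewrite /= -[h *: 1]/(h * 1) mulr1 -[_ *: _]/(_ * _) [RHS]mulrBr (mulrC d) mulKf.
split=> [/key/ccvgP h e e0|h].
  have [del del0 hd] := (cnearP _ _).1 (h e e0).
  exists del => // x hx; have [->|xz] := eqVneq x z.
    by rewrite !subrr mulr0 subrr cmod0 mulr0.
  have hz : x - z != 0 by rewrite subr_eq0.
  have := hd (x - z); rewrite subr0 => /(_ hx hz).
  rewrite alg // subrK cmodM cmodV => hh.
  by rewrite -ler_pdivrMr ?cmod_gt0 // mulrC ltW.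
apply/key/ccvgP => e e0.
have e20 : 0 < e / 2 by rewrite divr_gt0.
have [del del0 hd] := h _ e20.
apply/cnearP; exists del => // x; rewrite subr0 => hx x0.
rewrite alg // cmodM cmodV mulrC ltr_pdivrMr ?cmod_gt0 //.
have := hd (x + z); rewrite addrK => /(_ hx) /le_lt_trans; apply.
by rewrite ltr_pM2r ?cmod_gt0 // gtr_pMr // invf_lt1 // ltr1n.
Qed.

Section ForContinuous.
Context {T : topologicalType}.
Implicit Types (f g : T -> R[i]) (x : T).

Lemma for_contD f g x : {for x, continuous f} -> {for x, continuous g} ->
  {for x, continuous (fun y => f y + g y)}.
Proof. by move=> cf cg; apply: cvgD; [exact: cf|exact: cg]. Qed.
Lemma for_contB f g x : {for x, continuous f} -> {for x, continuous g} ->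
  {for x, continuous (fun y => f y - g y)}.
Proof. by move=> cf cg; apply: cvgB; [exact: cf|exact: cg]. Qed.
Lemma for_contM f g x : {for x, continuous f} -> {for x, continuous g} ->
  {for x, continuous (fun y => f y * g y)}.
Proof. by move=> cf cg; apply: cvgM; [exact: cf|exact: cg]. Qed.
Lemma for_cont_cst (k : R[i]) x : {for x, continuous (fun _ : T => k)}.
Proof. exact: cvg_cst. Qed.
Lemma for_contV f x : f x != 0 -> {for x, continuous f} ->
  {for x, continuous (fun y => (f y)^-1)}.
Proof. by move=> f0 cf; apply: cvgV. Qed.
Lemma for_contX f n x : {for x, continuous f} -> {for x, continuous (fun y => f y ^+ n)}.
Proof.
move=> cf; elim: n => [|n IH]; first exact: for_cont_cst.
rewrite (_ : (fun y => _) = (fun y => f y * f y ^+ n)); first exact: for_contM.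
by apply/funext => y; rewrite exprS.
Qed.
Lemma for_cont_sum (I : Type) (r : seq I) (P : pred I) (F : I -> T -> R[i]) x :
  (forall i, P i -> {for x, continuous (F i)}) ->
  {for x, continuous (fun y => \sum_(i <- r | P i) F i y)}.
Proof.
move=> h; elim: r => [|i r IH].
  rewrite (_ : (fun y => _) = (fun=> 0)); first exact: for_cont_cst.
  by apply/funext => y; rewrite big_nil.
have [Pi|nPi] := boolP (P i).
  rewrite (_ : (fun y => _) = (fun y => F i y + \sum_(j <- r | P j) F j y)).
    by apply: for_contD; [exact: h|exact: IH].
  by apply/funext => y; rewrite big_cons Pi.
rewrite (_ : (fun y => _) = (fun y => \sum_(j <- r | P j) F j y)); first exact: IH.
by apply/funext => y; rewrite big_cons (negbTE nPi).
Qed.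
Lemma for_cont_conj f x : {for x, continuous f} -> {for x, continuous (fun y => (f y)^*%R)}.
Proof.
move=> /(@ccvgP _ (nbhs x)) h; apply/(@ccvgP _ (nbhs x)) => e /h.
by apply: filterS => y; rewrite -rmorphB cmod_conj.
Qed.
End ForContinuous.

Lemma for_cont_id (z : R[i]) : {for z, continuous (fun y : R[i] => y)}.
Proof. exact: cvg_id. Qed.

End Cmod.
Arguments cmod {R} z : simpl never.

(** * Integrals along segments *)

Section Integral.
Context {R : realType}.
Local Notation mu := (@lebesgue_measure R).
Implicit Types (f : R -> R) (h : R -> R[i]) (a b c t : R).

Definition RI f a b : R := \int[mu]_(t in `[a, b]) f t.
Definition CI h a b : R[i] := RI (Re \o h) a b +i* RI (Im \o h) a b.
Definition segc {T : topologicalType} (h : R -> T) a b :=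
  forall t, a <= t <= b -> {for t, continuous h}.

Lemma segc_integrable f a b : segc f a b -> mu.-integrable `[a, b] (EFin \o f).
Proof.
move=> cf; apply: continuous_compact_integrable; first exact: segment_compact.
by apply: continuous_in_subspaceT => t; rewrite inE /= in_itv /= => /cf.
Qed.

Lemma segc_Re h a b : segc h a b -> segc (Re \o h) a b.
Proof. by move=> ch t /ch /Re_continuous. Qed.
Lemma segc_Im h a b : segc h a b -> segc (Im \o h) a b.
Proof. by move=> ch t /ch /Im_continuous. Qed.

Lemma segcD h1 h2 a b : segc h1 a b -> segc h2 a b -> segc (fun t => h1 t + h2 t) a b.
Proof. by move=> c1 c2 t tab; apply: cvgD; [exact: c1 | exact: c2]. Qed.
Lemma segcM h1 h2 a b : segc h1 a b -> segc h2 a b -> segc (fun t => h1 t * h2 t) a b.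
Proof. by move=> c1 c2 t tab; apply: cvgM; [exact: c1 | exact: c2]. Qed.
Lemma segcN h1 a b : segc h1 a b -> segc (fun t => - h1 t) a b.
Proof. by move=> c1 t tab; apply: cvgN; exact: c1. Qed.
Lemma segc_cst (k : R[i]) a b : segc (fun=> k) a b.
Proof. by move=> t tab; exact: cvg_cst. Qed.
Lemma segc_realC a b : segc (fun t => t%:C) a b.
Proof.
move=> t _; apply/rcontP => e e0; exists e => // x.
by rewrite -rmorphB cmod_real.
Qed.
Lemma segcZ (k : R[i]) h a b : segc h a b -> segc (fun t => k * h t) a b.
Proof. by move=> c1; exact: (segcM (@segc_cst k a b) c1). Qed.

Lemma RI_ext f g a b : (forall t, a <= t <= b -> f t = g t) -> RI f a b = RI g a b.
Proof.
by move=> fg; apply: eq_Rintegral => t; rewrite inE /= in_itv /= => /fg.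
Qed.

Lemma RID f g a b : segc f a b -> segc g a b ->
  RI (fun t => f t + g t) a b = RI f a b + RI g a b.
Proof. by move=> cf cg; apply: RintegralD => //; exact: segc_integrable. Qed.

Lemma RIZ k f a b : segc f a b -> RI (fun t => k * f t) a b = k * RI f a b.
Proof. by move=> cf; apply: RintegralZl => //; exact: segc_integrable. Qed.

Lemma RI_cst k a b : a <= b -> RI (fun=> k) a b = k * (b - a).
Proof.
move=> ab; rewrite /RI Rintegral_cst //=; rewrite [X in fine X]lebesgue_measure_itv /= lte_fin.
by move: ab; rewrite le_eqVlt => /predU1P[->|->] //; rewrite ltxx subrr.
Qed.

Lemma RI_ge0 f a b : (forall t, a <= t <= b -> 0 <= f t) -> 0 <= RI f a b.
Proof. by move=> f0; apply: Rintegral_ge0 => t; rewrite /= in_itv /= => /f0. Qed.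

Lemma RI_le f g a b : segc f a b -> segc g a b ->
  (forall t, a <= t <= b -> f t <= g t) -> RI f a b <= RI g a b.
Proof.
move=> cf cg fg; apply: le_Rintegral => //; try exact: segc_integrable.
Qed.

Lemma RI_cat f a b c : a <= c -> c <= b -> segc f a b ->
  RI f a b = RI f a c + RI f c b.
Proof.
move=> ac cb cf; have := segc_integrable cf => if_.
have := @Rintegral_itvB R f (BLeft a) (BRight b) c if_.
rewrite !bnd_simp => /(_ ac cb) => e.
have := @Rintegral_itv_obnd_cbnd R c (BRight b) f.
rewrite /RI => <-; first by rewrite -e; ring.
apply: integrableS if_ => //.
by apply: subset_itvr; rewrite bnd_simp.
Qed.

Lemma RI_bound f a b B : a <= b -> segc f a b ->
  (forall t, a <= t <= b -> `|f t| <= B) -> `|RI f a b| <= B * (b - a).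
Proof.
move=> ab cf fB; rewrite -RI_cst //.
have cB k : segc (fun=> k : R) a b by move=> t _; exact: cvg_cst.
rewrite ler_norml; apply/andP; split; last first.
  by apply: RI_le => // t /fB; exact/le_trans/ler_norm.
rewrite [X in - X]RI_cst // -mulNr -RI_cst //.
by apply: RI_le => // t /fB; rewrite ler_norml => /andP[].
Qed.

Lemma RI_id a b : a <= b -> RI id a b = (b ^+ 2 - a ^+ 2) / 2.
Proof.
rewrite le_eqVlt => /predU1P[->|ab].
  by rewrite /RI set_itv1 Rintegral_set1 subrr mul0r.
rewrite /RI /Rintegral (@continuous_FTC2 _ _ (fun x => x ^+ 2 / 2)) //=.
- by rewrite mulrBl.
- by apply: continuous_subspaceT => t; exact: cvg_id.
- have dd x : derivable (fun x : R => x ^+ 2 / 2) x 1 by [].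
  have cc x : {for x, continuous (fun x : R => x ^+ 2 / 2)}.
    by apply/differentiable_continuous/derivable1_diffP.
  split => //; [exact/cvg_at_right_filter/cc | exact/cvg_at_left_filter/cc].
- move=> x _ /=; rewrite derive1E.
  have -> : (fun x : R => x ^+ 2 / 2) = (fun x => 2^-1 *: x ^+ 2).
    by apply/funext => y; rewrite mulrC.
  rewrite deriveZ //= exp_derive /= !scaler1 expr1 [_ *: _]/(_ * _).
  by rewrite -[LHS]/(2^-1 * (2 *: x)) -[2 *: x]/(2 * x); field.
Qed.

Lemma CI_ext h1 h2 a b : (forall t, a <= t <= b -> h1 t = h2 t) -> CI h1 a b = CI h2 a b.
Proof. by move=> e; congr Complex; apply: RI_ext => t /e /= ->. Qed.

Lemma CID h1 h2 a b : segc h1 a b -> segc h2 a b ->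
  CI (fun t => h1 t + h2 t) a b = CI h1 a b + CI h2 a b.
Proof.
move=> c1 c2; apply: complex_eq.
  rewrite Re_add /= -RID; [|exact: segc_Re|exact: segc_Re].
  by apply: RI_ext => t _ /=; rewrite Re_add.
rewrite Im_add /= -RID; [|exact: segc_Im|exact: segc_Im].
by apply: RI_ext => t _ /=; rewrite Im_add.
Qed.

Lemma CIZ (k : R[i]) h a b : segc h a b -> CI (fun t => k * h t) a b = k * CI h a b.
Proof.
move=> c1; have cr := segc_Re c1; have ci := segc_Im c1.
have cZ c f : segc f a b -> segc (fun t => c * f t) a b.
  by move=> cf t tab; apply: cvgM; [exact: cvg_cst | exact: cf].
apply: complex_eq.
  rewrite Re_mul /= -!RIZ // -mulN1r -RIZ; last exact: cZ.
  rewrite -RID; [|exact: cZ|exact: (cZ _ _ (cZ _ _ ci))].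
  by apply: RI_ext => t _ /=; rewrite Re_mul mulN1r.
rewrite Im_mul /= -!RIZ // -RID; [|exact: cZ|exact: cZ].
by apply: RI_ext => t _ /=; rewrite Im_mul.
Qed.

Lemma CIN h a b : segc h a b -> CI (fun t => - h t) a b = - CI h a b.
Proof.
by move=> c; rewrite -mulN1r -CIZ //; apply: CI_ext => t _; rewrite mulN1r.
Qed.

Lemma CI_cst (k : R[i]) a b : a <= b -> CI (fun=> k) a b = k * (b - a)%:C.
Proof.
move=> ab; rewrite /CI; apply: complex_eq => /=.
  by rewrite Re_mul /= mulr0 subr0 -RI_cst.
by rewrite Im_mul /= mulr0 add0r -RI_cst.
Qed.

Lemma CI_realC a b : a <= b -> CI (fun t => t%:C) a b = ((b ^+ 2 - a ^+ 2) / 2)%:C.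
Proof.
move=> ab; rewrite /CI; apply: complex_eq => /=; first by rewrite -RI_id.
by rewrite -(mul0r (b - a)) -RI_cst.
Qed.

Lemma CI_affine (k d : R[i]) a b : a <= b ->
  CI (fun t => k + d * t%:C) a b = k * (b - a)%:C + d * ((b ^+ 2 - a ^+ 2) / 2)%:C.
Proof.
move=> ab; have cr := @segc_realC a b.
rewrite CID; [|exact: segc_cst|exact: segcZ].
by rewrite CI_cst // CIZ // CI_realC.
Qed.

Lemma CI_cat h a b c : a <= c -> c <= b -> segc h a b ->
  CI h a b = CI h a c + CI h c b.
Proof.
move=> ac cb ch; have cr := segc_Re ch; have ci := segc_Im ch.
by apply: complex_eq => /=; rewrite ?Re_add ?Im_add /=; apply: RI_cat.
Qed.

(** The factor 2 comes from bounding the real and imaginary parts separately. It is harmless: such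
    bounds serve only for limits and unspecified constants, and the sharp inequalities rest on the
    positivity in [cmean_ge0]. *)
Lemma CI_bound h a b B : a <= b -> segc h a b ->
  (forall t, a <= t <= b -> cmod (h t) <= B) -> cmod (CI h a b) <= 2 * B * (b - a).
Proof.
move=> ab ch hB; have cr := segc_Re ch; have ci := segc_Im ch.
apply: le_trans (cmod_le_ReIm _) _ => /=.
rewrite -mulrA mulr_natl mulr2n; apply: lerD; apply: RI_bound => // t /hB.
  exact/le_trans/Re_le_cmod.
exact/le_trans/Im_le_cmod.
Qed.

End Integral.
Arguments CI {R} h a b : simpl never.

(** * Goursat's lemma *)

Section Goursat.
Context {R : realType}.

Lemma sequence_choice (T : Type) (Q : nat -> T -> T -> Prop) (I : nat -> T -> Prop) (x0 : T) :
  I 0%N x0 -> (forall k x, I k x -> exists y, I k.+1 y /\ Q k x y) ->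
  exists u : nat -> T, [/\ u 0%N = x0, forall k, I k (u k) & forall k, Q k (u k) (u k.+1)].
Proof.
move=> I0 step.
have /choice[s hs] : forall kx : nat * T, exists y, I kx.1 kx.2 -> I kx.1.+1 y /\ Q kx.1 kx.2 y.
  move=> [k x] /=; have [/step[y Iy]|nI] := pselect (I k x); first by exists y.
  by exists x.
pose u := fix u k := if k is k'.+1 then s (k', u k') else x0.
have Iu k : I k (u k) by elim: k => [//|k IH]; have [] := hs (k, u k) IH.
by exists u; split=> // k; have [] := hs (k, u k) (Iu k).
Qed.

(** The left ends never decrease and the right ends never increase, so the supremum of the left ends
    lies in every interval. *)
Lemma nested_halves (u : nat -> R) (L : R) : 0 <= L ->
  (forall k, u k.+1 = u k \/ u k.+1 = u k + L / 2 ^+ k.+1) ->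
  exists p, forall k, u k <= p <= u k + L / 2 ^+ k.
Proof.
move=> L0 hu.
have LE k : L / 2 ^+ k = L / 2 ^+ k.+1 + L / 2 ^+ k.+1.
  by rewrite exprS; field; rewrite expf_neq0.
have L0k k : 0 <= L / 2 ^+ k by rewrite divr_ge0 // exprn_ge0.
have up k m : u k <= u (k + m)%N.
  elim: m => [|m IH]; first by rewrite addn0.
  rewrite addnS; apply: le_trans IH _; case: (hu (k + m)%N) => -> //.
  by rewrite lerDl.
have dn k m : u (k + m)%N + L / 2 ^+ (k + m) <= u k + L / 2 ^+ k.
  elim: m => [|m IH]; first by rewrite addn0.
  rewrite addnS; apply: le_trans _ IH; rewrite (LE (k + m)%N).
  by have := L0k (k + m).+1; case: (hu (k + m)%N) => ->; lra.
have ub k m : u m <= u k + L / 2 ^+ k.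
  have [km|mk] := leqP k m.
    rewrite -(subnKC km); apply: le_trans (dn k (m - k)%N).
    by rewrite lerDl.
  have := up m (k - m)%N; rewrite (subnKC (ltnW mk)) => h.
  by apply: le_trans h _; rewrite lerDl.
have hs : has_sup (range u).
  split; first by exists (u 0%N); exists 0%N.
  by exists (u 0%N + L / 2 ^+ 0) => _ [m _ <-].
exists (sup (range u)) => k; apply/andP; split.
  by apply: ub_le_sup; [case: hs | exists k].
by apply: ge_sup; [case: hs | move=> _ [m _ <-]].
Qed.

Definition in_box (x0 y0 L M : R) k (a : R * R) :=
    [/\ x0 <= a.1, a.1 + L / 2 ^+ k <= x0 + L, y0 <= a.2 & a.2 + M / 2 ^+ k <= y0 + M].

(** If [P] failed on the whole rectangle, it would fail on some quarter at every step. The nested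
    quarters meet in a point [(p, q)], where the last hypothesis gives a contradiction. A box of
    level [k] is recorded by its lower left corner alone, since the level fixes its sides. *)
Lemma bisection2 (P : nat -> R * R -> Prop) (x0 y0 L M : R) : 0 <= L -> 0 <= M ->
  (forall k a, in_box x0 y0 L M k a ->
    P k.+1 a -> P k.+1 (a.1 + L / 2 ^+ k.+1, a.2) -> P k.+1 (a.1, a.2 + M / 2 ^+ k.+1) ->
    P k.+1 (a.1 + L / 2 ^+ k.+1, a.2 + M / 2 ^+ k.+1) -> P k a) ->
  (forall p q, x0 <= p <= x0 + L -> y0 <= q <= y0 + M ->
    exists k, forall a, in_box x0 y0 L M k a -> a.1 <= p <= a.1 + L / 2 ^+ k ->
      a.2 <= q <= a.2 + M / 2 ^+ k -> P k a) ->
  P 0%N (x0, y0).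
Proof.
move=> L0 M0 split loc; apply: contrapT => nP.
have L0k k : 0 <= L / 2 ^+ k by rewrite divr_ge0 // exprn_ge0.
have M0k k : 0 <= M / 2 ^+ k by rewrite divr_ge0 // exprn_ge0.
have LE N k : N / 2 ^+ k = N / 2 ^+ k.+1 + N / 2 ^+ k.+1 :> R.
  by rewrite exprS; field; rewrite expf_neq0.
pose I k a := in_box x0 y0 L M k a /\ ~ P k a.
pose Q (k : nat) (a b : R * R) := (b.1 = a.1 \/ b.1 = a.1 + L / 2 ^+ k.+1) /\
                        (b.2 = a.2 \/ b.2 = a.2 + M / 2 ^+ k.+1).
have I0 : I 0%N (x0, y0) by split=> //; split=> //=; rewrite expr0 divr1.
have step k a : I k a -> exists b, I k.+1 b /\ Q k a b.
  case=> ina nPa; apply: contrapT => nex; apply: nPa.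
  have [h1 h2 h3 h4] := ina.
  have lk := L0k k.+1; have mk := M0k k.+1; have le := LE L k; have me := LE M k.
  have key b : in_box x0 y0 L M k.+1 b -> Q k a b -> P k.+1 b.
    by move=> inb qb; apply: contrapT => nPb; apply: nex; exists b.
  apply: split => //; apply: key; rewrite /in_box /Q /=.
  - by split; lra.
  - by split; left.
  - by split; lra.
  - by split; [right|left].
  - by split; lra.
  - by split; [left|right].
  - by split; lra.
  - by split; right.
have [u [u0 Iu Qu]] := sequence_choice I0 step.
have [p hp] := nested_halves L0 (fun k => (Qu k).1).
have [q hq] := nested_halves M0 (fun k => (Qu k).2).
have [] := loc p q.
- by have := hp 0%N; rewrite u0 /= expr0 divr1.
- by have := hq 0%N; rewrite u0 /= expr0 divr1.
move=> k /(_ (u k)) hk; have [inb nPk] := Iu k.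
by apply: nPk; apply: hk.
Qed.

Variable F : R[i] -> R[i].

Definition hseg (G : R[i] -> R[i]) y := fun x : R => G (x +i* y).
Definition vseg (G : R[i] -> R[i]) x := fun y : R => G (x +i* y).

Definition boundary_integral (G : R[i] -> R[i]) x1 x2 y1 y2 :=
  CI (hseg G y1) x1 x2 - CI (hseg G y2) x1 x2
  + 'i * (CI (vseg G x2) y1 y2 - CI (vseg G x1) y1 y2).

Lemma cmod_hor (x x' y : R) : cmod ((x +i* y) - (x' +i* y)) = `|x - x'|.
Proof.
have -> : (x +i* y) - (x' +i* y) = (x - x')%:C by apply: complex_eq => //=; rewrite subrr.
by rewrite cmod_real.
Qed.

Lemma cmod_ver (x y y' : R) : cmod ((x +i* y) - (x +i* y')) = `|y - y'|.
Proof.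
have -> : (x +i* y) - (x +i* y') = 'i * (y - y')%:C.
  by apply: complex_eq => //=; ring.
by rewrite cmodM cmod_i mul1r cmod_real.
Qed.

Lemma hseg_cont (G : R[i] -> R[i]) x y :
  {for (x +i* y), continuous G} -> {for x, continuous (hseg G y)}.
Proof.
move=> /ccontP h; apply/rcontP => e /h [d d0 hd]; exists d => // x' hx.
by apply: hd; rewrite cmod_hor.
Qed.

Lemma vseg_cont (G : R[i] -> R[i]) x y :
  {for (x +i* y), continuous G} -> {for y, continuous (vseg G x)}.
Proof.
move=> /ccontP h; apply/rcontP => e /h [d d0 hd]; exists d => // y' hy.
by apply: hd; rewrite cmod_ver.
Qed.

Definition cont_box (G : R[i] -> R[i]) x1 x2 y1 y2 := forall x y,
  x1 <= x <= x2 -> y1 <= y <= y2 -> {for (x +i* y), continuous G}.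

Lemma cont_box_h G x1 x2 y1 y2 y : cont_box G x1 x2 y1 y2 -> y1 <= y <= y2 ->
  segc (hseg G y) x1 x2.
Proof. by move=> c hy x hx; apply: hseg_cont; exact: c. Qed.
Lemma cont_box_v G x1 x2 y1 y2 x : cont_box G x1 x2 y1 y2 -> x1 <= x <= x2 ->
  segc (vseg G x) y1 y2.
Proof. by move=> c hx y hy; apply: vseg_cont; exact: c. Qed.

Arguments boundary_integral : simpl never.

Lemma boundary_integralD G H x1 x2 y1 y2 : x1 <= x2 -> y1 <= y2 ->
  cont_box G x1 x2 y1 y2 -> cont_box H x1 x2 y1 y2 ->
  boundary_integral (fun z => G z + H z) x1 x2 y1 y2 =
  boundary_integral G x1 x2 y1 y2 + boundary_integral H x1 x2 y1 y2.
Proof.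
move=> hx hy cG cH; rewrite /boundary_integral.
have y1i : y1 <= y1 <= y2 by rewrite lexx.
have y2i : y1 <= y2 <= y2 by rewrite lexx andbT.
have x1i : x1 <= x1 <= x2 by rewrite lexx.
have x2i : x1 <= x2 <= x2 by rewrite lexx andbT.
rewrite (CID (cont_box_h cG y1i) (cont_box_h cH y1i)).
rewrite (CID (cont_box_h cG y2i) (cont_box_h cH y2i)).
rewrite (CID (cont_box_v cG x1i) (cont_box_v cH x1i)).
rewrite (CID (cont_box_v cG x2i) (cont_box_v cH x2i)).
ring.
Qed.

Lemma boundary_integral_affine (k d : R[i]) x1 x2 y1 y2 : x1 <= x2 -> y1 <= y2 ->
  boundary_integral (fun z => k + d * z) x1 x2 y1 y2 = 0.
Proof.
move=> hx hy; rewrite /boundary_integral.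
have eh y : CI (hseg (fun z => k + d * z) y) x1 x2 =
    CI (fun x => (k + d * ('i * y%:C)) + d * x%:C) x1 x2.
  apply: CI_ext => x _; rewrite /hseg.
  have -> : x +i* y = x%:C + 'i * y%:C by rewrite [LHS]complexE.
  ring.
have ev x : CI (vseg (fun z => k + d * z) x) y1 y2 =
    CI (fun y => (k + d * x%:C) + (d * 'i) * y%:C) y1 y2.
  apply: CI_ext => y _; rewrite /vseg.
  have -> : x +i* y = x%:C + 'i * y%:C by rewrite [LHS]complexE.
  ring.
rewrite !eh !ev !CI_affine //.
have i2 : 'i * 'i = -1 :> R[i] by rewrite -expr2 sqr_i.
rewrite -[d * 'i * _]mulrA; set A := (_ / _)%:C; set B := (_ / _)%:C.
rewrite !rmorphB /= !mulrDr.
ring.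
Qed.

Lemma boundary_integral_bound G x1 x2 y1 y2 B : x1 <= x2 -> y1 <= y2 ->
  cont_box G x1 x2 y1 y2 ->
  (forall x y, x1 <= x <= x2 -> y1 <= y <= y2 -> cmod (G (x +i* y)) <= B) ->
  cmod (boundary_integral G x1 x2 y1 y2) <= 4 * B * ((x2 - x1) + (y2 - y1)).
Proof.
move=> hx hy cG hB.
have y1i : y1 <= y1 <= y2 by rewrite lexx.
have y2i : y1 <= y2 <= y2 by rewrite lexx andbT.
have x1i : x1 <= x1 <= x2 by rewrite lexx.
have x2i : x1 <= x2 <= x2 by rewrite lexx andbT.
have hh y : y1 <= y <= y2 -> cmod (CI (hseg G y) x1 x2) <= 2 * B * (x2 - x1).
  by move=> yi; apply: CI_bound => //; [exact: cont_box_h cG yi | move=> x /hB; apply].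
have hv x : x1 <= x <= x2 -> cmod (CI (vseg G x) y1 y2) <= 2 * B * (y2 - y1).
  by move=> xi; apply: CI_bound => //; [exact: cont_box_v cG xi | move=> y; exact: hB].
apply: le_trans (cmodD _ _) _; rewrite cmodM cmod_i mul1r.
have := cmodB (CI (hseg G y1) x1 x2) (CI (hseg G y2) x1 x2).
have := cmodB (CI (vseg G x2) y1 y2) (CI (vseg G x1) y1 y2).
have := hh _ y1i; have := hh _ y2i; have := hv _ x1i; have := hv _ x2i; lra.
Qed.

Lemma boundary_integral_split G x1 x2 y1 y2 xm ym :
  x1 <= xm <= x2 -> y1 <= ym <= y2 -> cont_box G x1 x2 y1 y2 ->
  boundary_integral G x1 x2 y1 y2 =
    boundary_integral G x1 xm y1 ym + boundary_integral G xm x2 y1 ym +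
    boundary_integral G x1 xm ym y2 + boundary_integral G xm x2 ym y2.
Proof.
move=> /andP[xm1 xm2] /andP[ym1 ym2] cG; rewrite /boundary_integral.
have hx := le_trans xm1 xm2; have hy := le_trans ym1 ym2.
have y1i : y1 <= y1 <= y2 by rewrite lexx.
have y2i : y1 <= y2 <= y2 by rewrite lexx andbT.
have x1i : x1 <= x1 <= x2 by rewrite lexx.
have x2i : x1 <= x2 <= x2 by rewrite lexx andbT.
rewrite (CI_cat xm1 xm2 (cont_box_h cG y1i)) (CI_cat xm1 xm2 (cont_box_h cG y2i)).
rewrite (CI_cat ym1 ym2 (cont_box_v cG x1i)) (CI_cat ym1 ym2 (cont_box_v cG x2i)).
ring.
Qed.

Theorem goursat x1 x2 y1 y2 : x1 < x2 -> y1 < y2 ->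
  (forall x y, x1 <= x <= x2 -> y1 <= y <= y2 -> differentiable F (x +i* y)) ->
  boundary_integral F x1 x2 y1 y2 = 0.
Proof.
move=> hx hy dF.
have cF : cont_box F x1 x2 y1 y2.
  by move=> x y xi yi; apply: differentiable_continuous; exact: dF.
apply/eqP; rewrite -cmod_eq0 eq_le cmod_ge0 andbT.
apply/ler_addgt0Pr => e e0; rewrite add0r.
pose L := x2 - x1; pose M := y2 - y1.
have L0 : 0 < L by rewrite subr_gt0.
have M0 : 0 < M by rewrite subr_gt0.
have Lk k : 0 < L / 2 ^+ k by rewrite divr_gt0 // exprn_gt0.
have Mk k : 0 < M / 2 ^+ k by rewrite divr_gt0 // exprn_gt0.
(* The error allowed at level [k] is proportional to the area of the box, so the errors of four
   quarters add up to the error of their union. *)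
pose P k (a : R * R) := cmod (boundary_integral F a.1 (a.1 + L / 2 ^+ k) a.2 (a.2 + M / 2 ^+ k))
  <= e / (2 ^+ k) ^+ 2.
suff : P 0%N (x1, y1) by rewrite /P /= !expr0 expr1n !divr1 /L /M !subrKC.
have sub k a : in_box x1 y1 L M k a ->
    cont_box F a.1 (a.1 + L / 2 ^+ k) a.2 (a.2 + M / 2 ^+ k).
  move=> [h1 h2 h3 h4] x y /andP[xa xb] /andP[ya yb]; apply: cF.
    by move: h2; rewrite /L subrKC => h2; rewrite (le_trans h1) // (le_trans _ h2).
  by move: h4; rewrite /M subrKC => h4; rewrite (le_trans h3) // (le_trans _ h4).
have LE N k : N / 2 ^+ k = N / 2 ^+ k.+1 + N / 2 ^+ k.+1 :> R.
  by rewrite exprS; field; rewrite expf_neq0.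
apply: (@bisection2 P x1 y1 L M (ltW L0) (ltW M0)).
  move=> k a ina; rewrite /P /= => P1 P2 P3 P4.
  have lk := Lk k.+1; have mk := Mk k.+1.
  rewrite (@boundary_integral_split F _ _ _ _ (a.1 + L / 2 ^+ k.+1) (a.2 + M / 2 ^+ k.+1)).
  - have e1 : a.1 + L / 2 ^+ k.+1 + L / 2 ^+ k.+1 = a.1 + L / 2 ^+ k by rewrite (LE L k) addrA.
    have e2 : a.2 + M / 2 ^+ k.+1 + M / 2 ^+ k.+1 = a.2 + M / 2 ^+ k by rewrite (LE M k) addrA.
    rewrite e1 in P2 P4; rewrite e2 in P3 P4.
    have -> : e / (2 ^+ k) ^+ 2 = 4 * (e / (2 ^+ k.+1) ^+ 2).
      by rewrite [2 ^+ k.+1]exprS; field; rewrite expf_neq0.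
    apply: le_trans (cmodD _ _) _; apply: le_trans (lerD (cmodD _ _) P4) _.
    apply: le_trans (lerD (lerD (cmodD _ _) P3) (lexx _)) _.
    by move: P1 P2 => P1 P2; lra.
  - by rewrite (LE L k); lra.
  - by rewrite (LE M k); lra.
  - exact: sub.
move=> p q hp hq.
have pi_ : x1 <= p <= x2 by move: hp; rewrite /L subrKC.
have qi_ : y1 <= q <= y2 by move: hq; rewrite /M subrKC.
have /derivable1_diffP/derivableP := dF p q pi_ qi_.
set d := 'D_1 F _; move=> /is_deriveCP hd.
(* On a box of level [k] the remainder of the tangent is at most this number times
   [(L + M) / 2 ^+ k]. The bound of the boundary integral multiplies it by [4 (L + M) / 2 ^+ k],
   which gives [e / (2 ^+ k) ^+ 2]. *)
have e'0 : 0 < e / (4 * (L + M) ^+ 2).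
  by rewrite divr_gt0 // mulr_gt0 // exprn_gt0 // addr_gt0.
have [del del0 hdel] := hd _ e'0.
have [k hk] : exists k, (L + M) / 2 ^+ k < del.
  have := @cvg_geometric R (L + M) (2^-1).
  rewrite ger0_norm ?invr_ge0 // invf_lt1 // ltr1n => /(_ isT) /cvgrPdist_lt /(_ _ del0).
  case=> N _ /(_ N) /= => /(_ (leqnn _)).
  rewrite sub0r normrN exprVn ger0_norm; first by exists N.
  by rewrite mulr_ge0 // ?invr_ge0 ?exprn_ge0 // addr_ge0 // ltW.
exists k => a ina /andP[ap1 ap2] /andP[aq1 aq2]; rewrite /P.
pose z0 := p +i* q; pose r z := F z - F z0 - d * (z - z0).
(* An affine function has zero boundary integral, so the tangent of [F] at [z0] can be
   subtracted. *)
have -> : boundary_integral F a.1 (a.1 + L / 2 ^+ k) a.2 (a.2 + M / 2 ^+ k) =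
   boundary_integral r a.1 (a.1 + L / 2 ^+ k) a.2 (a.2 + M / 2 ^+ k).
  have -> : r = (fun z => F z + ((- F z0 + d * z0) + (- d) * z)).
    by apply/funext => z; rewrite /r; ring.
  rewrite boundary_integralD ?lerDl ?ltW //.
  - by rewrite boundary_integral_affine ?lerDl ?ltW // addr0.
  - exact: sub.
  - move=> x y _ _; apply: for_contD; first exact: for_cont_cst.
    by apply: for_contM; [exact: for_cont_cst|exact: for_cont_id].
have cr : cont_box r a.1 (a.1 + L / 2 ^+ k) a.2 (a.2 + M / 2 ^+ k).
  move=> x y xi yi; apply: for_contB.
    by apply: for_contB; [exact: (sub k a ina)|exact: for_cont_cst].
  apply: for_contM; first exact: for_cont_cst.
  by apply: for_contB; [exact: for_cont_id|exact: for_cont_cst].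
pose B := e / (4 * (L + M) ^+ 2) * ((L + M) / 2 ^+ k).
apply: le_trans (@boundary_integral_bound _ _ _ _ _ B _ _ cr _) _.
- by rewrite lerDl ltW.
- by rewrite lerDl ltW.
- move=> x y /andP[xa xb] /andP[ya yb]; rewrite /r.
  have hz : cmod ((x +i* y) - z0) <= (L + M) / 2 ^+ k.
    apply: le_trans (cmod_le_ReIm _) _; rewrite /= mulrDl; apply: lerD.
      by rewrite ler_norml; lra.
    by rewrite ler_norml; lra.
  apply: le_trans (hdel _ (le_lt_trans hz hk)) _.
  by rewrite /B ler_wpM2l // ltW.
- have -> : a.1 + L / 2 ^+ k - a.1 + (a.2 + M / 2 ^+ k - a.2) = (L + M) / 2 ^+ k by ring.
  rewrite /B le_eqVlt; apply/orP; left; apply/eqP; field.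
  by rewrite expf_neq0 // gt_eqF // addr_gt0.
Qed.

End Goursat.

(** * The complex exponential *)

Section DifferentiableRules.
Context {R : realType} {V : normedModType R[i]}.
Implicit Types (f g : V -> R[i]) (x : V).

Lemma fun_diffD f g x : differentiable f x -> differentiable g x ->
  differentiable (fun y => f y + g y) x.
Proof. exact: differentiableD. Qed.
Lemma fun_diffB f g x : differentiable f x -> differentiable g x ->
  differentiable (fun y => f y - g y) x.
Proof. exact: differentiableB. Qed.
Lemma fun_diffM f g x : differentiable f x -> differentiable g x ->
  differentiable (fun y => f y * g y) x.
Proof. exact: differentiableM. Qed.
Lemma fun_diff_cst (k : R[i]) x : differentiable (fun _ : V => k) x.
Proof. exact: differentiable_cst. Qed.
Lemma fun_diffV f x : differentiable f x -> f x != 0 ->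
  differentiable (fun y => (f y)^-1) x.
Proof. exact: differentiableV. Qed.
Lemma fun_diffX f n x : differentiable f x -> differentiable (fun y => f y ^+ n) x.
Proof.
move=> df; elim: n => [|n IH]; first exact: fun_diff_cst.
rewrite (_ : (fun y => _) = (fun y => f y * f y ^+ n)); first exact: fun_diffM.
by apply/funext => y; rewrite exprS.
Qed.
Lemma fun_diff_sum (I : Type) (r : seq I) (P : pred I) (F : I -> V -> R[i]) x :
  (forall i, P i -> differentiable (F i) x) ->
  differentiable (fun y => \sum_(i <- r | P i) F i y) x.
Proof.
move=> h; elim: r => [|i r IH].
  rewrite (_ : (fun y => _) = (fun=> 0)); first exact: fun_diff_cst.
  by apply/funext => y; rewrite big_nil.
have [Pi|nPi] := boolP (P i).
  rewrite (_ : (fun y => _) = (fun y => F i y + \sum_(j <- r | P j) F j y)).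
    by apply: fun_diffD; [exact: h|exact: IH].
  by apply/funext => y; rewrite big_cons Pi.
rewrite (_ : (fun y => _) = (fun y => \sum_(j <- r | P j) F j y)); first exact: IH.
by apply/funext => y; rewrite big_cons (negbTE nPi).
Qed.
Lemma fun_diff_prod (I : Type) (r : seq I) (P : pred I) (F : I -> V -> R[i]) x :
  (forall i, P i -> differentiable (F i) x) ->
  differentiable (fun y => \prod_(i <- r | P i) F i y) x.
Proof.
move=> h; elim: r => [|i r IH].
  rewrite (_ : (fun y => _) = (fun=> 1)); first exact: fun_diff_cst.
  by apply/funext => y; rewrite big_nil.
have [Pi|nPi] := boolP (P i).
  rewrite (_ : (fun y => _) = (fun y => F i y * \prod_(j <- r | P j) F j y)).
    by apply: fun_diffM; [exact: h|exact: IH].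
  by apply/funext => y; rewrite big_cons Pi.
rewrite (_ : (fun y => _) = (fun y => \prod_(j <- r | P j) F j y)); first exact: IH.
by apply/funext => y; rewrite big_cons (negbTE nPi).
Qed.
End DifferentiableRules.

Section ComplexExp.
Context {R : realType}.
Implicit Types (r t : R) (z : R[i]).

Lemma fun_diff_id z : differentiable (fun y : R[i] => y) z.
Proof. exact: ex_diff. Qed.

Lemma is_derive_epsR (f : R -> R) (x d : R) : is_derive x 1 f d ->
  forall e : R, 0 < e -> exists2 del : R, 0 < del &
    forall y, `|y - x| < del -> `|f y - f x - d * (y - x)| <= e * `|y - x|.
Proof.
move=> [dg <-] e e0.
have /cvgrPdist_lt /(_ e e0) := dg => h.
have [del /= del0 hd] := (nbhs_ballP _ _).1 h.
exists del => // y hy; have [->|yx] := eqVneq y x.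
  by rewrite !subrr mulr0 subrr normr0 mulr0.
have hz : y - x != 0 by rewrite subr_eq0.
have := hd (y - x); rewrite /ball /= sub0r normrN => /(_ hy hz).
rewrite -['D_1 f x]/(lim _); set l := lim _ => hh.
have -> : f y - f x - l * (y - x) =
    - ((l - (y - x)^-1 *: (f ((y - x)%:A + x) - f x)) * (y - x)).
  rewrite -[(y - x)%:A]/((y - x) * 1) mulr1 subrK -[_ *: _]/(_ * _); field.
  exact: hz.
by rewrite normrN normrM ler_wpM2r // ltW.
Qed.

Definition cis t : R[i] := cos t +i* sin t.
Definition cexp z : R[i] := (expR (Re z))%:C * cis (Im z).

Lemma cmod_cis t : cmod (cis t) = 1.
Proof. by rewrite /cmod /= cos2Dsin2 sqrtr1. Qed.
Lemma cmod_circle r t : 0 <= r -> cmod (r%:C * cis t) = r.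
Proof. by move=> r0; rewrite cmodM cmod_cis mulr1 cmod_real ger0_norm. Qed.
Lemma cis0 : cis 0 = 1. Proof. by rewrite /cis cos0 sin0. Qed.
Lemma cis2pi : cis (pi *+ 2) = 1. Proof. by rewrite /cis cos2pi sin2pi. Qed.
Lemma cisD t u : cis (t + u) = cis t * cis u.
Proof.
apply: complex_eq; first by rewrite Re_mul /= cosD.
by rewrite Im_mul /= sinD addrC.
Qed.
Lemma cexpD z w : cexp (z + w) = cexp z * cexp w.
Proof. by rewrite /cexp Re_add Im_add expRD cisD rmorphM /= mulrACA. Qed.
Lemma cis_continuous t : {for t, continuous cis}.
Proof.
have cc : {for t, continuous (fun t : R => (cos t)%:C)}.
  apply/rcontP => e e0; have /cvgrPdist_lt /(_ e e0) := @continuous_cos R t.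
  move=> /nbhs_ballP [d /= d0 hd]; exists d => // x hx.
  rewrite -rmorphB cmod_real distrC; apply: hd.
  by rewrite -ball_normE /= distrC.
have cs : {for t, continuous (fun t : R => (sin t)%:C)}.
  apply/rcontP => e e0; have /cvgrPdist_lt /(_ e e0) := @continuous_sin R t.
  move=> /nbhs_ballP [d /= d0 hd]; exists d => // x hx.
  rewrite -rmorphB cmod_real distrC; apply: hd.
  by rewrite -ball_normE /= distrC.
rewrite (_ : cis = fun t => (cos t)%:C + 'i * (sin t)%:C).
  by apply: (for_contD cc); apply: for_contM; [exact: for_cont_cst|exact: cs].
by apply/funext => u; rewrite [LHS]complexE.
Qed.

Lemma cexp_diff0 e : 0 < e -> exists2 d : R, 0 < d &
  forall h, cmod h < d -> cmod (cexp h - 1 - h) <= e * cmod h.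
Proof.
move=> e0.
(* Six errors of size [e' m] are collected at the end, three in the real part and three in the
   imaginary part. The bound [e' <= 1] serves to get [expR a <= 2]. *)
have e'0 : 0 < Num.min (e / 6) 1 by rewrite lt_min ltr01 divr_gt0.
set e' := Num.min (e / 6) 1 in e'0.
have e'1 : e' <= 1 by rewrite ge_min lexx orbT.
have e'6 : e' <= e / 6 by rewrite ge_min lexx.
have [d1 d10 h1] := is_derive_epsR (is_derive_expR (0 : R)) e'0.
have [d2 d20 h2] := is_derive_epsR (is_derive_cos (0 : R)) e'0.
have [d3 d30 h3] := is_derive_epsR (is_derive_sin (0 : R)) e'0.
have d0 : 0 < Num.min (Num.min d1 d2) (Num.min d3 (e' / 2)).
  by rewrite !lt_min d10 d20 d30 divr_gt0.
exists (Num.min (Num.min d1 d2) (Num.min d3 (e' / 2))) => // h.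
rewrite !lt_min => /andP[/andP[k1 k2] /andP[k3 k4]].
have ha := Re_le_cmod h; have hb := Im_le_cmod h.
case: h k1 k2 k3 k4 ha hb => a b; set m := cmod _ => k1 k2 k3 k4 /= ha hb.
have {}h1 := h1 a; have {}h2 := h2 b; have {}h3 := h3 b.
rewrite !subr0 expR0 mul1r in h1; rewrite !subr0 cos0 sin0 oppr0 mul0r subr0 in h2.
rewrite !subr0 sin0 cos0 mul1r subr0 in h3.
have {}h1 := h1 (le_lt_trans ha k1).
have {}h2 := h2 (le_lt_trans hb k2).
have {}h3 := h3 (le_lt_trans hb k3).
have m0 : 0 <= m by exact: cmod_ge0.
have A0 := normr_ge0 a; have B0 := normr_ge0 b.
have ea1 : `|expR a - 1| <= e'.
  have -> : expR a - 1 = (expR a - 1 - a) + a by ring.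
  apply: le_trans (ler_normD _ _) _.
  have : e' * `|a| <= `|a| by rewrite ler_piMl.
  by lra.
have ea2 : expR a <= 2.
  have -> : expR a = (expR a - 1) + 1 by ring.
  by have := ler_norm (expR a - 1); lra.
have ea0 := expR_gt0 a.
have mb : e' * `|b| <= e' * m by rewrite ler_wpM2l // ltW.
have ma : e' * `|a| <= e' * m by rewrite ler_wpM2l // ltW.
have em : 6 * (e' * m) <= e * m.
  by rewrite mulrA ler_wpM2r //; lra.
apply: le_trans (cmod_le_ReIm _) _; rewrite /cexp /=.
have -> : expR a * cos b - 0 * sin b - 1 - a = (expR a - 1 - a) + expR a * (cos b - 1) by ring.
have -> : expR a * sin b + 0 * cos b - 0 - b = expR a * (sin b - b) + (expR a - 1) * b by ring.
have n1 : `|expR a * (cos b - 1)| <= 2 * (e' * m).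
  rewrite normrM ger0_norm; last exact: ltW.
  apply: ler_pM => //; exact: le_trans h2 mb.
have n2 : `|expR a * (sin b - b)| <= 2 * (e' * m).
  rewrite normrM ger0_norm; last exact: ltW.
  apply: ler_pM => //; exact: le_trans h3 mb.
have n3 : `|(expR a - 1) * b| <= e' * m by rewrite normrM ler_pM.
have := ler_normD (expR a - 1 - a) (expR a * (cos b - 1)).
have := ler_normD (expR a * (sin b - b)) ((expR a - 1) * b).
by lra.
Qed.

(** By the functional equation the increment at [z] is [cexp z] times the increment at the origin,
    where [cexp_diff0] is applied with [e / cmod (cexp z)]. *)
Lemma cexp_differentiable z : differentiable cexp z.
Proof.
apply/derivable1_diffP.
suff [] : is_derive z 1 cexp (cexp z) by [].
apply/is_deriveCP => e e0.
have c0 : 0 < cmod (cexp z).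
  by rewrite cmodM cmod_cis mulr1 cmod_real normr_gt0 gt_eqF // expR_gt0.
have [d d0 hd] := cexp_diff0 (divr_gt0 e0 c0).
exists d => // x /hd hx.
have -> : cexp x = cexp z * cexp (x - z) by rewrite -cexpD addrC subrK.
have -> : cexp z * cexp (x - z) - cexp z - cexp z * (x - z) =
  cexp z * (cexp (x - z) - 1 - (x - z)) by ring.
rewrite cmodM.
by rewrite mulrC -ler_pdivlMr // mulrAC.
Qed.

End ComplexExp.

(** * Means over circles *)

Section CircleMean.
Context {R : realType}.
Implicit Types (r t : R) (z w : R[i]) (g h : R[i] -> R[i]).

Local Notation "2pi" := (pi *+ 2 : R).

Lemma twopi_gt0 : 0 < (pi *+ 2 : R). Proof. by rewrite mulrn_wgt0 ?pi_gt0. Qed.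

Definition circle_cont r h := forall z, cmod z = r -> {for z, continuous h}.
(** This is the contour integral of [h(z) dz / (2 pi i z)]; the factor [1 / z] is the reason why
    Cauchy's kernel appears below as [z / (z - w)]. *)
Definition cmean r h : R[i] := (2pi^-1)%:C * CI (fun t => h (r%:C * cis t)) 0 2pi.

Lemma circle_path_cont r h t : 0 <= r -> circle_cont r h ->
  {for t, continuous (fun t => h (r%:C * cis t))}.
Proof.
move=> r0 ch.
apply: (@continuous_comp _ _ _ (fun t => r%:C * cis t) h).
  by apply: for_contM; [exact: for_cont_cst|exact: cis_continuous].
by apply: ch; rewrite cmod_circle.
Qed.

Lemma circle_segc r h : 0 <= r -> circle_cont r h ->
  segc (fun t => h (r%:C * cis t)) 0 2pi.
Proof. by move=> r0 ch t _; exact: circle_path_cont. Qed.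

Lemma cmean_ext r h1 h2 : 0 <= r -> (forall z, cmod z = r -> h1 z = h2 z) ->
  cmean r h1 = cmean r h2.
Proof.
move=> r0 e; congr (_ * _); apply: CI_ext => t _; apply: e.
by rewrite cmod_circle.
Qed.

Lemma cmeanD r h1 h2 : 0 <= r -> circle_cont r h1 -> circle_cont r h2 ->
  cmean r (fun z => h1 z + h2 z) = cmean r h1 + cmean r h2.
Proof.
by move=> r0 c1 c2; rewrite /cmean (CID (circle_segc r0 c1) (circle_segc r0 c2)) mulrDr.
Qed.

Lemma cmeanZ r (k : R[i]) h : 0 <= r -> circle_cont r h ->
  cmean r (fun z => k * h z) = k * cmean r h.
Proof.
by move=> r0 c1; rewrite /cmean (CIZ k (circle_segc r0 c1)) mulrCA.
Qed.

Lemma cmean_cst r (k : R[i]) : cmean r (fun=> k) = k.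
Proof.
rewrite /cmean CI_cst ?ltW ?twopi_gt0 // subr0 mulrCA -rmorphM /= mulVf ?mulr1 //.
by rewrite gt_eqF ?twopi_gt0.
Qed.

Lemma circle_contD r h1 h2 : circle_cont r h1 -> circle_cont r h2 ->
  circle_cont r (fun z => h1 z + h2 z).
Proof. by move=> c1 c2 z zr; apply: for_contD; [exact: c1|exact: c2]. Qed.
Lemma circle_contM r h1 h2 : circle_cont r h1 -> circle_cont r h2 ->
  circle_cont r (fun z => h1 z * h2 z).
Proof. by move=> c1 c2 z zr; apply: for_contM; [exact: c1|exact: c2]. Qed.
Lemma circle_cont_cst r (k : R[i]) : circle_cont r (fun=> k).
Proof. by move=> z zr; exact: for_cont_cst. Qed.
Lemma circle_contZ r (k : R[i]) h : circle_cont r h -> circle_cont r (fun z => k * h z).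
Proof. by move=> c1; exact: (circle_contM (@circle_cont_cst r k) c1). Qed.
Lemma circle_cont_id r : circle_cont r (fun z => z).
Proof. by move=> z _; exact: for_cont_id. Qed.
Lemma circle_contX r h n : circle_cont r h -> circle_cont r (fun z => h z ^+ n).
Proof. by move=> c1 z zr; apply: for_contX; exact: c1. Qed.
Lemma circle_cont_conj r h : circle_cont r h -> circle_cont r (fun z => (h z)^*%R).
Proof. by move=> c1 z zr; apply: for_cont_conj; exact: c1. Qed.
Lemma circle_cont_inv r h : (forall z, cmod z = r -> h z != 0) -> circle_cont r h ->
  circle_cont r (fun z => (h z)^-1).
Proof. by move=> h0 c1 z zr; apply: for_contV; [exact: h0|exact: c1]. Qed.
Lemma circle_contB r h1 h2 : circle_cont r h1 -> circle_cont r h2 ->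
  circle_cont r (fun z => h1 z - h2 z).
Proof. by move=> c1 c2 z zr; apply: for_contB; [exact: c1|exact: c2]. Qed.

Lemma cmeanB r h1 h2 : 0 <= r -> circle_cont r h1 -> circle_cont r h2 ->
  cmean r (fun z => h1 z - h2 z) = cmean r h1 - cmean r h2.
Proof.
move=> r0 c1 c2.
rewrite (@cmean_ext r _ (fun z => h1 z + (-1) * h2 z)) //; last by move=> z _; rewrite mulN1r.
have cz := @circle_contZ r (-1) h2 c2.
by rewrite (cmeanD r0 c1 cz) (cmeanZ _ r0 c2) mulN1r.
Qed.

Lemma cmean_bound r h B : 0 <= r -> circle_cont r h ->
  (forall z, cmod z = r -> cmod (h z) <= B) -> cmod (cmean r h) <= 2 * B.
Proof.
move=> r0 ch hB; have p0 := twopi_gt0.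
rewrite /cmean cmodM cmod_real ger0_norm; last by rewrite invr_ge0 ltW.
rewrite mulrC ler_pdivrMr //.
have := @CI_bound R (fun t => h (r%:C * cis t)) 0 2pi B.
rewrite subr0; apply; [exact: ltW|exact: circle_segc|].
by move=> t _; apply: hB; rewrite cmod_circle.
Qed.

Lemma cmean_conj r h : 0 <= r -> circle_cont r h ->
  cmean r (fun z => (h z)^*%R) = (cmean r h)^*%R.
Proof.
move=> r0 ch; rewrite /cmean rmorphM /= conj_realC; congr (_ * _).
have ci := segc_Im (circle_segc r0 ch).
apply: complex_eq; rewrite ?Re_conj ?Im_conj /CI /=.
  by apply: RI_ext => t _; rewrite /comp conjCE; case: (h _).
rewrite -mulN1r -(RIZ _ ci); apply: RI_ext => t _.
by rewrite mulN1r /comp conjCE; case: (h _).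
Qed.

Lemma cmean_ge0 r h : 0 <= r -> (forall z, cmod z = r -> 0 <= h z) -> 0 <= cmean r h.
Proof.
move=> r0 h0; have p0 := twopi_gt0.
apply: mulr_ge0; first by rewrite lecR invr_ge0 ltW.
rewrite /CI lecE /=; apply/andP; split.
  apply/eqP; rewrite (@RI_ext _ _ (fun=> 0)) ?RI_cst ?mul0r ?ltW // => t _ /=.
  have := h0 (r%:C * cis t) (cmod_circle _ r0).
  by rewrite lecE => /andP[/eqP].
apply: RI_ge0 => t _ /=; have := h0 (r%:C * cis t) (cmod_circle _ r0).
by rewrite lecE => /andP[].
Qed.

(** The exponential maps the rectangle with sides [[ln a, ln b]] and [[0, 2 pi]] onto the closed
    annulus. In Goursat's lemma the horizontal sides cancel by periodicity, and the vertical ones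
    are the integrals over the two circles. *)
Lemma cmean_annulus g r1 r2 a b : 0 <= r1 ->
  (forall z, r1 < cmod z < r2 -> differentiable g z) ->
  r1 < a -> a < b -> b < r2 -> cmean a g = cmean b g.
Proof.
move=> r10 dg r1a ab br2.
have a0 : 0 < a by exact: le_lt_trans r1a.
have b0 : 0 < b by exact: lt_trans ab.
have lab : ln a < ln b by rewrite ltr_ln.
have p0 := twopi_gt0.
have : boundary_integral (g \o cexp) (ln a) (ln b) 0 2pi = 0.
  apply: goursat => // x y /andP[ax xb] _.
  apply: differentiable_comp; first exact: cexp_differentiable.
  apply: dg; rewrite /cexp /= cmod_circle; last exact: expR_ge0.
  rewrite (lt_le_trans r1a); last by rewrite -(@lnK _ a) // ler_expR.
  by rewrite (le_lt_trans _ br2) // -[leRHS](@lnK _ b) // ler_expR.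
rewrite /boundary_integral.
have -> : hseg (g \o cexp) 0 = hseg (g \o cexp) 2pi.
  by apply/funext => x; rewrite /hseg /= /cexp /= cis0 cis2pi.
rewrite subrr add0r => /eqP; rewrite mulf_eq0 => /orP[/eqP[/eqP]|].
  by rewrite oner_eq0.
rewrite subr_eq0 => /eqP e; rewrite /cmean; congr (_ * _).
have ev x : 0 < x -> CI (fun t => g (x%:C * cis t)) 0 2pi = CI (vseg (g \o cexp) (ln x)) 0 2pi.
  by move=> x0; apply: CI_ext => t _; rewrite /vseg /= /cexp /= lnK.
exact: (etrans (ev a a0) (etrans (esym e) (esym (ev b b0)))).
Qed.

(** Continuity is assumed only at the points of one circle; compactness of the interval of angles
    makes the estimate uniform in [t]. *)
Lemma circle_uniform g r0 : 0 <= r0 -> circle_cont r0 g ->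
  forall e : R, 0 < e -> exists2 d : R, 0 < d &
  forall r t, `|r - r0| < d -> 0 <= t <= 2pi -> cmod (g (r%:C * cis t) - g (r0%:C * cis t)) <= e.
Proof.
move=> r00 cg e e0.
have e20 : 0 < e / 2 by rewrite divr_gt0.
have comp : compact (`[0, 2pi] : set R) by exact: segment_compact.
pose P r t := cmod (g (r%:C * cis t) - g (r0%:C * cis t)) <= e.
suff : \near r0, (`[0, 2pi] : set R) `<=` P r0.
  move=> /nbhs_ballP[d /= d0 hd]; exists d => // r t hr ht.
  by apply: (hd r); [rewrite -ball_normE /= distrC|rewrite /= in_itv].
move/compact_near_coveringP : comp => /(_ R (nbhs r0) P (nbhs_filter r0)); apply => t0 _.
have z0 : cmod (r0%:C * cis t0) = r0 by rewrite cmod_circle.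
have /ccontP/(_ _ e20) [d d0 hd] := cg _ z0.
have d20 : 0 < d / 2 by rewrite divr_gt0.
have dr0 : 0 < d / (2 * (r0 + 1)) by rewrite divr_gt0 // mulr_gt0 // ltr_wpDl.
have /rcontP/(_ _ dr0) [d1 d10 hd1] := @cis_continuous R t0.
have h3 (t : R) : `|t - t0| < d1 -> r0 * cmod (cis t - cis t0) <= d / 2.
  move=> /hd1 h2; apply: le_trans (ler_wpM2l r00 (ltW h2)) _.
  rewrite mulrA ler_pdivrMr ?mulr_gt0 // ?ltr_wpDl //.
  have -> : d / 2 * (2 * (r0 + 1)) = d * r0 + d by field.
  by rewrite mulrC lerDl ltW.
have key (r t : R) : `|t - t0| < d1 -> `|r - r0| < d / 2 ->
    cmod (r%:C * cis t - r0%:C * cis t0) < d.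
  move=> /h3 ht hr.
  have -> : r%:C * cis t - r0%:C * cis t0 = (r - r0)%:C * cis t + r0%:C * (cis t - cis t0).
    by rewrite rmorphB /=; ring.
  apply: le_lt_trans (cmodD _ _) _.
  by rewrite !cmodM cmod_cis mulr1 !cmod_real (ger0_norm r00); lra.
exists ([set t | `|t - t0| < d1], [set r | `|r - r0| < d / 2]) => /=.
  split; apply/nbhs_ballP; [exists d1 => //|exists (d / 2) => //];
  by move=> x; rewrite -ball_normE /= distrC.
move=> [t r] /= [ht hr]; rewrite /P.
have h1 := hd _ (key r t ht hr).
have h2 : cmod (g (r0%:C * cis t) - g (r0%:C * cis t0)) < e / 2.
  by apply: hd; apply: key => //; rewrite subrr normr0.
have := cmodB (g (r%:C * cis t) - g (r0%:C * cis t0)) (g (r0%:C * cis t) - g (r0%:C * cis t0)).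
rewrite opprB addrA subrK => /le_trans; apply.
lra.
Qed.

Definition disc_cont rho g := forall z, cmod z < rho -> {for z, continuous g}.

Lemma disc_circle_cont rho g r : disc_cont rho g -> r < rho -> circle_cont r g.
Proof. by move=> cg rr z zr; apply: cg; rewrite zr. Qed.

Lemma cmean_continuous g rho r0 : disc_cont rho g ->
  0 <= r0 -> r0 < rho -> forall e : R, 0 < e -> exists2 d : R, 0 < d &
  forall r, 0 <= r -> r < rho -> `|r - r0| < d -> cmod (cmean r g - cmean r0 g) <= e.
Proof.
move=> cg r00 r0rho e e0.
have c0 := disc_circle_cont cg r0rho.
have p0 := twopi_gt0.
have e20 : 0 < e / 2 by rewrite divr_gt0.
have [d d0 hd] := circle_uniform r00 c0 e20.
exists d => // r rr rrho hr.
have c1 := disc_circle_cont cg rrho.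
have s1 := circle_segc rr c1; have s0 := circle_segc r00 c0.
rewrite /cmean -mulrBr -(CIN s0) -(CID s1 (segcN s0)).
rewrite cmodM cmod_real ger0_norm; last by rewrite invr_ge0 ltW.
rewrite mulrC ler_pdivrMr //.
have -> : e * 2pi = 2 * (e / 2) * (2pi - 0) by field.
apply: CI_bound; [exact: ltW|exact: (segcD s1 (segcN s0))|].
by move=> t ht; apply: hd.
Qed.

Lemma cmean0 g : cmean 0 g = g 0.
Proof.
rewrite -[RHS](cmean_cst 0); apply: cmean_ext => // z /eqP.
by rewrite cmod_eq0 => /eqP ->.
Qed.

(* The mean over the circle is locally constant off the exceptional circle
   [cmod z = c] and continuous across it. *)
Lemma cmean_center g rho c : 0 <= c -> disc_cont rho g ->
  (forall z, 0 < cmod z < rho -> cmod z != c -> differentiable g z) ->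
  forall r, 0 < r < rho -> cmean r g = g 0.
Proof.
move=> c0 cg dg.
have eqe (x y : R[i]) : (forall e : R, 0 < e -> cmod (x - y) <= e) -> x = y.
  move=> h; apply/eqP; rewrite -subr_eq0 -cmod_eq0 eq_le cmod_ge0 andbT.
  by apply/ler_addgt0Pr => e e0; rewrite add0r; exact: h.
have near a : 0 <= a < rho -> forall e : R, 0 < e -> exists2 d : R, 0 < d &
    forall r, 0 <= r -> r < rho -> `|r - a| < d -> cmod (cmean r g - cmean a g) <= e.
  by move=> /andP[a0 ar]; apply: cmean_continuous cg a0 ar.
have small r : 0 < r < rho -> r < c -> cmean r g = g 0.
  move=> /andP[r0 rr] rc; rewrite -cmean0; apply: eqe => e e0.
  have rho0 : 0 < rho by exact: lt_trans rr.
  have [|d d0 hd] := near 0 _ e e0; first by rewrite lexx.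
  have m0 : 0 < Num.min (d / 2) (r / 2) by rewrite lt_min !divr_gt0.
  have m1 : Num.min (d / 2) (r / 2) <= r / 2 by rewrite ge_min lexx orbT.
  have m2 : Num.min (d / 2) (r / 2) <= d / 2 by rewrite ge_min lexx.
  set m := Num.min _ _ in m0 m1 m2.
  rewrite -(@cmean_annulus g 0 (Num.min c rho) m r) //.
  - apply: hd; [exact: ltW|lra|].
    by rewrite subr0 ger0_norm ?ltW //; lra.
  - move=> z /andP[z0]; rewrite lt_min => /andP[zc zr].
    by apply: dg; [rewrite z0|rewrite lt_eqF].
  - lra.
  - by rewrite lt_min rc.
have atc : c < rho -> cmean c g = g 0.
  move=> crho; have [->|cn0] := eqVneq c 0; first exact: cmean0.
  have cp : 0 < c by rewrite lt_neqAle eq_sym cn0.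
  apply: eqe => e e0.
  have [|d d0 hd] := near c _ e e0; first by rewrite c0.
  have m0 : 0 < Num.min (d / 2) (c / 2) by rewrite lt_min !divr_gt0.
  have m1 : Num.min (d / 2) (c / 2) <= c / 2 by rewrite ge_min lexx orbT.
  have m2 : Num.min (d / 2) (c / 2) <= d / 2 by rewrite ge_min lexx.
  set m := Num.min _ _ in m0 m1 m2.
  rewrite -(small (c - m)); [|by apply/andP; split; lra|lra].
  rewrite cmodBC; apply: hd; [lra|lra|].
  by rewrite addrAC subrr add0r normrN ger0_norm ?ltW //; lra.
move=> r /andP[r0 rr]; have [rc|rc|rc] := ltgtP r c.
- by apply: small => //; rewrite r0.
- have crho : c < rho by exact: lt_trans rr.
  rewrite -(atc crho); apply: eqe => e e0.
  have [|d d0 hd] := near c _ e e0; first by rewrite c0.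
  have m0 : 0 < Num.min (d / 2) ((r - c) / 2) by rewrite lt_min !divr_gt0 // subr_gt0.
  have m1 : Num.min (d / 2) ((r - c) / 2) <= (r - c) / 2 by rewrite ge_min lexx orbT.
  have m2 : Num.min (d / 2) ((r - c) / 2) <= d / 2 by rewrite ge_min lexx.
  set m := Num.min _ _ in m0 m1 m2.
  rewrite -(@cmean_annulus g c rho (c + m) r) //.
  - apply: hd; [lra|lra|].
    by rewrite addrAC subrr add0r ger0_norm ?ltW //; lra.
  - move=> z /andP[zc zr]; apply: dg; last by rewrite gt_eqF.
    by rewrite zr (le_lt_trans c0).
  - lra.
  - lra.
- by rewrite rc; apply: atc; rewrite -rc.
Qed.

End CircleMean.

(** * Taylor expansion and the Schwarz-Pick inequality in one variable *)

Section OneVariable.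
Context {R : realType}.
Implicit Types (r rho : R) (z w : R[i]) (g h u : R[i] -> R[i]).

Lemma realCD (a b : R) : (a + b)%:C = a%:C + b%:C :> R[i]. Proof. exact: rmorphD. Qed.
Lemma realCM (a b : R) : (a * b)%:C = a%:C * b%:C :> R[i]. Proof. exact: rmorphM. Qed.

Definition disc_diff rho g := forall z, cmod z < rho -> differentiable g z.

Lemma disc_diff_cont rho g : disc_diff rho g -> disc_cont rho g.
Proof. by move=> dg z /dg /differentiable_continuous. Qed.

(** The singularity at [w] is filled in by the derivative. Only continuity at [w] is then available,
    and the exceptional circle of [cmean_center] is there to allow for it. *)
Definition dquot g w z := if z == w then 'D_1 g w else (g z - g w) / (z - w).

Lemma dquot_near g w z : z != w -> {near z, (fun z => (g z - g w) / (z - w)) =1 dquot g w}.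
Proof.
move=> zw; apply/(cnearP z); exists (cmod (z - w)); first by rewrite cmod_gt0 subr_eq0.
move=> x hx; rewrite /dquot; case: eqP => // xw.
by move: hx; rewrite xw cmodBC ltxx.
Qed.

Lemma dquot_diff g w z : differentiable g z -> z != w -> differentiable (dquot g w) z.
Proof.
move=> dg zw; apply/derivable1_diffP.
apply: (near_eq_derivable (dquot_near g zw)); apply/derivable1_diffP.
apply: fun_diffM; first by apply: fun_diffB; [exact: dg|exact: fun_diff_cst].
apply: fun_diffV; last by rewrite subr_eq0.
by apply: fun_diffB; [exact: fun_diff_id|exact: fun_diff_cst].
Qed.

Lemma dquot_cont g w : differentiable g w -> {for w, continuous (dquot g w)}.
Proof.
move=> /derivable1_diffP/derivableP/is_deriveCP hd; apply/ccontP => e e0.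
have e20 : 0 < e / 2 by rewrite divr_gt0.
have [d d0 h] := hd _ e20; exists d => // x /h.
rewrite /dquot eqxx; case: eqP => [_ _|/eqP xw].
  by rewrite subrr cmod0.
have xw0 : x - w != 0 by rewrite subr_eq0.
have -> : (g x - g w) / (x - w) - 'D_1 g w = (g x - g w - 'D_1 g w * (x - w)) / (x - w).
  by field.
rewrite cmodM cmodV => hh; have c0 : 0 < cmod (x - w) by rewrite cmod_gt0.
by rewrite ltr_pdivrMr // (le_lt_trans hh) // ltr_pM2r //; lra.
Qed.

Lemma cmean_diff_center rho g r : disc_diff rho g -> 0 < r < rho -> cmean r g = g 0.
Proof.
move=> dg; apply: (@cmean_center _ g rho 0) => //; first exact: disc_diff_cont.
by move=> z /andP[_ zr] _; exact: dg.
Qed.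

Lemma circle_neq0 r z : 0 < r -> cmod z = r -> z != 0.
Proof. by move=> r0 zr; rewrite -cmod_gt0 zr. Qed.

Lemma circle_neq r w z : cmod w < r -> cmod z = r -> z - w != 0.
Proof. by move=> wr zr; rewrite subr_eq0; apply: contraTneq wr => <-; rewrite zr ltxx. Qed.

Lemma circle_cont_sub_inv r w : cmod w < r -> circle_cont r (fun z => (z - w)^-1).
Proof.
move=> wr; apply: circle_cont_inv; first by move=> z; exact: circle_neq.
by apply: circle_contB; [exact: circle_cont_id|exact: circle_cont_cst].
Qed.

Lemma circle_cont_idV r : 0 < r -> circle_cont r (fun z => z^-1).
Proof.
by move=> r0; apply: circle_cont_inv; [move=> z; exact: circle_neq0|exact: circle_cont_id].
Qed.

Lemma eq_of_cmod_le (x y : R[i]) : (forall e : R, 0 < e -> cmod (x - y) <= e) -> x = y.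
Proof.
move=> h; apply/eqP; rewrite -subr_eq0 -cmod_eq0 eq_le cmod_ge0 andbT.
by apply/ler_addgt0Pr => e e0; rewrite add0r; exact: h.
Qed.

(** All circles around the origin that enclose [w] give the same mean, and on a large one the
    integrand is close to 1. *)
Lemma cmean_inv_sub r w : cmod w < r -> cmean r (fun z => z / (z - w)) = 1.
Proof.
move=> wr; have w0 := cmod_ge0 w; have r0 : 0 < r by exact: le_lt_trans wr.
apply: eq_of_cmod_le => e e0.
(* Beyond this radius [cmod (z - w)] is at least [2 cmod w / e], so [w / (z - w)] is at most
   [e / 2]; the factor 2 of [cmean_bound] turns this into [e]. *)
pose s := r + cmod w + 2 * cmod w / e.
have q0 : 0 <= 2 * cmod w / e by rewrite divr_ge0 // ?mulr_ge0 // ltW.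
have ws : cmod w < s by rewrite /s; lra.
have s0 : 0 < s by exact: le_lt_trans ws.
have cc a : cmod w < a -> circle_cont a (fun z => z / (z - w)).
  by move=> wa; apply: circle_contM; [exact: circle_cont_id|exact: circle_cont_sub_inv].
have -> : cmean r (fun z => z / (z - w)) = cmean (s + 1) (fun z => z / (z - w)).
  apply: (@cmean_annulus _ _ (cmod w) (s + 2)); [exact: w0| |exact: wr|rewrite /s; lra|lra].
  move=> z /andP[wz _]; apply: fun_diffM; first exact: fun_diff_id.
  apply: fun_diffV; first by apply: fun_diffB; [exact: fun_diff_id|exact: fun_diff_cst].
  exact: (circle_neq wz).
have w1 : cmod w < s + 1 by lra.
have s10 : 0 <= s + 1 by lra.
have -> : cmean (s + 1) (fun z => z / (z - w)) - 1 =
    cmean (s + 1) (fun z => z / (z - w) - 1).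
  by rewrite (cmeanB s10 (cc _ w1) (@circle_cont_cst _ _ 1)) cmean_cst.
have -> : e = 2 * (e / 2) by field.
apply: cmean_bound; [exact: s10|by apply: circle_contB; [exact: cc|exact: circle_cont_cst]|].
move=> z zs; have zw := circle_neq w1 zs.
have -> : z / (z - w) - 1 = w / (z - w) by field.
rewrite cmodM cmodV ler_pdivrMr; last by rewrite cmod_gt0.
have h1 : cmod z <= cmod (z - w) + cmod w by have := cmodD (z - w) w; rewrite subrK.
have h2 : 2 * cmod w / e <= cmod (z - w) by rewrite zs /s in h1; lra.
have h3 : cmod w <= e / 2 * (2 * cmod w / e).
  by rewrite le_eqVlt; apply/orP; left; apply/eqP; field; rewrite gt_eqF.
by apply: le_trans h3 _; rewrite ler_wpM2l // divr_ge0 // ltW.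
Qed.

Lemma cmean_inv r : 0 < r -> cmean r (fun z => z^-1) = 0.
Proof.
move=> r0; apply: eq_of_cmod_le => e e0; rewrite subr0.
pose s := r + 2 / e + 1.
have q0 : 0 <= 2 / e by rewrite divr_ge0 // ltW.
have -> : cmean r (fun z => z^-1) = cmean s (fun z => z^-1).
  apply: (@cmean_annulus _ _ 0 (s + 2)); [exact: lexx| |exact: r0|rewrite /s; lra|lra].
  move=> z /andP[z0 _]; apply: fun_diffV; first exact: fun_diff_id.
  by rewrite -cmod_gt0.
have s0 : 0 < s by rewrite /s; lra.
have -> : e = 2 * (e / 2) by field.
apply: cmean_bound; [exact: ltW|exact: circle_cont_idV|].
move=> z zs; rewrite cmodV zs -[leRHS]invrK lef_pV2 ?posrE ?invr_gt0 ?divr_gt0 //.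
by rewrite invf_div /s; lra.
Qed.

(** The function [q] vanishes at the origin and is differentiable off the circle through [w], so its
    mean is its value 0 at the centre. On the circle of radius [r] it equals
    [(g z - g w) z / (z - w)]. *)
Lemma cauchy_formula rho g r w : disc_diff rho g -> cmod w < r -> r < rho ->
  cmean r (fun z => g z * (z / (z - w))) = g w.
Proof.
move=> dg wr rrho; have r0 : 0 < r by exact: le_lt_trans (cmod_ge0 w) wr.
have wrho := lt_trans wr rrho.
have cg := disc_circle_cont (disc_diff_cont dg) rrho.
have ck : circle_cont r (fun z => z / (z - w)).
  by apply: circle_contM; [exact: circle_cont_id|exact: circle_cont_sub_inv].
pose q z := z * dquot g w z.
have cdq : disc_cont rho (dquot g w).
  move=> z zr; have [->|zw] := eqVneq z w; first exact: dquot_cont (dg _ wrho).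
  by apply: differentiable_continuous; apply: dquot_diff => //; exact: dg.
have mq : cmean r q = 0.
  have -> : 0 = q 0 by rewrite /q mul0r.
  apply: (@cmean_center _ q rho (cmod w)); [exact: cmod_ge0| | |by rewrite r0].
  - by move=> z zr; apply: for_contM; [exact: for_cont_id|exact: cdq].
  move=> z /andP[_ zr] zw; apply: fun_diffM; first exact: fun_diff_id.
  by apply: dquot_diff; [exact: dg|apply: contra_neq zw => ->].
have : cmean r q = cmean r (fun z => g z * (z / (z - w))) - g w * cmean r (fun z => z / (z - w)).
  rewrite -(cmeanZ _ (ltW r0) ck) -(cmeanB (ltW r0)).
  - apply: cmean_ext; first exact: ltW.
    move=> z zr; have zw := circle_neq wr zr.
    rewrite /q /dquot; case: eqP => [zw'|_]; last by field.
    by rewrite zw' subrr eqxx in zw.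
  - exact: (circle_contM cg ck).
  - exact: (@circle_contZ _ r (g w) _ ck).
rewrite mq cmean_inv_sub // mulr1 => /esym/eqP.
by rewrite subr_eq0 => /eqP.
Qed.

Lemma geometric_kernel (N : nat) z w : z != 0 -> z - w != 0 ->
  z / (z - w) = \sum_(n < N) w ^+ n * z^-1 ^+ n + w ^+ N * (z^-1 ^+ N * (z / (z - w))).
Proof.
move=> z0 zw; elim: N => [|N IH]; first by rewrite big_ord0 !expr0 add0r !mul1r.
rewrite {1}IH big_ord_recr /= -!addrA; congr (_ + _).
by rewrite !exprS; field; rewrite z0 zw.
Qed.

(** The finite geometric expansion of the kernel is inserted in Cauchy's formula. The remainder is
    [w ^+ N] times a single mean, so no series has to converge. *)
Lemma taylor rho g r B N : disc_diff rho g -> 0 < r -> r < rho -> 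
  (forall z, cmod z = r -> cmod (g z) <= B) ->
  exists c : nat -> R[i], forall w, cmod w < r ->
  cmod (g w - \sum_(n < N) c n * w ^+ n) <= 2 * (B * (r / (r - cmod w))) * (cmod w / r) ^+ N.
Proof.
move=> dg r0 rrho gB.
have cg := disc_circle_cont (disc_diff_cont dg) rrho.
pose c n := cmean r (fun z => g z * z^-1 ^+ n).
exists c => w wr; have w0 := cmod_ge0 w.
have czV := circle_cont_idV r0.
have cz n : circle_cont r (fun z => g z * z^-1 ^+ n).
  by apply: circle_contM; [exact: cg|exact: (@circle_contX R r (fun z => z^-1) n czV)].
have ck : circle_cont r (fun z => z / (z - w)).
  by apply: circle_contM; [exact: circle_cont_id|exact: circle_cont_sub_inv].
have cr : circle_cont r (fun z => g z * (z^-1 ^+ N * (z / (z - w)))).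
  apply: circle_contM; first exact: cg.
  by apply: circle_contM; [exact: (@circle_contX R r (fun z => z^-1) N czV)|exact: ck].
have sumE M : cmean r (fun z => \sum_(n < M) w ^+ n * (g z * z^-1 ^+ n)) =
    \sum_(n < M) c n * w ^+ n /\ circle_cont r (fun z => \sum_(n < M) w ^+ n * (g z * z^-1 ^+ n)).
  elim: M => [|M [IH1 IH2]].
    have e : (fun z => \sum_(n < 0) w ^+ n * (g z * z^-1 ^+ n)) = (fun=> 0).
      by apply/funext => z; rewrite big_ord0.
    by rewrite e big_ord0 cmean_cst; split; [reflexivity|exact: circle_cont_cst].
  have e : (fun z => \sum_(n < M.+1) w ^+ n * (g z * z^-1 ^+ n)) =
     (fun z => \sum_(n < M) w ^+ n * (g z * z^-1 ^+ n) + w ^+ M * (g z * z^-1 ^+ M)).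
    by apply/funext => z; rewrite big_ord_recr.
  have cM := @circle_contZ _ r (w ^+ M) _ (cz M).
  rewrite e; split; last exact: (circle_contD IH2 cM).
  rewrite (cmeanD (ltW r0) IH2 cM) (cmeanZ _ (ltW r0) (cz M)) IH1 big_ord_recr /=.
  by rewrite [w ^+ M * _]mulrC.
have [s1 s2] := sumE N.
rewrite -(cauchy_formula dg wr rrho).
rewrite (@cmean_ext _ _ _ (fun z => \sum_(n < N) w ^+ n * (g z * z^-1 ^+ n) +
   w ^+ N * (g z * (z^-1 ^+ N * (z / (z - w)))))); first last.
- move=> z zr; rewrite {1}(@geometric_kernel N _ _ (circle_neq0 r0 zr) (circle_neq wr zr)).
  rewrite mulrDr mulrCA; congr (_ + _); rewrite mulr_sumr; apply: eq_bigr => i _.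
  by rewrite mulrCA.
- exact: ltW.
rewrite (cmeanD (ltW r0) s2 (@circle_contZ _ r (w ^+ N) _ cr)) s1 (cmeanZ _ (ltW r0) cr) addrAC subrr add0r.
have hb : forall z, cmod z = r ->
    cmod (g z * (z^-1 ^+ N * (z / (z - w)))) <= B * (r^-1 ^+ N * (r / (r - cmod w))).
  move=> z zr; rewrite !cmodM cmodX !cmodV zr.
  have rw0 : 0 < r - cmod w by rewrite subr_gt0.
  apply: ler_pM; [exact: cmod_ge0| |exact: gB|].
    by rewrite mulr_ge0 ?exprn_ge0 ?invr_ge0 ?mulr_ge0 ?invr_ge0 ?cmod_ge0 // ltW.
  rewrite ler_wpM2l ?exprn_ge0 ?invr_ge0 ?(ltW r0) // ler_wpM2l ?(ltW r0) //.
  rewrite lef_pV2 ?posrE ?cmod_gt0 ?(circle_neq wr) //.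
  by have := cmodD (z - w) w; rewrite subrK zr; lra.
have := cmean_bound (ltW r0) cr hb => mb.
rewrite cmodM cmodX; apply: le_trans (ler_wpM2l _ mb) _; first by rewrite exprn_ge0.
rewrite exprMn le_eqVlt; apply/orP; left; apply/eqP; ring.
Qed.

Lemma cmean_deriv rho u r : disc_diff rho u -> 0 < r -> r < rho ->
  cmean r (fun z => u z / z) = 'D_1 u 0.
Proof.
move=> du r0 rrho.
have cu := disc_circle_cont (disc_diff_cont du) rrho.
have ci := circle_cont_idV r0.
have rho0 := lt_trans r0 rrho.
have cdq : disc_cont rho (dquot u 0).
  move=> z zr; have [->|zw] := eqVneq z 0.
    by apply: dquot_cont; apply: du; rewrite cmod0.
  by apply: differentiable_continuous; apply: dquot_diff; [exact: du|exact: zw].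
have : cmean r (dquot u 0) = dquot u 0 0.
  apply: (@cmean_center _ _ rho 0); [exact: lexx|exact: cdq| |by rewrite r0].
  move=> z /andP[z0 zr] _; apply: dquot_diff; first exact: du.
  by rewrite -cmod_gt0.
rewrite {2}/dquot eqxx => <-.
have <- : cmean r (fun z => u z / z - u 0 * z^-1) = cmean r (fun z => u z / z).
  rewrite (cmeanB (ltW r0) (circle_contM cu ci) (@circle_contZ _ r (u 0) _ ci)).
  by rewrite (cmeanZ _ (ltW r0) ci) cmean_inv // mulr0 subr0.
apply: cmean_ext; first exact: ltW.
move=> z zr; rewrite /dquot; case: eqP => [z0|_]; last by rewrite subr0 mulrBl.
by move: r0; rewrite -zr z0 cmod0 ltxx.
Qed.

Lemma circle_conj r z : cmod z = r -> z^*%R = (r ^+ 2)%:C / z.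
Proof.
move=> zr; have [->|z0] := eqVneq z 0; first by rewrite rmorph0 invr0 mulr0.
by rewrite -zr -mulC_conj mulrAC divff // mul1r.
Qed.

(** The mean of the squared modulus of [u - (c0 + c1 z)] is nonnegative. The two mixed means and the
    mean of the squared affine part are all equal to the left-hand side, so expanding gives the
    claim. *)
Lemma bessel rho u r : disc_diff rho u -> 0 < r -> r < rho ->
  (cmod (u 0) ^+ 2 + r ^+ 2 * cmod ('D_1 u 0) ^+ 2)%:C <= cmean r (fun z => u z * (u z)^*%R).
Proof.
move=> du r0 rrho.
have r0' := ltW r0.
have cu := disc_circle_cont (disc_diff_cont du) rrho.
have ci := circle_cont_idV r0.
have cid := @circle_cont_id R r.
have cuc := circle_cont_conj cu.
pose c0 : R[i] := u 0; pose c1 : R[i] := 'D_1 u 0; rewrite -/c0 -[ 'D_1 u 0]/c1.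
have m0 : cmean r u = c0 by apply: (cmean_diff_center du); rewrite r0.
have m1 := cmean_deriv du r0 rrho; rewrite -/c1 in m1.
pose l z := c0 + c1 * z.
have cl : circle_cont r l.
  exact: (circle_contD (@circle_cont_cst _ r c0) (@circle_contZ _ r c1 _ cid)).
have clc := circle_cont_conj cl.
have mul_ : cmean r (fun z => u z * (l z)^*%R) = (cmod c0 ^+ 2 + r ^+ 2 * cmod c1 ^+ 2)%:C.
  have cuz := circle_contM cu ci.
  have e z : cmod z = r -> u z * (l z)^*%R =
     c0^*%R * u z + (c1^*%R * (r ^+ 2)%:C) * (u z / z).
    move=> zr; rewrite /l rmorphD rmorphM /= (circle_conj zr); ring.
  rewrite (cmean_ext r0' e).
  rewrite (cmeanD r0' (@circle_contZ _ r _ _ cu) (@circle_contZ _ r _ _ cuz)).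
  rewrite (cmeanZ _ r0' cu) (cmeanZ _ r0' cuz) m0 m1.
  rewrite realCD realCM -!mulC_conj; ring.
have mlu : cmean r (fun z => l z * (u z)^*%R) = (cmod c0 ^+ 2 + r ^+ 2 * cmod c1 ^+ 2)%:C.
  have e z : cmod z = r -> l z * (u z)^*%R = (u z * (l z)^*%R)^*%R.
    by move=> _; rewrite rmorphM /= conjCK mulrC.
  by rewrite (cmean_ext r0' e) (cmean_conj r0' (circle_contM cu clc)) mul_ conj_realC.
have mll : cmean r (fun z => l z * (l z)^*%R) = (cmod c0 ^+ 2 + r ^+ 2 * cmod c1 ^+ 2)%:C.
  have k1 := @circle_contZ _ r (c0 * c1^*%R * (r ^+ 2)%:C) _ ci.
  have k2 := @circle_contZ _ r (c1 * c0^*%R) _ cid.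
  have k0 := @circle_cont_cst R r (cmod c0 ^+ 2 + r ^+ 2 * cmod c1 ^+ 2)%:C.
  have e z : cmod z = r -> l z * (l z)^*%R =
     (cmod c0 ^+ 2 + r ^+ 2 * cmod c1 ^+ 2)%:C + ((c0 * c1^*%R * (r ^+ 2)%:C) * z^-1
        + (c1 * c0^*%R) * z).
    move=> zr; have z0 := circle_neq0 r0 zr.
    rewrite /l rmorphD rmorphM /= (circle_conj zr) realCD realCM -!mulC_conj; field.
    by rewrite z0.
  have mid : cmean r (fun z => z) = 0.
    apply: (@cmean_diff_center rho (fun z => z)); last by rewrite r0.
    by move=> z _; exact: fun_diff_id.
  rewrite (cmean_ext r0' e) (cmeanD r0' k0 (circle_contD k1 k2)) (cmeanD r0' k1 k2).
  by rewrite (cmeanZ _ r0' ci) (cmeanZ _ r0' cid) cmean_inv // mid !mulr0 !addr0 cmean_cst.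
have : 0 <= cmean r (fun z => (u z - l z) * (u z - l z)^*%R).
  by apply: cmean_ge0 => // z _; rewrite mulC_conj lecR sqr_ge0.
have e z : cmod z = r -> (u z - l z) * (u z - l z)^*%R =
   (u z * (u z)^*%R - u z * (l z)^*%R) - (l z * (u z)^*%R - l z * (l z)^*%R).
  by move=> _; rewrite rmorphB /=; ring.
have kuu := circle_contM cu cuc; have kul := circle_contM cu clc.
have klu := circle_contM cl cuc; have kll := circle_contM cl clc.
rewrite (cmean_ext r0' e) (cmeanB r0' (circle_contB kuu kul) (circle_contB klu kll)).
by rewrite (cmeanB r0' kuu kul) (cmeanB r0' klu kll) mul_ mlu mll subrr subr0 subr_ge0.
Qed.

(** The triangular Toeplitz matrix with [g 0] on the diagonal and ['D_1 g 0] below it has norm at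
    most [S]. Its image of [(x, y)] consists of the first two Taylor coefficients of [g] times an
    affine function, to which [bessel] applies. *)
Lemma schwarz_pick_pair g S : disc_diff 1 g -> (forall z, cmod z < 1 -> cmod (g z) <= S) ->
  forall x y, cmod (g 0 * x) ^+ 2 + cmod ('D_1 g 0 * x + g 0 * y) ^+ 2 <=
    S ^+ 2 * (cmod x ^+ 2 + cmod y ^+ 2).
Proof.
move=> dg gS x y.
have S0 : 0 <= S by apply: le_trans (cmod_ge0 _) (gS 0 _); rewrite cmod0.
pose a0 : R[i] := g 0; pose a1 : R[i] := 'D_1 g 0; rewrite -/a0 -[ 'D_1 g 0]/a1.
have main r : 0 < r < 1 -> cmod (a0 * x) ^+ 2 + cmod (r%:C * a1 * x + a0 * y) ^+ 2 <=
    S ^+ 2 * (cmod x ^+ 2 + cmod y ^+ 2).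
  move=> /andP[r0 r1]; have r0' := ltW r0.
  have rC0 : (r%:C : R[i]) != 0 by rewrite -cmod_gt0 cmod_real normr_gt0 gt_eqF.
  (* With the slope [y / r] the mean of [|l|^2] over the circle of radius [r] is exactly
     [|x|^2 + |y|^2], and only the term with [a1] is damped by [r]. *)
  pose k := y / r%:C; pose l z := x + k * z; pose u z := g z * l z.
  have dl z : is_derive z 1 l k.
    apply/is_deriveCP => e e0; exists 1 => // w _.
    have -> : l w - l z - k * (w - z) = 0 by rewrite /l; ring.
    by rewrite cmod0 mulr_ge0 ?cmod_ge0 ?ltW.
  have dfl z : differentiable l z by have [/derivable1_diffP] := dl z.
  have du : disc_diff 1 u.
    by move=> z z1; apply: fun_diffM; [exact: dg|exact: dfl].
  have u0 : u 0 = a0 * x by rewrite /u /l mulr0 addr0.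
  have u1 : 'D_1 u 0 = a1 * x + a0 * k.
    have d0 : derivable g 0 1 by apply/derivable1_diffP; apply: dg; rewrite cmod0.
    have [dl0 dl0e] := dl 0.
    have e := deriveM d0 dl0; rewrite dl0e in e.
    rewrite -[LHS]/('D_1 (g * l) 0) e -/a1 /l mulr0 addr0.
    by rewrite -![_ *: _]/(_ * _) -/a0; ring.
  have := bessel du r0 r1; rewrite u0 u1.
  have -> : r ^+ 2 * cmod (a1 * x + a0 * k) ^+ 2 = cmod (r%:C * a1 * x + a0 * y) ^+ 2.
    rewrite -exprMn -{1}(ger0_norm r0') -cmod_real -cmodM; congr (cmod _ ^+ 2).
    by rewrite /k; field.
  move=> /le_trans h; rewrite -lecR; apply: h.
  have cl : circle_cont r l by move=> z _; exact: differentiable_continuous (dfl z).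
  have cu : circle_cont r u.
    by move=> z zr; apply: differentiable_continuous; apply: du; rewrite zr.
  have cuu := circle_contM cu (circle_cont_conj cu).
  have cll := circle_contM cl (circle_cont_conj cl).
  have cS := @circle_contZ _ r (S ^+ 2)%:C _ cll.
  have ci := circle_cont_idV r0.
  have cid := @circle_cont_id R r.
  have -> : (S ^+ 2 * (cmod x ^+ 2 + cmod y ^+ 2))%:C =
      cmean r (fun z => (S ^+ 2)%:C * (l z * (l z)^*%R)).
    rewrite (cmeanZ _ r0' cll) realCM; congr (_ * _).
    have k1 := @circle_contZ _ r (x * k^*%R * (r ^+ 2)%:C) _ ci.
    have k2 := @circle_contZ _ r (k * x^*%R) _ cid.
    have k0 := @circle_cont_cst R r (cmod x ^+ 2 + cmod y ^+ 2)%:C.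
    have e z : cmod z = r -> l z * (l z)^*%R =
       (cmod x ^+ 2 + cmod y ^+ 2)%:C + ((x * k^*%R * (r ^+ 2)%:C) * z^-1
        + (k * x^*%R) * z).
      move=> zr; have z0 := circle_neq0 r0 zr.
      have kk : k * k^*%R * (r ^+ 2)%:C = y * y^*%R.
        by rewrite /k rmorphM /= fmorphV /= conj_realC rmorphXn /=; field.
      rewrite /l rmorphD rmorphM /= (circle_conj zr) realCD -!mulC_conj -kk; field.
      by rewrite z0.
    have mid : cmean r (fun z => z) = 0.
      apply: (@cmean_diff_center 1 (fun z => z)); last by rewrite r0.
      by move=> z _; exact: fun_diff_id.
    rewrite (cmean_ext r0' e) (cmeanD r0' k0 (circle_contD k1 k2)) (cmeanD r0' k1 k2).
    by rewrite (cmeanZ _ r0' ci) (cmeanZ _ r0' cid) cmean_inv // mid !mulr0 !addr0 cmean_cst.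
  rewrite -subr_ge0 -(cmeanB r0' cS cuu); apply: cmean_ge0 => // z zr.
  rewrite subr_ge0 !mulC_conj -realCM lecR -exprMn.
  rewrite ler_sqr ?nnegrE ?cmod_ge0 ?mulr_ge0 ?cmod_ge0 //.
  by rewrite /u cmodM ler_wpM2r ?cmod_ge0 // gS // zr.
set K := S ^+ 2 * _; set v := a1 * x + a0 * y.
pose m := cmod (a1 * x).
have m0 : 0 <= m by exact: cmod_ge0.
have v0 : 0 <= cmod v by exact: cmod_ge0.
apply/ler_addgt0Pr => e e0.
have c0 : 0 < 1 + 2 * cmod v * m by rewrite ltr_wpDr // !mulr_ge0.
(* Replacing the radius 1 by [1 - d] costs at most [2 cmod v (d m)] in the square of [cmod v]; this
   choice keeps the cost below [e]. *)
pose d := Num.min 2^-1 (e / (1 + 2 * cmod v * m)).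
have d0 : 0 < d by rewrite lt_min invr_gt0 ltr0n divr_gt0.
have d1 : d <= 2^-1 by rewrite ge_min lexx.
have d2 : d * (1 + 2 * cmod v * m) <= e by rewrite -ler_pdivlMr // ge_min lexx orbT.
have /main h : 0 < 1 - d < 1.
  have : (2^-1 : R) < 1 by rewrite invf_lt1 // ltr1n.
  by move=> hh; apply/andP; split; lra.
have hv : cmod v <= cmod ((1 - d)%:C * a1 * x + a0 * y) + d * m.
  have -> : v = ((1 - d)%:C * a1 * x + a0 * y) + d%:C * (a1 * x).
    by rewrite /v rmorphB /= ; ring.
  by apply: le_trans (cmodD _ _) _; rewrite [cmod (d%:C * _)]cmodM cmod_real ger0_norm ?lexx // ltW.
set T := cmod ((1 - d)%:C * _ * _ + _) in h hv.
have T0 : 0 <= T by exact: cmod_ge0.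
have : cmod v ^+ 2 <= T ^+ 2 + 2 * cmod v * (d * m).
  have dm : 0 <= d * m by rewrite mulr_ge0 // ltW.
  have [vd|vd] := leP (cmod v) (d * m).
    have : cmod v * cmod v <= cmod v * (d * m) by rewrite ler_wpM2l.
    have := sqr_ge0 T; rewrite (expr2 (cmod v)).
    have : 0 <= cmod v * (d * m) by rewrite mulr_ge0.
    by nra.
  have : (cmod v - d * m) ^+ 2 <= T ^+ 2 by rewrite ler_sqr ?nnegrE //; lra.
  by have := sqr_ge0 (d * m); nra.
rewrite -/K in h; have : 2 * cmod v * (d * m) <= e by nra.
by lra.
Qed.

End OneVariable.

(** * Matrices and the ball *)

Section SumCauchySchwarz.
Context {R : realType}.

(** Lagrange's identity: the double sum of the squares of [a i * b j - a j * b i] is twice the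
    defect. *)
Lemma sum_cauchy_schwarzR (I : finType) (a b : I -> R) :
  (\sum_i a i * b i) ^+ 2 <= (\sum_i a i ^+ 2) * (\sum_i b i ^+ 2).
Proof.
have e : \sum_i \sum_j (a i * b j - a j * b i) ^+ 2 =
   2 * ((\sum_i a i ^+ 2) * (\sum_i b i ^+ 2) - (\sum_i a i * b i) ^+ 2).
  have e1 : \sum_i \sum_j a i ^+ 2 * b j ^+ 2 = (\sum_i a i ^+ 2) * (\sum_i b i ^+ 2).
    by rewrite big_distrlr.
  have e2 : \sum_i \sum_j a j ^+ 2 * b i ^+ 2 = (\sum_i a i ^+ 2) * (\sum_i b i ^+ 2).
    by rewrite exchange_big big_distrlr.
  have e3 : \sum_i \sum_j (a i * b i) * (a j * b j) = (\sum_i a i * b i) ^+ 2.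
    by rewrite expr2 big_distrlr.
  transitivity (\sum_i \sum_j a i ^+ 2 * b j ^+ 2 + \sum_i \sum_j a j ^+ 2 * b i ^+ 2
     - 2 * \sum_i \sum_j (a i * b i) * (a j * b j)); last by rewrite e1 e2 e3; ring.
  rewrite mulr_sumr -big_split /= -sumrB; apply: eq_bigr => i _.
  rewrite mulr_sumr -big_split /= -sumrB; apply: eq_bigr => j _; ring.
have : 0 <= \sum_i \sum_j (a i * b j - a j * b i) ^+ 2.
  by apply: sumr_ge0 => i _; apply: sumr_ge0 => j _; exact: sqr_ge0.
by rewrite e; lra.
Qed.

Lemma sum_cauchy_schwarz (I : finType) (a b : I -> R[i]) :
  cmod (\sum_i a i * b i) ^+ 2 <= (\sum_i cmod (a i) ^+ 2) * (\sum_i cmod (b i) ^+ 2).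
Proof.
apply: le_trans (sum_cauchy_schwarzR (fun i => cmod (a i)) (fun i => cmod (b i))).
rewrite ler_sqr ?nnegrE ?cmod_ge0 ?sumr_ge0 // => [|i _]; last by rewrite mulr_ge0 ?cmod_ge0.
by apply: le_trans (cmod_sum _ _ _) _; apply: ler_sum => i _; rewrite cmodM.
Qed.

End SumCauchySchwarz.

Section Adjoint.
Context {R : realType}.
Local Notation C := R[i].

Lemma adjM m n p (A : 'M[C]_(m, n)) (B : 'M[C]_(n, p)) : (A *m B)^t* = B^t* *m A^t*.
Proof. by rewrite trmx_mul map_mxM. Qed.
Lemma adjD m n (A B : 'M[C]_(m, n)) : (A + B)^t* = A^t* + B^t*.
Proof. by rewrite linearD map_mxD. Qed.
Lemma adjN m n (A : 'M[C]_(m, n)) : (- A)^t* = - A^t*.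
Proof. by rewrite linearN map_mxN. Qed.
Lemma adjB m n (A B : 'M[C]_(m, n)) : (A - B)^t* = A^t* - B^t*.
Proof. by rewrite adjD adjN. Qed.
Lemma adjZ m n (k : C) (A : 'M[C]_(m, n)) : (k *: A)^t* = k^*%R *: A^t*.
Proof. by rewrite linearZ map_mxZ. Qed.
Lemma adj1 n : (1%:M : 'M[C]_n)^t* = 1%:M.
Proof. by rewrite trmx1 map_mx1. Qed.

Definition nrm2 n (x : 'rV[C]_n) : R := \sum_i cmod (x 0 i) ^+ 2.
Definition fro2 m n (A : 'M[C]_(m, n)) : R := \sum_i \sum_j cmod (A i j) ^+ 2.
Definition dotr n (x y : 'rV[C]_n) : C := (x *m y^t*) 0 0.

Lemma nrm2_ge0 n (x : 'rV[C]_n) : 0 <= nrm2 x.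
Proof. by apply: sumr_ge0 => i _; rewrite sqr_ge0. Qed.
Lemma fro2_ge0 m n (A : 'M[C]_(m, n)) : 0 <= fro2 A.
Proof. by apply: sumr_ge0 => i _; apply: sumr_ge0 => j _; rewrite sqr_ge0. Qed.
Lemma nrm2_eq0 n (x : 'rV[C]_n) : nrm2 x = 0 -> x = 0.
Proof.
move=> /eqP; rewrite psumr_eq0 => [/allP h|i _]; last exact: sqr_ge0.
apply/rowP => i; rewrite mxE; apply/eqP; rewrite -cmod_eq0.
by have := h i (mem_index_enum i); rewrite /= expf_eq0.
Qed.
Lemma nrm2_gt0 n (x : 'rV[C]_n) : x != 0 -> 0 < nrm2 x.
Proof.
move=> x0; rewrite lt_neqAle nrm2_ge0 andbT eq_sym.
by apply: contra_neq x0; exact: nrm2_eq0.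
Qed.
Lemma nrm20 n : nrm2 (0 : 'rV[C]_n) = 0.
Proof. by rewrite /nrm2 big1 // => i _; rewrite mxE cmod0 expr0n. Qed.

Lemma dotrE n (x y : 'rV[C]_n) : dotr x y = \sum_i x 0 i * (y 0 i)^*%R.
Proof. by rewrite /dotr mxE; apply: eq_bigr => i _; rewrite !mxE. Qed.
Lemma dotrr n (x : 'rV[C]_n) : dotr x x = (nrm2 x)%:C.
Proof.
by rewrite dotrE /nrm2 rmorph_sum; apply: eq_bigr => i _; rewrite mulC_conj.
Qed.
Lemma dotr_conj n (x y : 'rV[C]_n) : dotr y x = (dotr x y)^*%R.
Proof.
rewrite !dotrE rmorph_sum; apply: eq_bigr => i _.
by rewrite rmorphM /= conjCK mulrC.
Qed.
Lemma dotrDl n (x y z : 'rV[C]_n) : dotr (x + y) z = dotr x z + dotr y z.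
Proof. by rewrite /dotr mulmxDl mxE. Qed.
Lemma dotrBl n (x y z : 'rV[C]_n) : dotr (x - y) z = dotr x z - dotr y z.
Proof. by rewrite /dotr mulmxBl !mxE. Qed.
Lemma dotrDr n (x y z : 'rV[C]_n) : dotr x (y + z) = dotr x y + dotr x z.
Proof. by rewrite /dotr adjD mulmxDr mxE. Qed.
Lemma nrm2D n (x y : 'rV[C]_n) : nrm2 (x + y) = nrm2 x + nrm2 y + 2 * Re (dotr x y).
Proof.
apply: (@complexI R); rewrite -dotrr dotrDl !dotrDr.
rewrite !dotrr (dotr_conj x y) !realCD realCM.
have -> : (2%:C : C) * (Re (dotr x y))%:C = dotr x y + (dotr x y)^*%R.
  by rewrite conjCE; case: (dotr x y) => a b; apply: complex_eq => /=; ring.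
ring.
Qed.
Lemma nrm2Z n k (x : 'rV[C]_n) : nrm2 (k *: x) = cmod k ^+ 2 * nrm2 x.
Proof.
by rewrite /nrm2 mulr_sumr; apply: eq_bigr => i _; rewrite mxE cmodM exprMn.
Qed.
Lemma dotr_cs n (x y : 'rV[C]_n) : cmod (dotr x y) ^+ 2 <= nrm2 x * nrm2 y.
Proof.
rewrite dotrE; apply: le_trans (sum_cauchy_schwarz _ _) _.
suff -> : nrm2 y = \sum_i cmod (y 0 i)^*%R ^+ 2 by [].
by apply: eq_bigr => i _; rewrite cmod_conj.
Qed.
Lemma dotr_mul m n (x : 'rV[C]_m) (A : 'M[C]_(m, n)) (y : 'rV[C]_n) :
  dotr (x *m A) y = dotr x (y *m A^t*).
Proof. by rewrite /dotr adjM trmxCK mulmxA. Qed.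
Lemma dotrZl n k (x y : 'rV[C]_n) : dotr (k *: x) y = k * dotr x y.
Proof. by rewrite /dotr -scalemxAl mxE. Qed.
Lemma dotrZr n k (x y : 'rV[C]_n) : dotr x (k *: y) = k^*%R * dotr x y.
Proof. by rewrite dotr_conj dotrZl rmorphM /= -dotr_conj. Qed.

Lemma nrm2_mul m n (x : 'rV[C]_m) (A : 'M[C]_(m, n)) : nrm2 (x *m A) <= nrm2 x * fro2 A.
Proof.
rewrite /fro2 exchange_big mulr_sumr; apply: ler_sum => j _.
by rewrite mxE; apply: le_trans (sum_cauchy_schwarz _ _) _.
Qed.

(** By the spectral theorem [H = P' D P] with [P] unitary and [D] diagonal. The [i]-th diagonal
    entry is the value of the form at the [i]-th row of [P], hence nonnegative, and [P'] times the
    square root of [D] is a factor. *)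
Lemma psd_factor n (H : 'M[C]_n) : H^t* = H -> (forall x : 'rV_n, 0 <= (x *m H *m x^t*) 0 0) ->
  exists S : 'M[C]_n, H = S *m S^t*.
Proof.
move=> Hh Hp.
have /hermitian_normalmx/orthomx_spectralP : H \is hermsymmx.
  by apply/is_hermitianmxP; rewrite expr0 scale1r Hh.
have Pu := spectral_unitarymx H.
rewrite invmx_unitary //; set P := spectralmx H in Pu *; set d := spectral_diag H => HE.
have d0 i : 0 <= d 0 i.
  have := Hp (row i P); rewrite {1}HE.
  have rP : row i P *m P^t* = delta_mx 0 i.
    by rewrite -row_mul (unitarymxP Pu) row1.
  rewrite !mulmxA rP -mulmxA.
  have -> : P *m (row i P)^t* = (delta_mx 0 i : 'rV_n)^t*.
    by rewrite -rP adjM trmxCK.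
  rewrite -rowE mxE (bigD1 i) //= big1 ?addr0 => [|j ji].
    by rewrite !mxE !eqxx mulr1n /= conjC1 mulr1.
  by rewrite !mxE (negbTE ji) /= ?andbF conjC0 mulr0.
pose sd := map_mx sqrtC d.
exists (P^t* *m diag_mx sd).
have dd : diag_mx sd *m (diag_mx sd)^t* = diag_mx d.
  rewrite tr_diag_mx map_diag_mx mulmx_diag; congr diag_mx.
  apply/rowP => i; rewrite !mxE.
  have s0 : 0 <= sqrtC (d 0 i) by rewrite sqrtC_ge0.
  by rewrite /= (geC0_conj s0) -expr2 sqrtCK.
by rewrite adjM trmxCK mulmxA -(mulmxA (P^t*)) dd.
Qed.

End Adjoint.

Section Ball.
Context {R : realType} {r s : nat}.
Local Notation C := R[i].
Local Notation M := 'M[C]_(r, s).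

Definition qf n (H : 'M[C]_n) (x : 'rV[C]_n) : R := Re ((x *m H *m x^t*) 0 0).

Lemma qf_row (Z : M) (x : 'rV[C]_r) :
  (x *m (1%:M - Z *m Z^t*) *m x^t*) 0 0 = (nrm2 x - nrm2 (x *m Z))%:C.
Proof.
rewrite -[LHS]/(dotr (x *m (1%:M - Z *m Z^t*)) x) mulmxBr mulmx1 dotrBl dotrr mulmxA.
by rewrite dotr_mul trmxCK dotrr -rmorphB.
Qed.

Lemma qf_rowE (Z : M) x : qf (1%:M - Z *m Z^t*) x = nrm2 x - nrm2 (x *m Z).
Proof. by rewrite /qf qf_row. Qed.

Lemma ballP (Z : M) : matrix_ball Z <-> forall x : 'rV[C]_r, x != 0 -> nrm2 (x *m Z) < nrm2 x.
Proof.
split=> h x /h; rewrite qf_row; first by rewrite ltcR subr_gt0.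
by rewrite ltcR subr_gt0.
Qed.

Lemma ball_le (Z : M) (x : 'rV[C]_r) : matrix_ball Z -> nrm2 (x *m Z) <= nrm2 x.
Proof.
move=> /ballP h; have [->|/h/ltW //] := eqVneq x 0.
by rewrite mul0mx !nrm20.
Qed.

Lemma ball0 : matrix_ball (0 : M).
Proof. by apply/ballP => x x0; rewrite mulmx0 nrm20 nrm2_gt0. Qed.

(** For [x = y Z'] one has [|x|^2 = <x Z, y>]. Cauchy-Schwarz and [|x Z| <= |x|] give
    [|x|^4 <= |x|^2 |y|^2]. *)
Lemma ball_adj_le (Z : M) (y : 'rV[C]_s) : matrix_ball Z -> nrm2 (y *m Z^t*) <= nrm2 y.
Proof.
move=> bZ; set x := y *m Z^t*.
have h : nrm2 x ^+ 2 <= nrm2 x * nrm2 y.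
  have := dotr_cs (x *m Z) y; rewrite dotr_mul -/x dotrr cmod_real ger0_norm ?nrm2_ge0 //.
  move=> /le_trans; apply; apply: ler_wpM2r; [exact: nrm2_ge0|exact: ball_le].
have [x0|x0] := eqVneq (nrm2 x) 0; first by rewrite x0 nrm2_ge0.
have xp : 0 < nrm2 x by rewrite lt_neqAle eq_sym x0 nrm2_ge0.
by move: h; rewrite expr2 ler_pM2l.
Qed.

Lemma ball_cmod (Z : M) i j : matrix_ball Z -> cmod (Z i j) < 1.
Proof.
move=> /ballP /(_ (delta_mx 0 i)) h.
have d0 : (delta_mx 0 i : 'rV[C]_r) != 0.
  by apply/eqP => /rowP /(_ i) /eqP; rewrite !mxE !eqxx oner_eq0.
have n1 : nrm2 (delta_mx 0 i : 'rV[C]_r) = 1.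
  rewrite /nrm2 (bigD1 i) //= big1 ?addr0 => [|k ki]; first by rewrite mxE !eqxx cmod1 expr1n.
  by rewrite mxE (negbTE ki) andbF cmod0 expr0n.
have {h} := h d0; rewrite n1 -rowE => h.
rewrite -(ltr_pXn2r (ltn0Sn 1)) ?nnegrE ?cmod_ge0 // expr1n.
apply: le_lt_trans h; rewrite /nrm2 (bigD1 j) //= mxE lerDl.
by apply: sumr_ge0 => k _; exact: sqr_ge0.
Qed.

End Ball.

(** * The Schwarz-Pick inequality on the ball *)

Section MatrixDifferentiability.
Context {R : realType}.
Local Notation C := R[i].

Lemma fun_diff_det (V : normedModType C) n (A : V -> 'M[C]_n) x :
  (forall i j, differentiable (fun t => A t i j) x) -> differentiable (fun t => \det (A t)) x.
Proof.
move=> dA; rewrite /determinant; apply: fun_diff_sum => s _.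
apply: fun_diffM; first exact: fun_diff_cst.
by apply: fun_diff_prod => i _; exact: dA.
Qed.

Lemma fun_diff_adj (V : normedModType C) n (A : V -> 'M[C]_n) x :
  (forall i j, differentiable (fun t => A t i j) x) ->
  forall i j, differentiable (fun t => (\adj (A t)) i j) x.
Proof.
move=> dA i j.
have -> : (fun t => (\adj (A t)) i j) = (fun t => (-1) ^+ (j + i) * \det (row' j (col' i (A t)))).
  by apply/funext => t; rewrite mxE.
apply: fun_diffM; first exact: fun_diff_cst.
apply: fun_diff_det => k l.
have -> : (fun t => (row' j (col' i (A t))) k l) = (fun t => A t (lift j k) (lift i l)).
  by apply/funext => t; rewrite !mxE.
exact: dA.
Qed.

Lemma fun_diff_mulmx (V : normedModType C) m n p (A : V -> 'M[C]_(m, n)) (B : V -> 'M[C]_(n, p)) x :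
  (forall i j, differentiable (fun t => A t i j) x) ->
  (forall i j, differentiable (fun t => B t i j) x) ->
  forall i j, differentiable (fun t => (A t *m B t) i j) x.
Proof.
move=> dA dB i j.
have -> : (fun t => (A t *m B t) i j) = (fun t => \sum_k A t i k * B t k j).
  by apply/funext => t; rewrite mxE.
by apply: fun_diff_sum => k _; apply: fun_diffM; [exact: dA|exact: dB].
Qed.

Lemma diff_mxP (V : normedModType C) m n (A : V -> 'M[C]_(m, n)) x :
  (forall i j, differentiable (fun t => A t i j) x) -> differentiable A x.
Proof.
move=> dA.
have -> : A = \sum_(i < m) (\sum_(j < n) (fun t => A t i j *: (delta_mx i j : 'M[C]_(m, n)))).
  apply/funext => t; rewrite [LHS]matrix_sum_delta fct_sumE; apply: eq_bigr => i _.
  by rewrite fct_sumE.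
apply: differentiable_sum => i; apply: differentiable_sum => j.
exact: differentiableZl.
Qed.

Lemma derive_coord (V : normedModType C) m n (A : V -> 'M[C]_(m, n)) x v i j :
  derivable A x v -> ('D_v A x) i j = 'D_v (fun t => A t i j) x.
Proof.
move=> dA; apply/esym/cvg_lim; first exact: norm_hausdorff.
have h : (fun h => h^-1 *: ((A \o shift x) (h *: v) - A x)) @ 0^' --> 'D_v A x by exact: dA.
have hc := cvg_comp _ _ h (@coord_continuous C m n i j ('D_v A x)).
by apply: cvg_trans hc; apply: near_eq_cvg; apply: nearW => t; rewrite /= !mxE.
Qed.

(** Caratheodory's form of differentiability. It serves for functions known through an equation
    [f t = a + t k t], such as those built from inverse matrices: continuity of [k] at 0 is then
    enough. *)
Lemma is_derive_mul_id (k : C -> C) a : {for 0, continuous k} ->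
  is_derive (0 : C) 1 (fun t => a + t * k t) (k 0).
Proof.
move=> /ccontP ck; apply/is_deriveCP => e /ck [d d0 hd]; exists d => // t ht.
have -> : a + t * k t - (a + 0 * k 0) - k 0 * (t - 0) = (k t - k 0) * (t - 0) by ring.
by rewrite cmodM ler_wpM2r ?cmod_ge0 // ltW // hd.
Qed.

End MatrixDifferentiability.

Section AnalyticDisc.
Context {R : realType} {r s : nat}.
Local Notation C := R[i].
Local Notation M := 'M[C]_(r, s).
Variables (w U : M).
Hypothesis ball_w : matrix_ball w.
Hypothesis U_le : forall x : 'rV[C]_r,
  nrm2 (x *m U) - nrm2 (x *m U *m w^t*) <= nrm2 x - nrm2 (x *m w).

(* The disc [t |-> (1 + t U w* )^-1 (w + t U)] in the ball, through [w] at [t = 0]. *)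
Definition disc_den (t : C) : 'M[C]_r := 1%:M + t *: (U *m w^t*).
Definition disc_num (t : C) : M := w + t *: U.
Definition mdisc (t : C) : M := (\det (disc_den t))^-1 *: (\adj (disc_den t) *m disc_num t).

(** The cross terms pair [x w] with [x U] on one side and [x] with [x U w'] on the other; they are
    equal and cancel. What remains is [|t|^2 (|x U|^2 - |x U w'|^2) < |x|^2 - |x w|^2], which
    follows from [U_le] and [|t| < 1]. *)
Lemma disc_gap t (x : 'rV[C]_r) : cmod t < 1 -> x != 0 ->
  nrm2 (x *m disc_num t) < nrm2 (x *m disc_den t).
Proof.
move=> t1 x0.
rewrite /disc_num /disc_den !mulmxDr mulmx1 -!scalemxAr mulmxA !nrm2D !nrm2Z.
rewrite !dotrZr dotr_mul.
have := U_le x; have /ballP /(_ x x0) := ball_w.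
set a := nrm2 (x *m w); set b := nrm2 x; set c := nrm2 (x *m U); set d := nrm2 (_ *m _).
set e := Re _ => h1 h2.
have : cmod t ^+ 2 * (c - d) <= cmod t ^+ 2 * (b - a) by rewrite ler_wpM2l ?sqr_ge0.
have : cmod t ^+ 2 * (b - a) < b - a.
  rewrite gtr_pMl ?subr_gt0 //.
  by rewrite expr2 (le_lt_trans _ t1) // ler_piMl ?cmod_ge0 // ltW.
by lra.
Qed.

Lemma disc_den_unit t : cmod t < 1 -> disc_den t \in unitmx.
Proof.
move=> t1; rewrite -row_free_unit -kermx_eq0; apply/eqP/row_matrixP => i.
rewrite row0; apply/eqP/negPn/negP => x0.
have xk : row i (kermx (disc_den t)) *m disc_den t = 0.
  by apply/sub_kermxP; exact: row_sub.
have := disc_gap t1 x0; rewrite xk nrm20.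
by rewrite ltNge nrm2_ge0.
Qed.

Lemma mdiscE t : cmod t < 1 -> disc_den t *m mdisc t = disc_num t.
Proof.
move=> /disc_den_unit; rewrite unitmxE unitfE => d0.
by rewrite /mdisc -scalemxAr mulmxA mul_mx_adj mul_scalar_mx scalerA mulVf // scale1r.
Qed.

Lemma mdisc_ball t : cmod t < 1 -> matrix_ball (mdisc t).
Proof.
move=> t1; apply/ballP => x x0; have du := disc_den_unit t1.
pose y := x *m invmx (disc_den t).
have xy : x = y *m disc_den t by rewrite /y mulmxKV.
have y0 : y != 0 by apply: contra_neq x0 => y0; rewrite xy y0 mul0mx.
by rewrite {1}xy -mulmxA mdiscE // [ltRHS](congr1 _ xy); exact: disc_gap.
Qed.

Lemma mdisc0 : mdisc 0 = w.
Proof.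
have := @mdiscE 0; rewrite cmod0 => /(_ ltr01).
by rewrite /disc_den /disc_num !scale0r !addr0 mul1mx.
Qed.

Lemma disc_entry_diff m n (a b : 'M[C]_(m, n)) i j t :
  differentiable (fun t : C => (a + t *: b) i j) t.
Proof.
have -> : (fun t : C => (a + t *: b) i j) = (fun t => a i j + t * b i j).
  by apply/funext => u; rewrite !mxE.
apply: fun_diffD; first exact: fun_diff_cst.
by apply: fun_diffM; [exact: fun_diff_id|exact: fun_diff_cst].
Qed.

Lemma mdisc_entry_diff t i j : cmod t < 1 -> differentiable (fun t => mdisc t i j) t.
Proof.
move=> t1; have := disc_den_unit t1; rewrite unitmxE unitfE => d0.
have -> : (fun t => mdisc t i j) =
    (fun t => (\det (disc_den t))^-1 * (\adj (disc_den t) *m disc_num t) i j).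
  by apply/funext => u; rewrite mxE.
apply: fun_diffM.
  by apply: fun_diffV => //; apply: fun_diff_det => k l; exact: disc_entry_diff.
apply: fun_diff_mulmx => k l; last exact: disc_entry_diff.
by apply: fun_diff_adj => k' l'; exact: disc_entry_diff.
Qed.

Lemma mdisc_diff t : cmod t < 1 -> differentiable mdisc t.
Proof. by move=> t1; apply: diff_mxP => i j; exact: mdisc_entry_diff. Qed.

(** The equation [disc_den t *m mdisc t = disc_num t] reads [mdisc t = w + t (U - U w' mdisc t)],
    which is the form of [is_derive_mul_id]. *)
Lemma mdisc_derive : 'D_1 mdisc 0 = U *m (1%:M - w^t* *m w).
Proof.
have c01 : cmod (0 : C) < 1 by rewrite cmod0.
have d0 : derivable mdisc 0 1 by apply/derivable1_diffP; exact: mdisc_diff.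
apply/matrixP => i j; rewrite derive_coord //.
pose k (t : C) : C := U i j - (U *m w^t* *m mdisc t) i j.
have ck : {for 0, continuous k}.
  apply: differentiable_continuous; apply: fun_diffB; first exact: fun_diff_cst.
  apply: fun_diff_mulmx => i' j'; first exact: fun_diff_cst.
  exact: mdisc_entry_diff.
have near_eq : \forall t \near (0 : C), w i j + t * k t = mdisc t i j.
  apply/(cnearP (0 : C)); exists 1 => // t; rewrite subr0 => t1.
  have := mdiscE t1; rewrite /disc_den /disc_num mulmxDl mul1mx -scalemxAl.
  have addE (X Y : M) : (X + Y) i j = X i j + Y i j by rewrite mxE.
  have scaleE c (X : M) : (c *: X) i j = c * X i j by rewrite mxE.
  move=> /(congr1 (fun X : M => X i j)); rewrite /= !addE !scaleE /k => e.
  by rewrite mulrBr addrA -e addrK.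
have [_ e] := near_eq_is_derive near_eq (is_derive_mul_id (w i j) ck).
by rewrite e /k mdisc0 mulmxBr mulmx1 mulmxA !mxE.
Qed.

End AnalyticDisc.

(** * Boundedness on the ball and Schwarz-Pick for [f] along the disc *)

Section Boundedness.
Context {R : realType} {r s : nat}.
Local Notation C := R[i].
Local Notation M := 'M[C]_(r, s).

Lemma square_compact : compact [set z : C | `|Re z| <= 1 /\ `|Im z| <= 1].
Proof.
pose f (p : R * R) : C := p.1 +i* p.2.
have -> : [set z : C | `|Re z| <= 1 /\ `|Im z| <= 1] =
    f @` ((`[-1, 1] : set R) `*` (`[-1, 1] : set R)).
  apply/seteqP; split=> [[a b] /= [ha hb]|_ [[a b] /= [ha hb] <-]] /=.
    by exists (a, b) => //=; rewrite !in_itv /= -!ler_norml.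
  by move: ha hb; rewrite !in_itv /= -!ler_norml.
apply: continuous_compact; last by apply: compact_setX; exact: segment_compact.
apply: continuous_subspaceT => -[a b]; apply/(@ccvgP _ _ (nbhs (a, b))) => e e0.
have e20 : 0 < e / 2 by rewrite divr_gt0.
exists (ball a (e / 2), ball b (e / 2)) => /=.
  by split; exact: nbhsx_ballx.
move=> [x y] /= [hx hy].
apply: le_lt_trans (cmod_le_ReIm _) _ => /=.
move: hx hy; rewrite -!ball_normE /= (distrC a) (distrC b) => hx hy; lra.
Qed.

Lemma vec_mx_continuous : continuous (vec_mx : 'rV[C]_(r * s) -> M).
Proof.
move=> v; apply: differentiable_continuous; apply: diff_mxP => i j.
have -> : (fun t : 'rV[C]_(r * s) => vec_mx t i j) = (fun t => t 0 (mxvec_index i j)).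
  by apply/funext => t; rewrite mxE.
exact: differentiable_coord.
Qed.

Lemma ball_closure_compact : compact (closure (@matrix_ball R r s)).
Proof.
pose A : set 'rV[C]_(r * s) :=
  [set v | forall k, [set z : C | `|Re z| <= 1 /\ `|Im z| <= 1] (v ord0 k)].
have cA : compact A by apply: (@rV_compact C _ (fun=> _)) => k; exact: square_compact.
have cK : compact (vec_mx @` A : set M).
  by apply: continuous_compact => //; apply: continuous_subspaceT; exact: vec_mx_continuous.
have hK : @matrix_ball R r s `<=` vec_mx @` A.
  move=> Z bZ; exists (mxvec Z); last by rewrite mxvecK.
  move=> k; case/mxvec_indexP: k => i j; rewrite mxvecE.
  have zz := ball_cmod i j bZ.
  by split; apply: le_trans (ltW zz); [exact: Re_le_cmod|exact: Im_le_cmod].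
apply: (subclosed_compact _ cK); first exact: closed_closure.
have clK : closed (vec_mx @` A : set M) by apply: compact_closed cK; exact: norm_hausdorff.
by rewrite [X in _ `<=` X](closure_id _).1 //; exact: closureS.
Qed.

Lemma cmod_continuous {T : topologicalType} (f : T -> C) x :
  {for x, continuous f} -> {for x, continuous (fun y => cmod (f y))}.
Proof.
move=> /(@ccvgP _ _ (nbhs x)) h; apply/cvgrPdist_lt => e /h.
apply: filterS => y; apply: le_lt_trans.
rewrite distrC ler_norml; apply/andP; split.
  have := cmodD (f y) (f x - f y); rewrite addrC subrK (cmodBC (f x)); lra.
by have := cmodD (f x) (f y - f x); rewrite addrC subrK; lra.
Qed.

(** A real [sup] is an upper bound only for a set that is bounded above; here boundedness comes from
    the continuity of [f] on the compact closure of the ball. *)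
Lemma sup_norm_ge f (Z : M) : holo_nbhd_closure f -> matrix_ball Z -> cmod (f Z) <= sup_norm f.
Proof.
move=> [U [oU cU hU]] bZ.
have [||c _ hc] := @compact_EVT_max _ R (fun Z => cmod (f Z)) _ _ ball_closure_compact.
- by exists Z; exact: subset_closure.
- apply: continuous_in_subspaceT => X; rewrite inE => /cU /hU df.
  by apply: cmod_continuous; exact: differentiable_continuous.
apply: ub_le_sup; last by exists Z.
exists (cmod (f c)) => _ [X bX <-]; apply: hc; rewrite inE.
exact: subset_closure.
Qed.

Lemma diff_gradient f (w V : M) : differentiable f w ->
  'D_V f w = \sum_k mxvec V 0 k * gradient f w 0 k.
Proof.
move=> df; rewrite deriveE //.
have e : V = \sum_k mxvec V 0 k *: coord_dir k.
  rewrite -{1}[V]mxvecK {1}[mxvec V]row_sum_delta linear_sum.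
  by apply: eq_bigr => k _; rewrite linearZ.
rewrite {1}e linear_sum; apply: eq_bigr => k _.
by rewrite linearZ /= mxE deriveE.
Qed.

Lemma schwarz_pick_matrix f (w U : M) : holo_nbhd_closure f -> matrix_ball w ->
  (forall x : 'rV[C]_r, nrm2 (x *m U) - nrm2 (x *m U *m w^t*) <= nrm2 x - nrm2 (x *m w)) ->
  let a1 := \sum_k mxvec (U *m (1%:M - w^t* *m w)) 0 k * gradient f w 0 k in
  forall x y, cmod (f w * x) ^+ 2 + cmod (a1 * x + f w * y) ^+ 2 <=
    sup_norm f ^+ 2 * (cmod x ^+ 2 + cmod y ^+ 2).
Proof.
move=> hf bw hU a1 x y.
have df Z : matrix_ball Z -> differentiable f Z.
  by case: hf => V [_ cV hV] bZ; apply: hV; apply: cV; exact: subset_closure.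
have dg : disc_diff 1 (f \o mdisc w U).
  move=> t t1; apply: differentiable_comp; first exact: mdisc_diff.
  by apply: df; exact: mdisc_ball.
have := @schwarz_pick_pair R _ (sup_norm f) dg.
have e0 : (f \o mdisc w U) 0 = f w by rewrite /= mdisc0.
have c01 : cmod (0 : C) < 1 by rewrite cmod0.
have e1 : 'D_1 (f \o mdisc w U) 0 = a1.
  have dm := mdisc_diff bw hU c01.
  rewrite deriveE; last exact: dg.
  rewrite diff_comp //; last by rewrite mdisc0 //; exact: df.
  have em : 'd (mdisc w U) 0 1 = U *m (1%:M - w^t* *m w) by rewrite -deriveE // mdisc_derive.
  rewrite -[LHS]/('d f (mdisc w U 0) ('d (mdisc w U) 0 1)) em mdisc0 // -deriveE; last exact: df.
  by rewrite diff_gradient //; exact: df.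
rewrite e0 e1 => hsp; apply: hsp => t t1.
by apply: (sup_norm_ge hf); exact: mdisc_ball.
Qed.

End Boundedness.

(** * Norm of the block matrix *)

Section BlockNorm.
Context {R : realType}.
Local Notation C := R[i].

Lemma l2norm_le n (x : 'cV[C]_n) (c : R) : 0 <= c ->
  (l2norm x <= c) = (\sum_i cmod (x i 0) ^+ 2 <= c ^+ 2).
Proof.
move=> c0; rewrite /l2norm -[X in _ <= X]ger0_norm // -sqrtr_sqr ler_sqrt //.
by rewrite exprn_ge0.
Qed.

Lemma opnorm_le m n (A : 'M[C]_(m, n)) (c : R) : 0 <= c ->
  (forall x : 'cV[C]_n, \sum_i cmod ((A *m x) i 0) ^+ 2 <= c ^+ 2 * \sum_i cmod (x i 0) ^+ 2) ->
  opnorm A <= c.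
Proof.
move=> c0 h; apply: ge_sup.
  exists (l2norm (A *m 0)); exists 0 => //=.
  rewrite l2norm_le // big1 ?expr1n // => i _.
  by rewrite mxE cmod0 expr0n.
move=> _ [x /= x1 <-]; rewrite l2norm_le //; apply: le_trans (h x) _.
by move: x1; rewrite l2norm_le // expr1n => x1; rewrite -[leRHS]mulr1 ler_wpM2l // sqr_ge0.
Qed.

(** The lower block [y] acts in the first row only through [t = v y]. Since [|v| <= |a1|], there is
    a scalar [u] with [a1 u = t] and [|u| <= |y|]. The inequality of size 2 at [u] and the first
    coordinate handles [u]; the rest of [y] is only multiplied by [a0], and [|a0| <= S]. *)
Lemma block_contraction n (a0 a1 : C) (v : 'rV[C]_n) (S : R) : 0 <= S ->
  (forall x y, cmod (a0 * x) ^+ 2 + cmod (a1 * x + a0 * y) ^+ 2 <=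
    S ^+ 2 * (cmod x ^+ 2 + cmod y ^+ 2)) ->
  nrm2 v <= cmod a1 ^+ 2 ->
  opnorm (@block_mx C 1 n 1 n a0%:M v 0 a0%:M) <= S.
Proof.
move=> S0 h hv; apply: opnorm_le => // x.
rewrite -[x]vsubmxK; set x0 := usubmx x; set y := dsubmx x.
rewrite mul_block_col !mul_scalar_mx mul0mx add0r.
rewrite !big_split_ord /= !big_ord1 !col_mxEu.
under eq_bigr do rewrite col_mxEd.
under [X in _ <= _ * (_ + X)]eq_bigr do rewrite col_mxEd.
set xx := x0 ord0 0; have -> : (a0 *: x0 + v *m y) ord0 0 = a0 * xx + (v *m y) 0 0.
  by rewrite [LHS]mxE [(a0 *: x0) _ _]mxE.
set t := (v *m y) 0 0; set Y := \sum_i cmod (y i 0) ^+ 2.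
have -> : \sum_i cmod ((a0 *: y) i 0) ^+ 2 = cmod a0 ^+ 2 * Y.
  by rewrite mulr_sumr; apply: eq_bigr => i _; rewrite mxE cmodM exprMn.
have Y0 : 0 <= Y by apply: sumr_ge0 => i _; exact: sqr_ge0.
have ht : cmod t ^+ 2 <= cmod a1 ^+ 2 * Y.
  rewrite /t mxE; apply: le_trans (sum_cauchy_schwarz _ _) _.
  by rewrite ler_wpM2r.
have [u ut uY] : exists2 u : C, a1 * u = t & cmod u ^+ 2 <= Y.
  have [a10|a10] := eqVneq a1 0.
    exists 0; last by rewrite cmod0 expr0n.
    apply/eqP; rewrite mulr0 eq_sym -cmod_eq0 -sqrf_eq0 eq_le sqr_ge0 andbT.
    by apply: le_trans ht _; rewrite a10 cmod0 expr0n mul0r.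
  exists (t / a1); first by rewrite mulrC divfK.
  by rewrite cmodM cmodV expr_div_n ler_pdivrMr ?exprn_gt0 ?cmod_gt0 // mulrC.
have a0S : cmod a0 ^+ 2 <= S ^+ 2.
  by have := h 0 1; rewrite !mulr0 add0r mulr1 cmod0 cmod1 expr0n expr1n !add0r mulr1.
have := h u xx; rewrite ut cmodM exprMn (addrC t).
have : cmod a0 ^+ 2 * (Y - cmod u ^+ 2) <= S ^+ 2 * (Y - cmod u ^+ 2).
  by rewrite ler_wpM2r // subr_ge0.
by nra.
Qed.

End BlockNorm.

(** * Curvature of the Bergman kernel *)

Section DerivativeRules.
Context {R : realType}.
Local Notation C := R[i].
Implicit Types (f g : C -> C) (x d : C).

Lemma addmxE m n (A B : 'M[C]_(m, n)) i j : (A + B) i j = A i j + B i j.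
Proof. by rewrite mxE. Qed.
Lemma scalemxE m n (k : C) (A : 'M[C]_(m, n)) i j : (k *: A) i j = k * A i j.
Proof. by rewrite mxE. Qed.

Lemma isd_eq f x d e : is_derive x 1 f d -> d = e -> is_derive x 1 f e.
Proof. by move=> h <-. Qed.
Lemma isd_cst (k x : C) : is_derive x 1 (fun _ : C => k) (0 : C).
Proof. exact: is_derive_cst. Qed.
Lemma isdD f g x d e : is_derive x 1 f d -> is_derive x 1 g e ->
  is_derive x 1 (fun t => f t + g t) (d + e).
Proof. by move=> df dg; exact: is_deriveD. Qed.
Lemma isdM f g x d e : is_derive x 1 f d -> is_derive x 1 g e ->
  is_derive x 1 (fun t => f t * g t) (f x * e + g x * d).
Proof. by move=> df dg; exact: is_deriveM. Qed.
Lemma isd_sum (I : Type) (r : seq I) (P : pred I) (F : I -> C -> C) (D : I -> C) x :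
  (forall i, is_derive x 1 (F i) (D i)) ->
  is_derive x 1 (fun t => \sum_(i <- r | P i) F i t) (\sum_(i <- r | P i) D i).
Proof.
move=> h; elim: r => [|i r IH].
  have -> : (fun t => \sum_(i <- [::] | P i) F i t) = (fun=> 0).
    by apply/funext => t; rewrite big_nil.
  by rewrite big_nil; exact: isd_cst.
have [Pi|nPi] := boolP (P i).
  have -> : (fun t => \sum_(j <- i :: r | P j) F j t) =
      (fun t => F i t + \sum_(j <- r | P j) F j t).
    by apply/funext => t; rewrite big_cons Pi.
  by rewrite big_cons Pi; exact: isdD.
have -> : (fun t => \sum_(j <- i :: r | P j) F j t) = (fun t => \sum_(j <- r | P j) F j t).
  by apply/funext => t; rewrite big_cons (negbTE nPi).
by rewrite big_cons (negbTE nPi); exact: IH.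
Qed.

Lemma isd_prod (I : eqType) (r : seq I) (F : I -> C -> C) (D : I -> C) x :
  uniq r -> (forall i, is_derive x 1 (F i) (D i)) ->
  is_derive x 1 (fun t => \prod_(i <- r) F i t)
    (\sum_(i <- r) D i * \prod_(j <- r | j != i) F j x).
Proof.
move=> ur h; elim: r ur => [|i r IH] /=.
  have -> : (fun t => \prod_(i <- [::]) F i t) = (fun=> 1).
    by apply/funext => t; rewrite big_nil.
  by rewrite big_nil => _; exact: isd_cst.
move=> /andP[ir ur].
have -> : (fun t => \prod_(j <- i :: r) F j t) = (fun t => F i t * \prod_(j <- r) F j t).
  by apply/funext => t; rewrite big_cons.
apply: (isd_eq (isdM (h i) (IH ur))).
rewrite big_cons big_cons eqxx /= addrC mulrC; congr (_ + _).
  congr (_ * _); rewrite big_seq [RHS]big_seq_cond; apply: eq_bigl => j.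
  by case jr : (j \in r) => //=; apply/esym; apply: contraNneq ir => <-.
rewrite mulr_sumr; apply: eq_big_seq => k kr.
rewrite big_cons; case: eqVneq => [ik|_]; first by rewrite ik kr in ir.
by rewrite mulrCA.
Qed.

(** At the identity matrix only the identity permutation contributes to the derivative of the
    Leibniz expansion. *)
Lemma isd_det n (A : C -> 'M[C]_n) (D : 'M[C]_n) : A 0 = 1%:M ->
  (forall i j, is_derive (0 : C) 1 (fun t => A t i j) (D i j)) ->
  is_derive (0 : C) 1 (fun t => \det (A t)) (\tr D).
Proof.
move=> A0 dA.
have dterm (s : 'S_n) := isdM (isd_cst ((-1) ^+ s) 0)
  (isd_prod (index_enum_uniq _) (fun i => dA i (s i))).
apply: (isd_eq (isd_sum (index_enum _) xpredT dterm)).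
rewrite (bigD1 (1%g : 'S_n)) //= [X in _ + X]big1 ?addr0.
  rewrite odd_perm1 expr0 mul1r mulr0 addr0; apply: eq_bigr => i _.
  rewrite perm1 big1 ?mulr1 // => j _.
  by rewrite A0 perm1 mxE eqxx.
move=> s s1; rewrite mulr0 addr0 big1 ?mulr0 // => i _.
(* A permutation other than the identity moves at least two points, so it moves one different from
   [i]; the entry of the identity matrix at that place is a vanishing factor. *)
have /existsP[j /andP[ji sj]] : [exists j, (j != i) && (s j != j)].
  apply: contraNT s1 => /existsPn hs.
  have fixj j : j != i -> s j = j.
    by move=> ji; have := hs j; rewrite ji /= negbK => /eqP.
  apply/eqP/permP => j; rewrite perm1; have [->|/fixj//] := eqVneq j i.
  apply/eqP; apply: contraT => si.
  by have := fixj _ si => /perm_inj e; rewrite e eqxx in si.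
rewrite (bigD1 j) //= A0 mxE eq_sym (negbTE sj) mul0r mulr0 //.
Qed.

Lemma is_deriveRP (f : R -> R) (x d : R) :
  (forall e : R, 0 < e -> exists2 del : R, 0 < del &
    forall y, `|y - x| < del -> `|f y - f x - d * (y - x)| <= e * `|y - x|) ->
  is_derive x 1 f d.
Proof.
move=> h.
have key : (fun h => h^-1 *: ((f \o shift x) (h *: 1) - f x)) @ 0^' --> d.
  apply/cvgrPdist_le => e /h [del del0 hd].
  apply/nbhs_ballP; exists del => //= t; rewrite /ball /= sub0r normrN => ht t0.
  rewrite -[t *: 1]/(t * 1) mulr1 -[_ *: _]/(_ * _).
  have := hd (t + x); rewrite addrK => /(_ ht).
  have -> : d - t^-1 * (f (t + x) - f x) = - ((f (t + x) - f x - d * t) / t) by field.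
  by rewrite normrN normrM normfV ler_pdivrMr ?normr_gt0.
split; first by apply/cvg_ex; exists d.
exact: (cvg_lim (@norm_hausdorff _ _) key).
Qed.

Lemma is_derive_Re (h : C -> C) (d : C) : is_derive (0 : C) 1 h d ->
  is_derive (0 : R) 1 (fun t : R => Re (h t%:C)) (Re d) /\
  is_derive (0 : R) 1 (fun t : R => Im (h t%:C)) (Im d).
Proof.
move=> /is_deriveCP hd; split; apply: is_deriveRP => e /hd [del del0 hh]; exists del => // y hy.
  have := hh y%:C; rewrite !subr0 cmod_real -(subr0 y) => /(_ hy).
  apply: le_trans; rewrite subr0.
  have -> : Re (h y%:C) - Re (h 0) - Re d * y = Re (h y%:C - h 0 - d * y%:C).
    by rewrite !Re_add !Re_opp Re_mul /= mulr0 subr0.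
  exact: Re_le_cmod.
have := hh y%:C; rewrite !subr0 cmod_real -(subr0 y) => /(_ hy).
apply: le_trans; rewrite subr0.
have -> : Im (h y%:C) - Im (h 0) - Im d * y = Im (h y%:C - h 0 - d * y%:C).
  by rewrite !Im_add !Im_opp Im_mul /= mulr0 add0r.
exact: Im_le_cmod.
Qed.

End DerivativeRules.

Section Curvature.
Context {R : realType} {r s : nat}.
Local Notation C := R[i].
Local Notation M := 'M[C]_(r, s).

Lemma real_dir_derivP (v : M) (g : M -> C) (w : M) (h : C -> C) (d : C) :
  (\forall t \near (0 : R), g (w + t%:C *: v) = h t%:C) ->
  is_derive (0 : C) 1 h d -> real_dir_deriv v g w = d.
Proof.
move=> near_gh /is_derive_Re [h1 h2].
have e1 : \forall t \near (0 : R), Re (h t%:C) = Re (g (w + t%:C *: v)).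
  by apply: filterS near_gh => t ->.
have e2 : \forall t \near (0 : R), Im (h t%:C) = Im (g (w + t%:C *: v)).
  by apply: filterS near_gh => t ->.
have [_ k1] := near_eq_is_derive e1 h1; have [_ k2] := near_eq_is_derive e2 h2.
by rewrite /real_dir_deriv !derive1E; apply: complex_eq.
Qed.

Definition pdef (W : M) : 'M[C]_r := 1%:M - W *m W^t*.

Lemma pdef_herm W : (pdef W)^t* = pdef W.
Proof. by rewrite adjB adj1 adjM trmxCK. Qed.

Lemma det_adj n (A : 'M[C]_n) : \det (A^t*) = (\det A)^*%R.
Proof. by rewrite det_map_mx det_tr. Qed.

Lemma det_pdef_real W : \det (pdef W) = (Re (\det (pdef W)))%:C.
Proof.
have : (\det (pdef W))^*%R = \det (pdef W) by rewrite -det_adj pdef_herm.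
move=> e; apply: complex_eq => //=.
by move: e; rewrite conjCE; case: (\det _) => a b /= -[/eqP]; rewrite eqNr => /eqP.
Qed.

(** The factorization [S S'] makes the determinant [|det S|^2]. It cannot vanish, since a null
    vector [x] would satisfy [|x W| = |x|]. *)
Lemma det_pdef_gt0 W : matrix_ball W -> 0 < Re (\det (pdef W)).
Proof.
move=> bW; have [|x|S PE] := @psd_factor R r (pdef W); first exact: pdef_herm.
  by rewrite qf_row lecR subr_ge0 ball_le.
have e : \det (pdef W) = (cmod (\det S) ^+ 2)%:C.
  by rewrite PE det_mulmx det_adj mulC_conj.
rewrite e /= lt_neqAle sqr_ge0 andbT eq_sym; apply/eqP => /(congr1 (real_complex R)).
rewrite -e => d0.
have : \det (pdef W) == 0 by rewrite d0.
case/det0P => x x0 xP; have /ballP/(_ x x0) := bW.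
have := qf_rowE W x; rewrite /qf xP mul0mx mxE /= => /esym/eqP.
by rewrite subr_eq0 => /eqP ->; rewrite ltxx.
Qed.

Lemma log_bergman (lambda : R) W : 0 < Re (\det (pdef W)) ->
  ln (bergman_diag_pow lambda W) = - (lambda * (r + s)%:R) * ln (Re (\det (pdef W))).
Proof.
move=> d0; rewrite /bergman_diag_pow ln_powR /bergman -/(pdef W) det_pdef_real.
rewrite -rmorphXn -fmorphV /= lnV ?posrE ?exprn_gt0 // lnXn //.
by rewrite -mulr_natl; ring.
Qed.

(** The conjugate of [t] is replaced by [t], which makes this holomorphic in [t]. It agrees with
    [pdef (W + t v)] at real [t], and a real directional derivative sees nothing else. *)
Definition pline (W v : M) (t : C) : 'M[C]_r := 1%:M - (W + t *: v) *m (W^t* + t *: v^t*).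
Definition pslope (W v : M) (t : C) : 'M[C]_r := - (v *m W^t* + W *m v^t*) - t *: (v *m v^t*).

Lemma plineE W v t : pline W v t = pdef W + t *: pslope W v t.
Proof.
rewrite /pline /pdef /pslope mulmxDl !mulmxDr -!scalemxAr -!scalemxAl.
move: (1%:M) (W *m W^t* ) (W *m v^t* ) (v *m W^t* ) (v *m v^t* ) => I0 A B D E.
by apply/matrixP => i j; rewrite !mxE; ring.
Qed.

Lemma pline_real W v (t : R) : pline W v t%:C = pdef (W + t%:C *: v).
Proof. by rewrite /pline /pdef adjD adjZ conj_realC. Qed.

Lemma pslope_diff W v i j t : differentiable (fun t => pslope W v t i j) t.
Proof.
have -> : (fun t => pslope W v t i j) =
    (fun t => (- (v *m W^t* + W *m v^t*)) i j + t * (- (v *m v^t*)) i j).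
  by apply/funext => u; rewrite /pslope -scalerN !mxE.
apply: fun_diffD; first exact: fun_diff_cst.
by apply: fun_diffM; [exact: fun_diff_id|exact: fun_diff_cst].
Qed.

Lemma pslope0 W v : pslope W v 0 = - (v *m W^t* + W *m v^t*).
Proof. by rewrite /pslope scale0r subr0. Qed.

Lemma pline_diff W v i j t : differentiable (fun t => pline W v t i j) t.
Proof.
have -> : (fun t => pline W v t i j) = (fun t => pdef W i j + t * pslope W v t i j).
  by apply/funext => u; rewrite plineE !mxE.
apply: fun_diffD; first exact: fun_diff_cst.
by apply: fun_diffM; [exact: fun_diff_id|exact: pslope_diff].
Qed.

(** Jacobi's formula: taking out [\det (pdef W)] leaves a curve through the identity, where
    [isd_det] applies. *)
Lemma det_pline_derive W v : pdef W \in unitmx ->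
  is_derive (0 : C) 1 (fun t => \det (pline W v t))
    (\det (pdef W) * \tr (invmx (pdef W) *m - (v *m W^t* + W *m v^t*))).
Proof.
move=> Pu.
pose A t : 'M[C]_r := 1%:M + t *: (invmx (pdef W) *m pslope W v t).
have -> : (fun t => \det (pline W v t)) = (fun t => \det (pdef W) * \det (A t)).
  apply/funext => t; rewrite -det_mulmx; congr (\det _).
  by rewrite /A mulmxDr mulmx1 -scalemxAr mulmxA mulmxV // mul1mx plineE.
have A0 : A 0 = 1%:M by rewrite /A scale0r addr0.
have dA : is_derive (0 : C) 1 (fun t => \det (A t)) (\tr (invmx (pdef W) *m pslope W v 0)).
  apply: isd_det => // i j.
  have -> : (fun t => A t i j) =
      (fun t => (1%:M : 'M[C]_r) i j + t * (invmx (pdef W) *m pslope W v t) i j).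
    by apply/funext => t; rewrite /A addmxE scalemxE.
  apply: (@is_derive_mul_id R (fun t => (invmx (pdef W) *m pslope W v t) i j)).
  apply: differentiable_continuous; apply: fun_diff_mulmx => k l; last exact: pslope_diff.
  exact: fun_diff_cst.
apply: (isd_eq (isdM (isd_cst (\det (pdef W)) 0) dA)).
by rewrite mulr0 addr0 pslope0.
Qed.

Lemma near_det_pline W v : 0 < Re (\det (pdef W)) ->
  \forall t \near (0 : R), 0 < Re (\det (pdef (W + t%:C *: v))).
Proof.
move=> d0.
have c : {for (0 : R), continuous (fun t : R => Re (\det (pline W v t%:C)))}.
  apply: (@Re_continuous R (fun t : R => \det (pline W v t%:C))).
  apply: (@continuous_comp _ _ _ (fun t : R => t%:C : C) (fun t => \det (pline W v t))).
    by apply/rcontP => e e0; exists e => // x; rewrite -rmorphB cmod_real.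
  by apply: differentiable_continuous; apply: fun_diff_det => i j; exact: pline_diff.
have p0 : pline W v (0 : R)%:C = pdef W by rewrite pline_real scale0r addr0.
move/cvgrPdist_lt: c => /(_ _ d0).
apply: filterS => t; rewrite p0 pline_real => h.
by move: h; rewrite ltr_distl => /andP[_]; rewrite ltrDr.
Qed.


Lemma tr_adj n (A : 'M[C]_n) : \tr (A^t*) = (\tr A)^*%R.
Proof. by rewrite -(mxtrace_tr A) /mxtrace rmorph_sum; apply: eq_bigr => i _; rewrite !mxE. Qed.

Lemma mulmx_split (N Y : 'M[C]_r) (X w : M) (S : 'M[C]_(s, r)) :
  N *m (X *m S + Y) *m N *m w + N *m X = (N *m X *m S *m N *m w + N *m X) + N *m Y *m N *m w.
Proof. by rewrite mulmxDr !mulmxDl mulmxA addrAC. Qed.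

(** The derivative in the direction [X] is a part [A], complex linear in [X], plus a conjugate
    linear part [B]. In the direction [i X] it is [i (A - B)], and the Wirtinger combination keeps
    [A]. *)
Lemma wirtinger_alg (nu : C) (N : 'M[C]_r) (X w : M) (E : 'M[C]_(s, r)) :
  (nu * \tr ((N *m (X *m w^t* + w *m X^t*) *m N *m w + N *m X) *m E) -
   'i * (nu * \tr ((N *m ('i *: X *m w^t* + w *m (- 'i *: X^t*)) *m N *m w +
          N *m ('i *: X)) *m E))) / 2 =
  nu * \tr (N *m X *m (1%:M + w^t* *m N *m w) *m E).
Proof.
have e2 : N *m ('i *: X *m w^t* + w *m (- 'i *: X^t*)) *m N *m w + N *m ('i *: X) =
    'i *: (N *m X *m w^t* *m N *m w + N *m X - N *m (w *m X^t*) *m N *m w).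
  rewrite -scalemxAl -scalemxAr scaleNr -scalerBr -!scalemxAr -!scalemxAl -scalerDr.
  by rewrite mulmx_split mulmxN !mulNmx.
have e3 : N *m X *m (1%:M + w^t* *m N *m w) = N *m X *m w^t* *m N *m w + N *m X.
  by rewrite mulmxDr mulmx1 addrC !mulmxA.
have key (T1 T2 T3 A B : M) : T1 = A + B -> T2 = 'i *: (A - B) -> T3 = A ->
    (nu * \tr (T1 *m E) - 'i * (nu * \tr (T2 *m E))) / 2 = nu * \tr (T3 *m E).
  move=> -> -> ->; rewrite -scalemxAl mxtraceZ mulmxDl mulmxBl mxtraceD.
  have -> : \tr (A *m E - B *m E) = \tr (A *m E) - \tr (B *m E) by rewrite linearB.
  move: (\tr (A *m E)) (\tr (B *m E)) => a b.
  have i2 : 'i * 'i = -1 :> C by rewrite -expr2 sqr_i.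
  have -> : nu * (a + b) - 'i * (nu * ('i * (a - b))) =
     nu * (a + b) - ('i * 'i) * nu * (a - b) by ring.
  by rewrite i2; field.
exact: (key _ _ _ _ _ (mulmx_split _ _ _ _ _) e2 e3).
Qed.

Lemma tr_herm (N : 'M[C]_r) (W v : M) : N^t* = N ->
  \tr (N *m W *m v^t*) = (\tr (N *m v *m W^t*))^*%R.
Proof. by move=> HN; rewrite -tr_adj !adjM trmxCK HN mulmxA [RHS]mxtrace_mulC mulmxA. Qed.

Lemma near_neq0 (f : C -> C) z : {for z, continuous f} -> f z != 0 -> \forall t \near z, f t != 0.
Proof.
move=> /ccontP cf f0; have c0 : 0 < cmod (f z) by rewrite cmod_gt0.
have [d dd hd] := cf _ c0; apply/cnearP; exists d => // t /hd h.
by apply: contraTneq h => ->; rewrite sub0r cmodN ltxx.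
Qed.

Lemma for_cont_mulmx m n p (A : C -> 'M[C]_(m, n)) (B : C -> 'M[C]_(n, p)) z :
  (forall i j, {for z, continuous (fun t => A t i j)}) ->
  (forall i j, {for z, continuous (fun t => B t i j)}) ->
  forall i j, {for z, continuous (fun t => (A t *m B t) i j)}.
Proof.
move=> cA cB i j.
have -> : (fun t => (A t *m B t) i j) = (fun t => \sum_k A t i k * B t k j).
  by apply/funext => t; rewrite mxE.
by apply: for_cont_sum => l _; apply: for_contM; [exact: cA|exact: cB].
Qed.

Lemma for_cont_mulmxr m n p (A : C -> 'M[C]_(m, n)) (B : 'M[C]_(n, p)) z :
  (forall i j, {for z, continuous (fun t => A t i j)}) ->
  forall i j, {for z, continuous (fun t => (A t *m B) i j)}.
Proof.
move=> cA; apply: (@for_cont_mulmx _ _ _ A (fun=> B)) => // i j.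
exact: for_cont_cst.
Qed.

Lemma resolvent (N K P L : 'M[C]_r) (t : C) : K *m (P + t *: L) = 1%:M -> P *m N = 1%:M ->
  K = N - t *: (K *m L *m N).
Proof.
move=> e1 e2; have : K *m (P + t *: L) *m N = N by rewrite e1 mul1mx.
rewrite mulmxDr mulmxDl -(mulmxA K P) e2 mulmx1 -scalemxAr -scalemxAl => e.
by rewrite -[X in X - _]e addrK.
Qed.

Lemma resolvent_trace (N K L : 'M[C]_r) (w v : M) (E : 'M[C]_(s, r)) (t : C) :
  K = N - t *: (K *m L *m N) ->
  \tr (K *m (w + t *: v) *m E) =
  \tr (N *m w *m E) + t * \tr ((K *m v - K *m L *m N *m w) *m E).
Proof.
move=> KN; rewrite -mxtraceZ scalemxAl -mxtraceD -mulmxDl; congr (\tr (_ *m _)).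
rewrite mulmxDr -scalemxAr {1}KN mulmxBl -scalemxAl scalerBr -addrA; congr (_ + _).
by rewrite addrC.
Qed.

Lemma pdef_unit W : 0 < Re (\det (pdef W)) -> pdef W \in unitmx.
Proof.
move=> d0; rewrite unitmxE unitfE det_pdef_real; apply/eqP => -[e].
by rewrite e ltxx in d0.
Qed.

Lemma invmx_adj n (A : 'M[C]_n) : (invmx A)^t* = invmx (A^t*).
Proof. by rewrite trmx_inv map_invmx. Qed.

Lemma invmx_pdef_herm W : (invmx (pdef W))^t* = invmx (pdef W).
Proof. by rewrite invmx_adj pdef_herm. Qed.

Section FirstDerivative.
Variables (lambda : R) (W : M).
Hypothesis d0 : 0 < Re (\det (pdef W)).
Let nu : R := lambda * (r + s)%:R.
Let L (W : M) : C := (ln (bergman_diag_pow lambda W))%:C.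
Let N := invmx (pdef W).

Lemma real_mul_twice_Re (k : R) (z : C) :
  (k * Re (z + z^*%R)) +i* 0 = k%:C * (z + z^*%R).
Proof. by rewrite conjCE; case: z => a b; apply: complex_eq => /=; ring. Qed.

Lemma log_bergman_dir (v : M) :
  real_dir_deriv v L W = nu%:C * (\tr (N *m v *m W^t*) + \tr (N *m W *m v^t*)).
Proof.
have Pu := pdef_unit d0.
have [h1 _] := is_derive_Re (det_pline_derive v Pu).
set D := Re (_ * _) in h1.
pose p (t : R) := Re (\det (pline W v t%:C)).
have p0 : p 0 = Re (\det (pdef W)) by rewrite /p pline_real scale0r addr0.
have hp : is_derive (0 : R) 1 p D by exact: h1.
have hl : is_derive (p 0) 1 (@ln R) (p 0)^-1 by apply: is_derive1_ln; rewrite p0.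
have hc : is_derive (0 : R) 1 (fun t => (- nu) * ln (p t)) (- nu * ((p 0)^-1 * D)).
  have h2 : is_derive (0 : R) 1 (@ln R \o p) ((p 0)^-1 * D).
    by have := is_derive1_comp hl hp; rewrite mulrC.
  by have := is_deriveZ (- nu) h2.
have ne : \forall t \near (0 : R), - nu * ln (p t) = Re (L (W + t%:C *: v)).
  apply: filterS (near_det_pline v d0) => t ht.
  rewrite -[RHS]/(ln (bergman_diag_pow lambda (W + t%:C *: v))) (log_bergman lambda ht).
  by rewrite /p pline_real.
have [_ e1] := near_eq_is_derive ne hc.
have e2 : derive1 (fun t : R => Im (L (W + t%:C *: v))) 0 = 0.
  by rewrite /L /=; exact: derive1_cst.
have tau : \tr (N *m W *m v^t*) = (\tr (N *m v *m W^t*))^*%R.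
  exact: tr_herm (invmx_pdef_herm W).
have reD : D = - (p 0) * Re (\tr (N *m v *m W^t*) + \tr (N *m W *m v^t*)).
  rewrite /D -/N mulmxN mulmxDr !mulmxA linearN /= mxtraceD p0 det_pdef_real.
  by rewrite Re_mul /= mul0r subr0 Re_opp mulrN mulNr.
rewrite /real_dir_deriv derive1E e1 e2 reD.
have -> : - nu * ((p 0)^-1 * (- p 0 * Re (\tr (N *m v *m W^t*) + \tr (N *m W *m v^t*)))) =
   nu * Re (\tr (N *m v *m W^t*) + \tr (N *m W *m v^t*)).
  have alg (a b c : R) : b != 0 -> - a * (b^-1 * (- b * c)) = a * c by move=> b0; field.
  by apply: alg; rewrite p0 gt_eqF.
rewrite tau; exact: real_mul_twice_Re.
Qed.

Lemma wirtinger_bar_log j :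
  wirtinger_bar j L W = nu%:C * \tr (N *m W *m (coord_dir j)^t*).
Proof.
rewrite /wirtinger_bar !log_bergman_dir adjZ -!scalemxAr -!scalemxAl !linearZ /=.
have -> : ('i : C)^*%R = - 'i by rewrite conjCE; apply: complex_eq; rewrite /= ?oppr0.
set a := \tr _; set b := \tr _.
have i2 : 'i * 'i = -1 :> C by rewrite -expr2 sqr_i.
have -> : nu%:C * (a + b) + 'i * (nu%:C * ('i * a + - 'i * b)) =
   nu%:C * (a + b) + nu%:C * (('i * 'i) * a - ('i * 'i) * b) by ring.
by rewrite i2; field.
Qed.

End FirstDerivative.

Section SecondDerivative.
Variables (lambda : R) (w : M).
Hypothesis ball_w : matrix_ball w.
Let nu : R := lambda * (r + s)%:R.

Lemma invmx_pline_cont v i j : {for (0 : C), continuous (fun t => invmx (pline w v t) i j)}.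
Proof.
have d0 : \det (pline w v 0) != 0.
  rewrite plineE scale0r addr0 -unitfE -unitmxE.
  exact: pdef_unit (det_pdef_gt0 ball_w).
have dd : differentiable (fun t => \det (pline w v t)) (0 : C).
  by apply: fun_diff_det => k l; exact: pline_diff.
have nz := near_neq0 (differentiable_continuous dd) d0.
have ne : \forall t \near (0 : C),
    (\det (pline w v t))^-1 * (\adj (pline w v t)) i j = invmx (pline w v t) i j.
  by apply: filterS nz => t tn; rewrite /invmx unitmxE unitfE tn scalemxE.
have d1 : differentiable (fun t => (\det (pline w v t))^-1 * (\adj (pline w v t)) i j) (0 : C).
  apply: fun_diffM; last by apply: fun_diff_adj => k l; exact: pline_diff.
  exact: fun_diffV.
have /derivable1_diffP d2 := d1.
have /derivable1_diffP := near_eq_derivable ne d2.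
exact: differentiable_continuous.
Qed.

(** The resolvent identity writes the function on the line exactly as [a + t * k t]. Hence only
    continuity of the inverse matrix along the line is used, never its derivative. *)
Lemma second_dir (v : M) (E : M) (N : 'M[C]_r) : N = invmx (pdef w) ->
  real_dir_deriv v (fun W => nu%:C * \tr (invmx (pdef W) *m W *m E^t*)) w =
  nu%:C * \tr ((N *m (v *m w^t* + w *m v^t*) *m N *m w + N *m v) *m E^t*).
Proof.
move=> NE; have d0 := det_pdef_gt0 ball_w.
have Pu := pdef_unit d0.
have PN : pdef w *m N = 1%:M by rewrite NE mulmxV.
pose k t : C := nu%:C * \tr ((invmx (pline w v t) *m v
   - invmx (pline w v t) *m pslope w v t *m N *m w) *m E^t*).
pose a : C := nu%:C * \tr (N *m w *m E^t*).
have ck : {for (0 : C), continuous k}.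
  apply: for_contM; first exact: for_cont_cst.
  apply: for_cont_sum => i _; apply: for_cont_mulmxr => i' j'.
  have -> : (fun t => (invmx (pline w v t) *m v
       - invmx (pline w v t) *m pslope w v t *m N *m w) i' j') =
     (fun t => (invmx (pline w v t) *m v) i' j'
        - (invmx (pline w v t) *m pslope w v t *m N *m w) i' j').
    by apply/funext => t; rewrite [LHS]mxE [X in _ + X]mxE.
  apply: for_contB.
    by apply: (@for_cont_mulmxr _ _ _ (fun t => invmx (pline w v t))) => *; exact: invmx_pline_cont.
  apply: (@for_cont_mulmxr _ _ _ (fun t => invmx (pline w v t) *m pslope w v t *m N)).
  apply: (@for_cont_mulmxr _ _ _ (fun t => invmx (pline w v t) *m pslope w v t)).
  apply: (@for_cont_mulmx _ _ _ (fun t => invmx (pline w v t)) (pslope w v)) => *.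
    exact: invmx_pline_cont.
  by apply: differentiable_continuous; exact: pslope_diff.
have ha := is_derive_mul_id a ck.
have k0 : k 0 = nu%:C * \tr ((N *m (v *m w^t* + w *m v^t*) *m N *m w + N *m v) *m E^t*).
  rewrite /k plineE scale0r addr0 -NE pslope0; congr (_ * \tr (_ *m _)).
  by rewrite mulmxN !mulNmx opprK addrC.
rewrite (real_dir_derivP _ ha); first exact: k0.
apply: filterS (near_det_pline v d0) => t /pdef_unit ut.
have e1 : invmx (pline w v t%:C) *m (pdef w + t%:C *: pslope w v t%:C) = 1%:M.
  by rewrite -plineE; apply: mulVmx; rewrite pline_real.
rewrite -pline_real (resolvent_trace _ _ _ (resolvent e1 PN)) /a /k.
by rewrite mulrDr mulrCA.
Qed.

(** The factor [1 + w' N w] is the inverse of [1 - w' w], as [QQ'] in [rho_contractive_ball]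
    confirms. *)
Lemma curvatureE (i j : 'I_(r * s)) (N : 'M[C]_r) : N = invmx (pdef w) ->
  (- curvature lambda w) i j =
  nu%:C * \tr (N *m coord_dir i *m (1%:M + w^t* *m N *m w) *m (coord_dir j)^t*).
Proof.
move=> NE; rewrite /curvature opprK mxE.
have d0 := det_pdef_gt0 ball_w.
have main v : real_dir_deriv v (wirtinger_bar j (fun W => (ln (bergman_diag_pow lambda W))%:C)) w =
    real_dir_deriv v (fun W => nu%:C * \tr (invmx (pdef W) *m W *m (coord_dir j)^t*)) w.
  have ne : \forall t \near (0 : R),
     (wirtinger_bar j (fun W => (ln (bergman_diag_pow lambda W))%:C)) (w + t%:C *: v) =
     nu%:C * \tr (invmx (pdef (w + t%:C *: v)) *m (w + t%:C *: v) *m (coord_dir j)^t*).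
    apply: filterS (near_det_pline v d0) => t ht.
    exact: wirtinger_bar_log.
  rewrite /real_dir_deriv !derive1E; congr Complex; apply: near_eq_derive;
  by apply: filterS ne => t ->.
rewrite /wirtinger !main !(second_dir _ _ NE) adjZ.
have -> : ('i : C)^*%R = - 'i by rewrite conjCE; apply: complex_eq; rewrite /= ?oppr0.
exact: wirtinger_alg.
Qed.

End SecondDerivative.

End Curvature.

(** * Inverse of the curvature and contractivity *)

Section CurvatureInverse.
Context {R : realType} {r s : nat}.
Local Notation C := R[i].
Local Notation M := 'M[C]_(r, s).

Lemma tr_mul_adj (X Y : M) :
  \tr (X *m Y^t*) = \sum_k mxvec X 0 k * (mxvec Y 0 k)^*%R.
Proof.
have -> : \sum_k mxvec X 0 k * (mxvec Y 0 k)^*%R =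
    \sum_i \sum_j mxvec X 0 (mxvec_index i j) * (mxvec Y 0 (mxvec_index i j))^*%R.
  by rewrite pair_big /= (reindex _ (curry_mxvec_bij r s)); apply: eq_bigr => -[i j] _.
apply: eq_bigr => i _; rewrite mxE; apply: eq_bigr => j _.
by rewrite !mxvecE !mxE.
Qed.

Lemma tr_mul_fro m n (X : 'M[C]_(m, n)) : \tr (X *m X^t*) = (fro2 X)%:C.
Proof.
rewrite /fro2 rmorph_sum; apply: eq_bigr => i _; rewrite mxE rmorph_sum.
by apply: eq_bigr => j _; rewrite !mxE mulC_conj.
Qed.

Lemma tr_coord (A : M) (j : 'I_(r * s)) : \tr (A *m (coord_dir j)^t*) = mxvec A 0 j.
Proof.
rewrite tr_mul_adj /coord_dir vec_mxK (bigD1 j) //= big1 ?addr0 => [|k kj].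
  by rewrite mxE !eqxx conjC1 mulr1.
by rewrite mxE (negbTE kj) andbF conjC0 mulr0.
Qed.

Definition sandwich (k : C) (P : 'M[C]_r) (Q : 'M[C]_s) : M -> M :=
  fun Y => k *: (P *m Y *m Q).

(** The rows are the images of the coordinate directions, so the matrix acts on vectorized matrices
    from the right. *)
Definition sandwich_mx (k : C) P Q : 'M[C]_(r * s) :=
  \matrix_(i, j) mxvec (sandwich k P Q (coord_dir i)) 0 j.

Lemma sandwich_mxE k P Q (Y : M) :
  mxvec Y *m sandwich_mx k P Q = mxvec (sandwich k P Q Y).
Proof.
have e : Y = \sum_i mxvec Y 0 i *: coord_dir i.
  rewrite -{1}[Y]mxvecK {1}[mxvec Y]row_sum_delta linear_sum.
  by apply: eq_bigr => i _; rewrite linearZ.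
have lin (v : 'I_(r * s) -> C) : sandwich k P Q (\sum_i v i *: coord_dir i) =
    \sum_i v i *: sandwich k P Q (coord_dir i).
  rewrite /sandwich mulmx_sumr mulmx_suml scaler_sumr; apply: eq_bigr => i _.
  by rewrite -scalemxAr -scalemxAl scalerA mulrC -scalerA.
apply/rowP => j; rewrite mxE {2}e lin linear_sum summxE.
by apply: eq_bigr => i _; rewrite linearZ scalemxE mxE.
Qed.

Lemma sandwich_mx_inv k P Q P' Q' : k != 0 -> P *m P' = 1%:M -> P' *m P = 1%:M ->
  Q' *m Q = 1%:M -> Q *m Q' = 1%:M ->
  sandwich_mx k P Q *m sandwich_mx k^-1 P' Q' = 1%:M.
Proof.
move=> k0 e1 e2 e3 e4; apply/row_matrixP => i; rewrite row_mul.
have -> : row i (sandwich_mx k P Q) = mxvec (sandwich k P Q (coord_dir i)).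
  by apply/rowP => j; rewrite !mxE.
rewrite sandwich_mxE /sandwich -scalemxAr -scalemxAl scalerA mulVf // scale1r.
rewrite !mulmxA e2 mul1mx -mulmxA e4 mulmx1 /coord_dir vec_mxK.
by rewrite row1.
Qed.

Lemma invmx_uniq n (A B : 'M[C]_n) : A *m B = 1%:M -> invmx A = B.
Proof. by move=> e; have [u _] := mulmx1_unit e; rewrite -[LHS]mulmx1 -e mulKmx. Qed.

Theorem rho_contractive_ball (lambda : R) (w : M) (A : 'M[C]_(r * s)) :
  1 <= lambda * (r + s)%:R -> matrix_ball w -> curvature_factor lambda w A ->
  rho_contractive A w.
Proof.
move=> nu1 bw hA f hf.
set nu := lambda * _ in nu1.
have nu0 : 0 < nu by lra.
have nuC : (nu%:C : C) != 0 by rewrite -cmod_gt0 cmod_real normr_gt0 gt_eqF.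
pose P := pdef w; pose Q : 'M[C]_s := 1%:M - w^t* *m w.
have Pu : P \in unitmx := pdef_unit (det_pdef_gt0 bw).
pose Q' := 1%:M + w^t* *m invmx P *m w.
have wNw : w *m w^t* = 1%:M - P by rewrite /P /pdef opprB addrC subrK.
have QQ' : Q' *m Q = 1%:M.
  have e : w^t* *m invmx P *m w *m (w^t* *m w) = w^t* *m invmx P *m w - w^t* *m w.
    rewrite -!mulmxA (mulmxA w) wNw mulmxBl mul1mx !mulmxBr (mulmxA (invmx P)) mulVmx //.
    by rewrite mul1mx.
  by rewrite /Q' /Q mulmxDl mul1mx mulmxBr mulmx1 e subKr subrK.
have Q'Q : Q *m Q' = 1%:M by apply: mulmx1C.
have cE : - curvature lambda w = sandwich_mx nu%:C (invmx P) Q'.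
  apply/matrixP => i j; rewrite (curvatureE lambda bw _ _ (erefl _)) mxE /sandwich.
  by rewrite linearZ mxE -tr_coord.
have inv : invmx (- (curvature lambda w)^T) = (sandwich_mx (nu%:C)^-1 P Q)^T.
  have -> : - (curvature lambda w)^T = (sandwich_mx nu%:C (invmx P) Q')^T by rewrite -cE; move: (curvature lambda w) => X; apply/matrixP => i j; rewrite !mxE.
  rewrite -trmx_inv; congr (_^T).
  exact: invmx_uniq (sandwich_mx_inv nuC (mulVmx Pu) (mulmxV Pu) Q'Q QQ').
pose g := gradient f w.
(* With this conjugation the derivative of [f] along [V] is [tr (V F')]. *)
pose F : M := vec_mx (map_mx Num.conj g).
have [S PE] : exists S : 'M[C]_r, P = S *m S^t*.
  apply: psd_factor; first exact: pdef_herm.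
  by move=> x; rewrite qf_row lecR subr_ge0; exact: ball_le.
have [T QE] : exists T : 'M[C]_s, Q = T *m T^t*.
  apply: psd_factor; first by rewrite adjB adj1 adjM trmxCK.
  move=> x; have := qf_row (w^t*) x; rewrite trmxCK => ->.
  by rewrite lecR subr_ge0; exact: ball_adj_le.
(* This is [tr (P F Q F')]. As a squared Frobenius norm it is visibly nonnegative, and it dominates
   the operator norm of [S' F T], which gives the hypothesis on [U]. *)
pose n2 := fro2 (S^t* *m F *m T).
have n20 : 0 <= n2 := fro2_ge0 _.
pose c := \sum_k mxvec (P *m F *m Q) 0 k * g 0 k.
have gF k : g 0 k = (mxvec F 0 k)^*%R by rewrite /F vec_mxK [in RHS]mxE conjCK.
have cn2 : c = n2%:C.
  rewrite /c -(tr_mul_fro (S^t* *m F *m T)).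
  have -> : \tr (S^t* *m F *m T *m (S^t* *m F *m T)^t*) = \tr (P *m F *m Q *m F^t*).
    rewrite !adjM trmxCK !mulmxA mxtrace_mulC PE QE !mulmxA; congr (\tr _).
  rewrite tr_mul_adj; apply: eq_bigr => k _; by rewrite gF.
have vn : nrm2 (g *m A^T) = nu^-1 * n2.
  apply: (@complexI R); rewrite -dotrr /dotr.
  have -> : g *m A^T *m (g *m A^T)^t* = g *m (A^T *m map_mx Num.conj A) *m g^t*.
    by rewrite adjM trmxK !mulmxA.
  rewrite hA inv.
  have -> : g *m (sandwich_mx (nu%:C)^-1 P Q)^T *m g^t* =
     (mxvec F *m sandwich_mx (nu%:C)^-1 P Q *m g^T)^T.
    rewrite !trmx_mul trmxK mulmxA; congr (_ *m _).
    by rewrite /F vec_mxK map_trmx.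
  rewrite sandwich_mxE /sandwich linearZ -scalemxAl mxE scalemxE mxE.
  have eV : (nu^-1)%:C = (nu%:C)^-1 :> C by exact: fmorphV.
  transitivity ((nu%:C)^-1 * c); last by rewrite cn2 (@realCM _ nu^-1 n2) eV.
  congr (_ * _); apply: eq_bigr => k _; congr (_ * _).
  by rewrite [LHS]mxE.
have S0 : 0 <= sup_norm f by apply: le_trans (sup_norm_ge hf bw); exact: cmod_ge0.
(* The direction is [P F] divided by the square root of [n2]; when [n2 = 0] the zero direction has
   the required derivative. *)
have [U [hU hUn]] : exists U : M, (forall x : 'rV[C]_r,
     nrm2 (x *m U) - nrm2 (x *m U *m w^t*) <= nrm2 x - nrm2 (x *m w)) /\
     cmod (\sum_k mxvec (U *m (1%:M - w^t* *m w)) 0 k * g 0 k) ^+ 2 = n2.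
  have [n0|n0] := eqVneq n2 0.
    exists 0; split=> [x|].
      by rewrite mulmx0 mul0mx !nrm20 subr0 subr_ge0; exact: ball_le.
    by rewrite mul0mx big1 ?cmod0 ?expr0n // => k _; rewrite linear0 mxE mul0r.
  have np : 0 < n2 by rewrite lt_neqAle eq_sym n0.
  pose c2 : C := ((Num.sqrt n2)^-1)%:C.
  have c2n : cmod c2 ^+ 2 = n2^-1.
    by rewrite /c2 cmod_real ger0_norm ?invr_ge0 ?sqrtr_ge0 // exprVn sqr_sqrtr.
  have uQ : (c2 *: (P *m F)) *m (1%:M - w^t* *m w) = c2 *: (P *m F *m Q).
    by rewrite -scalemxAl.
  exists (c2 *: (P *m F)); split=> [x|]; last first.
    rewrite uQ linearZ; have -> : \sum_k (c2 *: mxvec (P *m F *m Q)) 0 k * g 0 k = c2 * c.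
      by rewrite /c mulr_sumr; apply: eq_bigr => k _; rewrite scalemxE mulrA.
    by rewrite cmodM exprMn c2n cn2 cmod_real ger0_norm // expr2 mulKf.
  have e1 (y : 'rV[C]_s) : nrm2 y - nrm2 (y *m w^t*) = nrm2 (y *m T).
    apply: (@complexI R); rewrite -qf_row trmxCK -/Q QE -dotrr /dotr.
    by rewrite adjM !mulmxA.
  have e2 (y : 'rV[C]_r) : nrm2 y - nrm2 (y *m w) = nrm2 (y *m S).
    apply: (@complexI R); rewrite -qf_row -/(pdef w) -/P PE -dotrr /dotr.
    by rewrite adjM !mulmxA.
  rewrite e1 e2 -scalemxAr -scalemxAl nrm2Z c2n.
  (* Here [|x U T|^2 = |(x S) (S' F T)|^2 / n2], at most [|x S|^2] by the Frobenius bound. *)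
  have -> : x *m (P *m F) *m T = (x *m S) *m (S^t* *m F *m T) by rewrite PE !mulmxA.
  rewrite mulrC ler_pdivrMr //; exact: nrm2_mul.
have h := schwarz_pick_matrix hf bw hU.
apply: (block_contraction S0 h).
(* The gradient row has squared length [n2 / nu] and the derivative along the disc has squared
   modulus [n2]; [nu >= 1] enters here. *)
rewrite hUn vn -[X in _ <= X]mul1r; apply: ler_wpM2r => //.
by rewrite invf_le1.
Qed.

End CurvatureInverse.

(** * The kernel near the origin *)

Section BinomialSeries.
Context {R : realType}.
Implicit Types (nu x : R).

(** The coefficient of [x ^ m] in [(1 - x) ^ (- nu)], that is
    [nu (nu + 1) ... (nu + m - 1) / m!]. *)
Definition rising nu m : R := \prod_(j < m) ((nu + j%:R) / j.+1%:R).

Lemma rising_shift nu m : rising nu m.+1 * m.+1%:R = nu * rising (nu + 1) m.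
Proof.
elim: m => [|m IH]; rewrite /rising.
  by rewrite big_ord_recr !big_ord0 /= addr0 mul1r divr1 !mulr1.
rewrite big_ord_recr -/(rising nu m.+1) /= [in RHS]big_ord_recr -/(rising (nu + 1) m) /=.
have -> : nu + 1 + m%:R = nu + m.+1%:R by rewrite -addrA nat1r.
have t0 : (m.+1%:R : R) != 0 by rewrite pnatr_eq0.
have u0 : (m.+2%:R : R) != 0 by rewrite pnatr_eq0.
rewrite [in RHS]mulrA -IH; move: (rising nu m.+1) (m.+1%:R : R) (m.+2%:R : R) t0 u0 => A t u t0 u0.
by field; apply/andP.
Qed.

Lemma is_derive_powsum (a : nat -> R) n x :
  is_derive x 1 (fun y => \sum_(m < n.+1) a m * y ^+ m)
    (\sum_(m < n) a m.+1 * m.+1%:R * x ^+ m).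
Proof.
elim: n => [|n IH].
  rewrite big_ord0; have -> : (fun y => \sum_(m < 1) a m * y ^+ m) = fun=> a 0%N.
    by apply/funext => y; rewrite big_ord_recl big_ord0 expr0 mulr1 addr0.
  exact: is_derive_cst.
have -> : (fun y => \sum_(m < n.+2) a m * y ^+ m) =
    (fun y => \sum_(m < n.+1) a m * y ^+ m + a n.+1 * y ^+ n.+1).
  by apply/funext => y; rewrite big_ord_recr.
rewrite big_ord_recr /=.
have hX : is_derive x 1 (fun y : R => y ^+ n.+1) (n.+1%:R * x ^+ n).
  have := @is_deriveX R R id n.+1 x 1 1 (is_derive_id x 1).
  have -> : (n.+1%:R * id x ^+ n) *: (1 : R) = n.+1%:R * x ^+ n by exact: mulr1.
  by rewrite exprfctE.
have := is_deriveD IH (is_deriveZ (a n.+1) hX).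
by rewrite -mulrA.
Qed.

(** The derivative of the remainder of order [n + 1] for [nu] is [nu] times the remainder of order
    [n] for [nu + 1]. The mean value theorem then gains one power of [x]; the induction runs over
    all [nu] at once. *)
Lemma binomial_series_remainder n nu : 0 <= nu -> exists2 C : R, 0 <= C &
  forall x, 0 <= x <= 2^-1 ->
  `|(1 - x) `^ (- nu) - \sum_(m < n) rising nu m * x ^+ m| <= C * x ^+ n.
Proof.
elim: n nu => [|n IH] nu nu0.
  exists ((2^-1) `^ nu)^-1; first by rewrite invr_ge0 powR_ge0.
  move=> x /andP[x0 x1]; rewrite big_ord0 subr0 expr0 mulr1 powRN.
  have h : 2^-1 <= 1 - x by lra.
  have hp : 0 < (2^-1 : R) `^ nu by apply: powR_gt0; rewrite invr_gt0.
  rewrite ger0_norm ?invr_ge0 ?powR_ge0 // lef_pV2 ?posrE //; last first.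
    by apply: powR_gt0; lra.
  by apply: ge0_ler_powR; rewrite ?nnegrE //; lra.
have [|C C0 hC] := IH (nu + 1); first lra.
exists (nu * C); first by rewrite mulr_ge0.
move=> x /andP[x0 x1].
pose D (y : R) : R := (1 - y) `^ (- nu) - \sum_(m < n.+1) rising nu m * y ^+ m.
pose dD (y : R) : R := nu * ((1 - y) `^ (- (nu + 1)) - \sum_(m < n) rising (nu + 1) m * y ^+ m).
have hD (y : R) : y < 1 -> is_derive y 1 D (dD y).
  move=> y1; have y1' : 0 < 1 - y by rewrite subr_gt0.
  have h1 : is_derive y 1 (fun y : R => 1 - y) (-1).
    have := is_deriveB (is_derive_cst (1 : R) y 1) (is_derive_id y (1 : R)).
    by rewrite sub0r.
  have h2 := @is_derive1_comp R (fun u => u `^ (- nu)) (fun y => 1 - y) y _ _ (is_derive1_powR (- nu) y1') h1.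
  have h3 := is_deriveB h2 (is_derive_powsum (rising nu) n y).
  apply: is_derive_eq h3 _.
  have -> : - nu - 1 = - (nu + 1) by rewrite opprD.
  rewrite /dD mulrBr mulr_sumr; congr (_ - _).
    by rewrite mulrN1 mulNr opprK.
  by apply: eq_bigr => m _; rewrite mulrA rising_shift.
have cD : {within `[0, x], continuous D}.
  apply: derivable_within_continuous => y; rewrite in_itv /= => /andP[_ yx].
  have [] // := hD y _; lra.
have [|c] := MVT_segment x0 _ cD (df := dD).
  by move=> y; rewrite in_itv /= => /andP[_ yx]; apply: hD; lra.
rewrite in_itv /= => /andP[c0 cx].
have D0 : D 0 = 0.
  rewrite /D subr0 powR1 big_ord_recl expr0 /rising big_ord0 mulr1 big1 ?addr0 ?subrr //.
  by move=> m _; rewrite expr0n mulr0.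
rewrite D0 !subr0 -/(D x) => ->; rewrite normrM (ger0_norm x0) /dD normrM (ger0_norm nu0).
have cc : 0 <= c <= 2^-1 by lra.
rewrite exprSr mulrA; apply: ler_wpM2r => //; rewrite -mulrA.
apply: ler_wpM2l => //; apply: le_trans (hC _ cc) _.
by apply: ler_wpM2l => //; rewrite lerXn2r ?nnegrE.
Qed.

End BinomialSeries.

(** * Interpolation from real nodes *)

Section Interpolation.
Context {R : realType}.
Local Notation C := R[i].

Lemma vandermonde_unit n (a : 'rV[C]_n) : injective (a 0) -> Vandermonde n a \in unitmx.
Proof.
move=> ia; rewrite unitmxE unitfE det_Vandermonde prodf_seq_neq0; apply/allP => i _ /=.
rewrite prodf_seq_neq0; apply/allP => j _ /=; apply/implyP => ij.
rewrite subr_eq0; apply/eqP => /ia e; by rewrite e ltnn in ij.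
Qed.

(** Evaluation at [z] is a fixed combination of the evaluations at the nodes [j / N], found by
    inverting a Vandermonde matrix. The constant [L] depends on [N] and [z] only, not on the
    polynomial. *)
Lemma interpolation_bound N (z : C) : exists2 L : R, 0 <= L & forall (c : nat -> C) (E : R),
  (forall t : R, 0 <= t <= 1 -> cmod (\sum_(n < N) c n * (t%:C) ^+ n) <= E) ->
  cmod (\sum_(n < N) c n * z ^+ n) <= L * E.
Proof.
pose a : 'rV[C]_N := \row_j ((j%:R / N%:R : R)%:C).
have ia : injective (a 0).
  move=> i j; rewrite !mxE => /(@complexI R) e; apply: val_inj; apply/eqP.
  have N0 : (N%:R : R)^-1 != 0.
    by rewrite invr_eq0 pnatr_eq0 -lt0n; case: N i {a j e} => [[]|].
  by move/(mulIf N0): e => /eqP; rewrite eqr_nat.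
pose b := invmx (Vandermonde N a) *m (\col_(i < N) z ^+ i).
exists (\sum_j cmod (b j 0)) => [|c E hE]; first by rewrite sumr_ge0 // => j _; exact: cmod_ge0.
pose v : 'rV[C]_N := (\row_(i < N) c i) *m Vandermonde N a.
have e : \sum_(n < N) c n * z ^+ n = \sum_j v 0 j * b j 0.
  have -> : \sum_j v 0 j * b j 0 = (v *m b) 0 0 by rewrite mxE.
  rewrite /v /b -mulmxA mulKVmx ?vandermonde_unit // mxE.
  by apply: eq_bigr => i _; rewrite !mxE.
rewrite e mulr_suml; apply: le_trans (cmod_sum _ _ _) _.
apply: ler_sum => j _; rewrite cmodM mulrC; apply: ler_wpM2l; first exact: cmod_ge0.
have -> : v 0 j = \sum_(n < N) c n * ((j%:R / N%:R : R)%:C) ^+ n.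
  by rewrite mxE; apply: eq_bigr => i _; rewrite !mxE.
apply: hE; have jN := ltn_ord j; have N0 : (0 < N)%N by apply: leq_ltn_trans jN.
by rewrite divr_ge0 ?ler0n //= ler_pdivrMr ?ltr0n // mul1r ler_nat ltnW.
Qed.

End Interpolation.

Section ConjMatrix.
Context {R : realType}.

Lemma real_powsum (a : nat -> R) (x : R) n :
  \sum_(m < n) (a m)%:C * x%:C ^+ m = (\sum_(m < n) a m * x ^+ m)%:C :> R[i].
Proof. by rewrite rmorph_sum; apply: eq_bigr => m _; rewrite rmorphM rmorphXn. Qed.

Lemma conj_mxK m n (A : 'M[R[i]]_(m, n)) : map_mx Num.conj (map_mx Num.conj A) = A.
Proof. by apply/matrixP => i j; rewrite !mxE conjCK. Qed.

Lemma conj_line m n (A B : 'M[R[i]]_(m, n)) t :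
  map_mx Num.conj (map_mx Num.conj A + t *: map_mx Num.conj B) = A + t^*%R *: B.
Proof. by rewrite map_mxD map_mxZ !conj_mxK. Qed.

End ConjMatrix.

(** * Matrices supported on the first row *)

Section FirstRow.
Context {R : realType} {r s : nat}.
Local Notation C := R[i].
Local Notation M := 'M[C]_(r.+1, s).
Implicit Types (z w u v : 'rV[C]_s).

Definition frow z : M := delta_mx 0 (0 : 'I_1) *m z.

Lemma mul_frow (x : 'rV[C]_r.+1) z : x *m frow z = x 0 0 *: z.
Proof.
rewrite /frow mulmxA; have -> : x *m delta_mx 0 (0 : 'I_1) = (x 0 0)%:M.
  by rewrite -colE; apply/matrixP => i j; rewrite !ord1 !mxE eqxx mulr1n.
by rewrite mul_scalar_mx.
Qed.

Lemma frowE z i j : frow z i j = (i == 0)%:R * z 0 j.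
Proof. by rewrite mxE big_ord1 mxE andbT. Qed.

Lemma frow0 : frow 0 = 0. Proof. exact: mulmx0. Qed.

Lemma conj_frow z : map_mx Num.conj (frow z) = frow (map_mx Num.conj z).
Proof. by apply/matrixP => i j; rewrite mxE !frowE mxE rmorphM rmorph_nat. Qed.

Lemma frow_ball z : nrm2 z < 1 -> matrix_ball (frow z).
Proof.
move=> z1; apply/ballP => x x0; rewrite mul_frow nrm2Z.
have h : cmod (x 0 0) ^+ 2 <= nrm2 x.
  by rewrite /nrm2 big_ord_recl lerDl sumr_ge0 // => i _; exact: sqr_ge0.
have [e|n0] := eqVneq (x 0 0) 0; first by rewrite e cmod0 expr0n mul0r nrm2_gt0.
by apply: lt_le_trans h; rewrite -[X in _ < X]mulr1 ltr_pM2l // exprn_gt0 // cmod_gt0.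
Qed.

Lemma ball_row0 (Z : M) : matrix_ball Z -> nrm2 (row 0 Z) < 1.
Proof.
move=> /ballP /(_ (delta_mx 0 0)); rewrite -rowE.
have d0 : (delta_mx 0 0 : 'rV[C]_r.+1) != 0.
  by apply/eqP => /rowP /(_ 0) /eqP; rewrite !mxE !eqxx oner_eq0.
move=> /(_ d0); congr (_ < _); rewrite /nrm2 big_ord_recl big1 ?addr0 => [|i _].
  by rewrite mxE !eqxx cmod1 expr1n.
by rewrite mxE /= cmod0 expr0n.
Qed.

Lemma det_frow z w : \det (1%:M - frow z *m (frow w)^t*) = 1 - dotr z w.
Proof.
have -> : 1%:M - frow z *m (frow w)^t* =
    diag_mx (\row_(i < r.+1) (if i == 0 then 1 - dotr z w else 1)).
  apply/matrixP => i j.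
  have e : (frow z *m (frow w)^t*) i j = (i == 0)%:R * (j == 0)%:R * dotr z w.
    rewrite mxE dotrE mulr_sumr; apply: eq_bigr => k _.
    rewrite [((frow w)^t*) k j]mxE [(frow w)^T k j]mxE !frowE rmorphM rmorph_nat.
    by rewrite mulrACA.
  rewrite addmxE [X in _ + X]mxE e !mxE; case: (eqVneq i j) => [<-|ij] /=.
    by case: (i == 0); rewrite ?mul1r ?mul0r ?subr0.
  have ij0 : (i == 0) && (j == 0) = false.
    by apply/negP => /andP[/eqP i0 /eqP j0]; rewrite i0 j0 eqxx in ij.
  by rewrite -natrM mulnb ij0 mul0r subr0.
rewrite det_diag big_ord_recl big1 ?mulr1 => [|i _]; by rewrite mxE.
Qed.

Lemma bergman_diag_frow lambda z : nrm2 z < 1 ->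
  bergman_diag_pow lambda (frow z) = (1 - nrm2 z) `^ (- (lambda * (r.+1 + s)%:R)).
Proof.
move=> z1; have p0 : 0 < 1 - nrm2 z by rewrite subr_gt0.
rewrite /bergman_diag_pow /bergman det_frow dotrr.
have -> : (1 - (nrm2 z)%:C : C) = (1 - nrm2 z)%:C by rewrite rmorphB.
have -> : (((1 - nrm2 z)%:C : C) ^- (r.+1 + s)) = ((1 - nrm2 z) ^- (r.+1 + s))%:C.
  by rewrite -rmorphXn -fmorphV.
rewrite /= -[_ ^- _]/((_ ^+ _)^-1) -powR_mulrn ?(ltW p0) // -powRN -powRrM.
by rewrite mulrC mulrN.
Qed.

Lemma frow_line_diff (a b : 'rV[C]_s) (x : C) : differentiable (fun t : C => frow (a + t *: b)) x.
Proof.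
apply: diff_mxP => i j.
have -> : (fun t => frow (a + t *: b) i j) = (fun t => (i == 0)%:R * (a + t *: b) 0 j).
  by apply/funext => u; rewrite frowE.
by apply: fun_diffM; [exact: fun_diff_cst|exact: disc_entry_diff].
Qed.

Lemma nrm2_le z (rho : R) : (forall j, cmod (z 0 j) <= rho) -> nrm2 z <= s%:R * rho ^+ 2.
Proof.
move=> h; apply: (@le_trans _ _ (\sum_(j < s) rho ^+ 2)).
  by apply: ler_sum => j _; rewrite lerXn2r ?nnegrE ?cmod_ge0 //; apply: le_trans (h j); exact: cmod_ge0.
by rewrite sumr_const card_ord mulr_natl.
Qed.

End FirstRow.

Section KernelEstimate.
Context {R : realType} {r s : nat}.
Local Notation C := R[i].
Local Notation M := 'M[C]_(r.+1, s).
Variables (lambda : R) (K : M -> M -> C).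
Hypothesis K_polar : is_polarization (bergman_diag_pow lambda) K.
Let nu := lambda * (r.+1 + s)%:R.

(** Joint continuity at the origin of [K] with its second argument conjugated, which is the function
    that the polarization makes differentiable. *)
Lemma kernel_bounded_near0 : exists2 d : R, 0 < d & exists2 B : R, 0 <= B &
  forall Z Y : M, (forall i j, cmod (Z i j) < d) -> (forall i j, cmod (Y i j) < d) ->
  cmod (K Z (map_mx Num.conj Y)) <= B.
Proof.
have b0 : matrix_ball (0 : M) := ball0.
have := (K_polar.1 _ _ b0 b0); rewrite map_mx0 => /differentiable_continuous.
pose F (P : M * M) := K P.1 (map_mx Num.conj P.2).
move=> /(@ccvgP _ _ (nbhs ((0 : M), (0 : M))) _ F) /(_ 1 ltr01) /nbhs_ballP[e /= e0 h].
have eR : e = (Re e)%:C.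
  by move: e0; case: (e) => a b; rewrite ltcE /= => /andP[/eqP -> _].
exists (Re e); first by rewrite -ltcR -eR.
exists (1 + cmod (F (0, 0))); first by rewrite addr_ge0 ?cmod_ge0.
move=> Z Y hZ hY; have : cmod (F (Z, Y) - F (0, 0)) < 1.
  apply: h; split; split=> //= i j; rewrite mxE -ball_normE /= sub0r normrN normE eR ltcR.
    exact: hZ.
  exact: hY.
move=> /ltW h1; rewrite -[K _ _]/(F (Z, Y)) -(subrK (F (0, 0)) (F (Z, Y))).
by apply: le_trans (cmodD _ _) _; rewrite lerD2r.
Qed.

(** The function [G] of [t] is the kernel minus the truncated series along a line of pairs. It is
    small at real [t] by the binomial remainder, and it is close to a polynomial of degree below
    [N], so interpolation bounds it at [-i]. The constants precede [rho], [z] and [w], so the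
    estimate is uniform. *)
Lemma kernel_estimate n : 0 <= nu -> exists2 d : R, 0 < d & exists2 A : R, 0 <= A &
  forall (rho : R) (z w : 'rV[C]_s), 0 < rho <= d ->
  (forall j, cmod (z 0 j) <= rho) -> (forall j, cmod (w 0 j) <= rho) ->
  cmod (K (frow z) (frow w) - \sum_(m < n.+1) (rising nu m)%:C * dotr z w ^+ m)
    <= A * rho ^+ (2 * n.+1).
Proof.
move=> nu0; have [d1 d10 [B B0 hB]] := kernel_bounded_near0.
have [C1 C10 hC1] := binomial_series_remainder n.+1 nu0.
set N := (2 * n.+1)%N.
have [L L0 hL] := interpolation_bound N (- 'i : C).
pose s1 : R := s%:R + 1.
have s10 : 0 < s1 by rewrite ltr_wpDl // ler0n.
(* Entries of size [d] stay where the kernel is bounded, and [s d^2 <= 1/2] keeps the points in the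
   ball and the argument of the binomial series within its range. *)
pose d := Num.min d1 (2 * s1)^-1.
have d0 : 0 < d by rewrite lt_min d10 invr_gt0 mulr_gt0.
have dd1 : d <= d1 by rewrite ge_min lexx.
have ds : s%:R * d ^+ 2 <= 2^-1.
  have ds1 : d <= (2 * s1)^-1 by rewrite ge_min lexx orbT.
  have h1 : s1 * d <= 2^-1.
    apply: le_trans (_ : s1 * (2 * s1)^-1 <= _); first by rewrite ler_wpM2l // ltW.
    by rewrite invfM mulrCA mulfV ?gt_eqF // mulr1.
  have d1' : d <= 1.
    have : d <= s1 * d by rewrite ler_peMl ?(ltW d0) // /s1 lerDr ler0n.
    by move: h1; move: (s1 * d) => x; lra.
  apply: le_trans h1; rewrite expr2 mulrA; apply: le_trans (_ : s%:R * d <= _).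
    by rewrite ler_piMr // mulr_ge0 ?ler0n // ltW.
  by apply: ler_wpM2r; [exact: ltW|rewrite lerDl].
pose B2 := \sum_(m < n.+1) `|rising nu m|.
have B20 : 0 <= B2 by rewrite sumr_ge0.
pose A1 : R := 4 * (B + B2) * (4 / d) ^+ N.
have A10 : 0 <= A1.
  apply: mulr_ge0; first by rewrite mulr_ge0 // addr_ge0.
  by rewrite exprn_ge0 // divr_ge0 // ltW.
pose A2 : R := C1 * (4 * s%:R) ^+ n.+1.
have A20 : 0 <= A2 by rewrite mulr_ge0 // exprn_ge0 // mulr_ge0 // ler0n.
(* This makes the radius [T = d / (4 rho)] below at least 4, well beyond [cmod t = 1]. *)
exists (d / 16); first by rewrite divr_gt0.
exists (L * (A1 + A2) + A1); first by rewrite addr_ge0 // mulr_ge0 // addr_ge0.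
move=> rho z w /andP[rho0 rhod] hz hw.
pose u : 'rV[C]_s := 2^-1 *: (z + w); pose v : 'rV[C]_s := ('i / 2) *: (z - w).
have c2 : cmod (2^-1 : C) = 2^-1 by rewrite cmodV -[2]/(2%:R) -(rmorph_nat (real_complex R)) cmod_real normr_nat.
have hu j : cmod (u 0 j) <= rho.
  rewrite !mxE cmodM c2 mulrC ler_pdivrMr //.
  by apply: le_trans (cmodD _ _) _; have := hz j; have := hw j; lra.
have hv j : cmod (v 0 j) <= rho.
  rewrite !mxE !cmodM cmod_i mul1r c2 mulrC ler_pdivrMr //.
  by apply: le_trans (cmodB _ _) _; have := hz j; have := hw j; lra.
pose uc := map_mx Num.conj u; pose vc := map_mx Num.conj v.
have hlin (a b : 'rV[C]_s) t j : (forall j, cmod (a 0 j) <= rho) -> (forall j, cmod (b 0 j) <= rho) ->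
    cmod ((a + t *: b) 0 j) <= (1 + cmod t) * rho.
  move=> ha hb; rewrite addmxE scalemxE mulrDl mul1r.
  apply: le_trans (cmodD _ _) _; rewrite cmodM; apply: lerD; first exact: ha.
  by apply: ler_wpM2l; [exact: cmod_ge0|exact: hb].
have huc j : cmod (uc 0 j) <= rho by rewrite mxE cmod_conj.
have hvc j : cmod (vc 0 j) <= rho by rewrite mxE cmod_conj.
(* The squared norm of [u + t v], continued from real [t] to a polynomial in [t]; [h] continues the
   diagonal values of the kernel in the same way. *)
pose q t : C := \sum_j (u + t *: v) 0 j * (uc + t *: vc) 0 j.
pose h t : C := K (frow (u + t *: v)) (map_mx Num.conj (frow (uc + t *: vc))).
pose G t := h t - \sum_(m < n.+1) (rising nu m)%:C * q t ^+ m.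
have conjl t : map_mx Num.conj (uc + t *: vc) = u + t^*%R *: v.
  exact: conj_line.
have qE t : q t = dotr (u + t *: v) (u + t^*%R *: v).
  by rewrite dotrE; apply: eq_bigr => j _; rewrite -conjl [X in X^*%R]mxE conjCK.
have hE t : h t = K (frow (u + t *: v)) (frow (u + t^*%R *: v)).
  by rewrite /h conj_frow conjl.
have GE : K (frow z) (frow w) - \sum_(m < n.+1) (rising nu m)%:C * dotr z w ^+ m = G (- 'i).
  have mi2 : - ('i : C) * ('i / 2) = 2^-1 by rewrite mulrA mulNr -expr2 sqr_i opprK mul1r.
  have zE : z = u + - 'i *: v.
    apply/rowP => j; rewrite !mxE; move: (z 0 j) (w 0 j) => a b.
    by rewrite [- 'i * _]mulrA mi2; field.
  have wE : w = u + (- 'i)^*%R *: v.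
    apply/rowP => j; rewrite !mxE; move: (z 0 j) (w 0 j) => a b.
    have -> : (- 'i : C)^*%R = 'i by rewrite conjCE; apply: complex_eq; rewrite /= ?oppr0 ?opprK.
    by rewrite [_ * (_ * (_ - _))]mulrA -[X in X * (a - b)]opprK -mulNr mi2; field.
  by rewrite /G hE qE -zE -wE.
have small t : cmod t < d / (2 * rho) -> (1 + cmod t) * rho < d.
  move=> ht; rewrite mulrDl mul1r.
  have : cmod t * rho < d / 2.
    by move: ht; rewrite invfM mulrA ltr_pdivlMr.
  by move: rhod; lra.
have frow_small (a b : 'rV[C]_s) t i j : (forall j, cmod (a 0 j) <= rho) -> (forall j, cmod (b 0 j) <= rho) ->
    cmod t < d / (2 * rho) -> cmod (frow (r := r) (a + t *: b) i j) < d.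
  move=> ha hb ht; rewrite frowE; case: (i == 0); rewrite ?mul0r ?cmod0 // mul1r.
  exact: (le_lt_trans (hlin a b t j ha hb) (small _ ht)).
have q_small t : cmod t < d / (2 * rho) -> cmod (q t) <= 1.
  move=> ht; apply: le_trans (cmod_sum _ _ _) _.
  apply: (@le_trans _ _ (\sum_(j < s) d ^+ 2)).
    apply: ler_sum => j _; rewrite cmodM expr2; apply: ler_pM; rewrite ?cmod_ge0 //.
      exact: (ltW (le_lt_trans (hlin u v t j hu hv) (small _ ht))).
    exact: (ltW (le_lt_trans (hlin uc vc t j huc hvc) (small _ ht))).
  by rewrite sumr_const card_ord -mulr_natl; apply: le_trans ds _; lra.
have ball_small (a b : 'rV[C]_s) t : (forall j, cmod (a 0 j) <= rho) -> (forall j, cmod (b 0 j) <= rho) ->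
    cmod t < d / (2 * rho) -> nrm2 (a + t *: b) <= 2^-1.
  move=> ha hb ht; apply: le_trans ds; apply: nrm2_le => j.
  exact: (ltW (le_lt_trans (hlin a b t j ha hb) (small _ ht))).
have dG : disc_diff (d / (2 * rho)) G.
  move=> t ht; apply: fun_diffB.
    have bZ : matrix_ball (frow (r := r) (u + t *: v)).
      by apply: frow_ball; have := ball_small u v _ hu hv ht; lra.
    have bW : matrix_ball (frow (r := r) (u + t^*%R *: v)).
      by apply: frow_ball; rewrite -(cmod_conj t) in ht; have := ball_small u v _ hu hv ht; lra.
    have dK := K_polar.1 _ _ bZ bW.
    rewrite -conjl -conj_frow in dK.
    rewrite conj_mxK in dK.
    have dp : differentiable (fun t : C => (frow (u + t *: v) : M, frow (uc + t *: vc) : M)) t.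
      by apply: differentiable_pair; exact: frow_line_diff.
    exact: (differentiable_comp dp dK).
  apply: fun_diff_sum => m _; apply: fun_diffM; first exact: fun_diff_cst.
  apply: fun_diffX; apply: fun_diff_sum => j _.
  by apply: fun_diffM; exact: disc_entry_diff.
(* The disc in [t] has radius of order [1 / rho]. For [cmod t <= 1] the Taylor remainder of order
   [N] is therefore a constant times [rho ^+ N]. *)
pose T := d / (4 * rho).
have T4 : 4 <= T.
  by rewrite /T ler_pdivlMr ?mulr_gt0 //; move: rhod; rewrite ler_pdivlMr //; lra.
have T0 : 0 < T by lra.
have TT : T < d / (2 * rho).
  have -> : d / (2 * rho) = 2 * T by rewrite /T; field; rewrite gt_eqF.
  by lra.
have GB t : cmod t = T -> cmod (G t) <= B + B2.
  move=> tT; have ht : cmod t < d / (2 * rho) by rewrite tT.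
  apply: le_trans (cmodB _ _) _; apply: lerD.
    apply: (hB (frow (u + t *: v)) (frow (uc + t *: vc))) => i j.
      exact: (lt_le_trans (frow_small u v t i j hu hv ht) dd1).
    exact: (lt_le_trans (frow_small uc vc t i j huc hvc ht) dd1).
  apply: le_trans (cmod_sum _ _ _) _; apply: ler_sum => m _.
  rewrite cmodM cmod_real cmodX; apply: ler_piMr => //.
  by apply: exprn_ile1; [exact: cmod_ge0|exact: q_small].
have [c hc] := taylor N dG T0 TT GB.
have rem t : cmod t <= 1 -> cmod (G t - \sum_(m < N) c m * t ^+ m) <= A1 * rho ^+ N.
  move=> t1; have tT : cmod t < T by lra.
  apply: le_trans (hc _ tT) _.
  have f1 : T / (T - cmod t) <= 2 by rewrite ler_pdivrMr; lra.
  have f2 : (cmod t / T) ^+ N <= (4 / d) ^+ N * rho ^+ N.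
    rewrite -exprMn; apply: lerXn2r; rewrite ?nnegrE.
    - by rewrite divr_ge0 ?cmod_ge0 // ltW.
    - by apply: mulr_ge0; rewrite ?divr_ge0 // ltW.
    rewrite ler_pdivrMr //; have -> : 4 / d * rho * T = 1.
      by rewrite /T; field; rewrite !gt_eqF.
    by [].
  have -> : A1 * rho ^+ N = 2 * ((B + B2) * 2) * ((4 / d) ^+ N * rho ^+ N).
    by rewrite /A1; ring.
  apply: ler_pM => //.
  - by rewrite mulr_ge0 // mulr_ge0 ?addr_ge0 // divr_ge0 ?(ltW T0) // subr_ge0 ltW.
  - by rewrite exprn_ge0 // divr_ge0 ?cmod_ge0 // ltW.
  - by apply: ler_wpM2l => //; apply: ler_wpM2l => //; rewrite addr_ge0.
have onreal (t : R) : 0 <= t <= 1 -> cmod (G t%:C) <= A2 * rho ^+ N.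
  move=> /andP[t0 t1]; have ct : cmod (t%:C : C) = t by rewrite cmod_real ger0_norm.
  have ht : cmod (t%:C : C) < d / (2 * rho) by rewrite ct; lra.
  have b12 := ball_small _ _ _ hu hv ht.
  have b1 : nrm2 (u + t%:C *: v) < 1 by move: b12; move: (nrm2 _) => x; lra.
  rewrite /G hE qE conj_realC (K_polar.2 _ (frow_ball b1)) (bergman_diag_frow _ b1) dotrr.
  have -> : \sum_(m < n.+1) (rising nu m)%:C * (nrm2 (u + t%:C *: v))%:C ^+ m =
      (\sum_(m < n.+1) rising nu m * nrm2 (u + t%:C *: v) ^+ m)%:C :> C.
    exact: real_powsum.
  rewrite -rmorphB cmod_real; apply: le_trans (hC1 _ _) _; first by rewrite nrm2_ge0.
  rewrite /A2 -mulrA; apply: ler_wpM2l => //.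
  rewrite /N exprM -exprMn; apply: lerXn2r; rewrite ?nnegrE ?nrm2_ge0 //.
    by rewrite mulr_ge0 ?sqr_ge0 // mulr_ge0 // ler0n.
  have -> : 4 * s%:R * rho ^+ 2 = s%:R * (2 * rho) ^+ 2 by ring.
  apply: nrm2_le => j; apply: le_trans (hlin u v _ j hu hv) _.
  by apply: ler_wpM2r; [exact: ltW|rewrite ct; lra].
have p01 (t : R) : 0 <= t <= 1 ->
    cmod (\sum_(m < N) c m * t%:C ^+ m) <= (A1 + A2) * rho ^+ N.
  move=> t01; have ct : cmod (t%:C : C) <= 1.
    by rewrite cmod_real ger0_norm; move/andP: t01 => [].
  have -> : \sum_(m < N) c m * t%:C ^+ m = G t%:C - (G t%:C - \sum_(m < N) c m * t%:C ^+ m).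
    by rewrite subKr.
  apply: le_trans (cmodB _ _) _; rewrite mulrDl addrC.
  by apply: lerD; [exact: rem|exact: onreal].
rewrite GE -(subrK (\sum_(m < N) c m * (- 'i) ^+ m) (G (- 'i))) addrC.
apply: le_trans (cmodD _ _) _; rewrite mulrDl; apply: lerD.
  by rewrite -mulrA; exact: hL.
by apply: rem; rewrite cmodN cmod_i.
Qed.

End KernelEstimate.

(** * Random phases *)

Section RootsOfUnity.

Lemma primitive_root_exists (F : numClosedFieldType) n : (0 < n)%N ->
  exists z : F, n.-primitive_root z.
Proof.
move=> n0; have [rs e] := closed_field_poly_normal ('X^n - 1 : {poly F}).
rewrite (monicP _) ?monicXnsubC // scale1r in e.
have h : has n.-primitive_root rs.
  apply: has_prim_root => //.
  - by apply/allP => z zr; rewrite /root_of_unity e root_prod_XsubC.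
  - by rewrite -separable_prod_XsubC -e separable_Xn_sub_1 // pnatr_eq0 -lt0n.
  - by rewrite -ltnS -(size_prod_XsubC rs id) -e size_XnsubC.
by have /hasP[z _ pz] := h; exists z.
Qed.

Context {R : realType}.
Local Notation C := R[i].
Variables (N : nat) (om : C).
Hypothesis prim_om : N.-primitive_root om.

Lemma cmod_prim : cmod om = 1.
Proof.
have N0 := prim_order_gt0 prim_om.
have : cmod om ^+ N = 1 by rewrite -cmodX prim_expr_order // cmod1.
by move/eqP; rewrite pexpr_eq1 ?cmod_ge0 // => /eqP.
Qed.

Lemma conj_prim : om^*%R = om ^+ N.-1.
Proof.
have N0 := prim_order_gt0 prim_om.
have om0 : om != 0 by rewrite -cmod_gt0 cmod_prim ltr01.
apply: (mulfI om0); rewrite mulC_conj cmod_prim expr1n -exprS prednK //.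
by rewrite prim_expr_order.
Qed.

Lemma prim_geometric_sum m : \sum_(j < N) (om ^+ m) ^+ j = (if (N %| m)%N then N%:R else 0).
Proof.
case: ifPn => [/dvdnP[q ->]|nd].
  rewrite mulnC exprM (prim_expr_order prim_om) expr1n.
  by rewrite (eq_bigr (fun=> 1)) ?sumr_const ?card_ord // => j _; rewrite expr1n.
have h : om ^+ m - 1 != 0 by rewrite subr_eq0 -(prim_order_dvd prim_om).
apply: (mulfI h); rewrite mulr0 -subrX1 -exprM mulnC exprM (prim_expr_order prim_om).
by rewrite expr1n subrr.
Qed.

(** The sum factors over [i] into geometric sums. Conjugation is the power [N - 1], and exponents
    below [N] are equal as soon as they are congruent modulo [N]. *)
Lemma phase_orthogonality (I : finType) (a b : I -> nat) :
  (forall i, (a i < N)%N) -> (forall i, (b i < N)%N) ->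
  \sum_(e : {ffun I -> 'I_N})
     (\prod_i (om ^+ e i) ^+ a i) * (\prod_i (om ^+ e i) ^+ b i)^*%R =
  if [forall i, a i == b i] then N%:R ^+ #|I| else 0.
Proof.
move=> aN bN; have N0 := prim_order_gt0 prim_om.
have -> : \sum_(e : {ffun I -> 'I_N})
     (\prod_i (om ^+ e i) ^+ a i) * (\prod_i (om ^+ e i) ^+ b i)^*%R =
   \prod_i \sum_(e < N) (om ^+ (a i + N.-1 * b i)) ^+ e.
  rewrite bigA_distr_bigA; apply: eq_bigr => e _.
  rewrite rmorph_prod -big_split; apply: eq_bigr => i _ /=.
  rewrite !rmorphXn /= conj_prim /= -!exprM -exprD; congr (_ ^+ _).
  by rewrite mulnDl (mulnC (e i)) (mulnC (e i) (b i)) mulnA.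
have dvdE i : (N %| a i + N.-1 * b i)%N = (a i == b i).
  have e : ((a i + N.-1 * b i + b i) = a i + b i * N)%N.
    by rewrite -addnA -mulSnr prednK // mulnC.
  apply/idP/eqP => [/eqP d|->]; last first.
    by rewrite -[X in (X + _)%N]mul1n -mulnDl add1n prednK // dvdn_mulr.
  have : ((a i + N.-1 * b i + b i) %% N = b i %% N)%N by rewrite -modnDml d.
  by rewrite e addnC modnMDl !modn_small.
case: ifP => [/forallP ab|/negbT/forallPn[i nab]].
  rewrite -prodr_const; apply: eq_bigr => i _.
  by rewrite prim_geometric_sum dvdE ab.
by rewrite (bigD1 i) //= prim_geometric_sum dvdE (negbTE nab) mul0r.
Qed.

End RootsOfUnity.

Section RandomPhases.
Context {R : realType}.
Local Notation C := R[i].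
Variables (I : finType) (k : nat).
Local Notation word := {ffun 'I_k -> I}.

Definition letters (A : word) : {ffun I -> nat} := [ffun i => #|[pred j | A j == i]|].

Lemma prod_word (T : comPzRingType) (A : word) (x : I -> T) :
  \prod_j x (A j) = \prod_i x i ^+ letters A i.
Proof.
rewrite (partition_big A xpredT) //=; apply: eq_bigr => i _.
rewrite (eq_bigr (fun=> x i)) => [|j /eqP -> //].
by rewrite prodr_const ffunE; congr (_ ^+ _); apply: eq_card => j; rewrite [in RHS]inE.
Qed.

Lemma letters_le (A : word) i : (letters A i <= k)%N.
Proof. by rewrite ffunE -[X in (_ <= X)%N]card_ord max_card. Qed.

(** A word with the letters of [A] uses no other letter, so it is [A] composed with a map of the [k]
    positions to themselves; there are [k ^ k] such maps. *)
Lemma card_same_letters (A : word) : (#|[pred B : word | letters B == letters A]| <= k ^ k)%N.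
Proof.
pose f (t : {ffun 'I_k -> 'I_k}) : word := [ffun j => A (t j)].
apply: (@leq_trans #|codom f|); last first.
  by apply: leq_trans (leq_image_card _ _) _; rewrite card_ffun !card_ord.
apply: fintype.subset_leq_card; apply/fintype.subsetP => B; rewrite inE => /eqP e.
have h j : exists l, A l == B j.
  have : (0 < letters A (B j))%N by rewrite -e ffunE; apply/card_gt0P; exists j; rewrite inE.
  by rewrite ffunE => /card_gt0P[l]; rewrite inE; exists l.
apply/codomP; exists [ffun j => xchoose (h j)].
by apply/ffunP => j; rewrite !ffunE; apply/esym/eqP; exact: (xchooseP (h j)).
Qed.

(** A letter occurs at most [k] times in a word of length [k], so roots of unity of order [k + 1]
    distinguish all letter counts. *)
Lemma phase_correlation (om : C) (A B : word) : k.+1.-primitive_root om ->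
  cmod (\sum_(e : {ffun I -> 'I_k.+1})
     (\prod_j om ^+ e (A j)) * (\prod_j om ^+ e (B j))^*%R)
  <= (letters B == letters A)%:R * k.+1%:R ^+ #|I|.
Proof.
move=> po.
rewrite (eq_bigr (fun e : {ffun I -> 'I_k.+1} => (\prod_i (om ^+ e i) ^+ letters A i) *
    (\prod_i (om ^+ e i) ^+ letters B i)^*%R)) => [|e _]; last first.
  by rewrite (prod_word A (fun i => om ^+ e i)) (prod_word B (fun i => om ^+ e i)).
rewrite (phase_orthogonality po) => [|i|i]; try by rewrite ltnS letters_le.
case: ifP => [/forallP h|_]; last by rewrite cmod0 mulr_ge0 ?exprn_ge0 ?ler0n.
have -> : letters B == letters A by apply/eqP/ffunP => i; rewrite (eqP (h i)).
by rewrite mul1r cmodX -(rmorph_nat (real_complex R)) cmod_real normr_nat.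
Qed.

(* On average over the phases two words are correlated only if they have the
   same letters, which leaves at most [k ^ k] partners for every word. *)
Lemma random_phases (B : finType) (W : I -> R) (key : word -> B) : (forall i, 0 <= W i) ->
  exists eps : I -> C, (forall i, cmod (eps i) = 1) /\
  forall (x : I -> C) (y : B -> C), (forall A : word, \prod_j x (A j) = y (key A)) ->
  \sum_i W i * cmod (x i) ^+ 2 <= 1 ->
  cmod (\sum_i eps i * (Num.sqrt (W i))%:C * x i) ^+ (2 * k) <= (k ^ k * #|B|)%:R.
Proof.
move=> W0; have [om po] := primitive_root_exists (R[i]) (ltn0Sn k).
pose phase := {ffun I -> 'I_k.+1}.
pose a (A : word) : R := \prod_j Num.sqrt (W (A j)).
pose ep (e : phase) (A : word) : C := \prod_j om ^+ e (A j).
(* [W' b] is the total weight of the words with key [b] in the [k]-th power of the weighted sum;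
   [c e b] is the coefficient of [y b] in the [k]-th power of the random sum. *)
pose W' (b : B) : R := \sum_(A | key A == b) a A ^+ 2.
pose c (e : phase) (b : B) : C := \sum_(A | key A == b) ep e A * (a A)%:C.
have a0 A : 0 <= a A by apply: prodr_ge0 => j _; exact: sqrtr_ge0.
have a2 A : a A ^+ 2 = \prod_j W (A j).
  by rewrite /a -prodrXl; apply: eq_bigr => j _; rewrite sqr_sqrtr.
have W'0 b : 0 <= W' b by apply: sumr_ge0 => A _; exact: sqr_ge0.
have aE (A A' : word) : letters A' == letters A -> a A' = a A.
  by move=> /eqP e; rewrite /a !(prod_word _ (fun i => Num.sqrt (W i))) e.
have avg b : \sum_(e : phase) cmod (c e b) ^+ 2 <= (k.+1%:R ^+ #|I|) * ((k ^ k)%:R * W' b).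
  have h0 : 0 <= \sum_(e : phase) cmod (c e b) ^+ 2 by apply: sumr_ge0 => e _; exact: sqr_ge0.
  rewrite -(ger0_norm h0) -cmod_real.
  have -> : (\sum_(e : phase) cmod (c e b) ^+ 2)%:C =
      \sum_(A | key A == b) \sum_(A' | key A' == b)
           (a A * a A')%:C * \sum_(e : phase) ep e A * (ep e A')^*%R.
    rewrite rmorph_sum (eq_bigr (fun e => \sum_(A | key A == b) \sum_(A' | key A' == b)
       (a A * a A')%:C * (ep e A * (ep e A')^*%R))) => [|e _]; last first.
      rewrite -[LHS]/((cmod (c e b) ^+ 2)%:C) -mulC_conj rmorph_sum big_distrlr /=.
      apply: eq_bigr => A _; apply: eq_bigr => A' _.
      by rewrite rmorphM /= conj_realC realCM; ring.
    rewrite exchange_big; apply: eq_bigr => A _; rewrite exchange_big; apply: eq_bigr => A' _.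
    by rewrite mulr_sumr.
  rewrite /W' mulrA mulr_sumr; apply: le_trans (cmod_sum _ _ _) _; apply: ler_sum => A _.
  apply: le_trans (cmod_sum _ _ _) _.
  apply: (@le_trans _ _ (\sum_(A' : word | letters A' == letters A) a A ^+ 2 * k.+1%:R ^+ #|I|)).
    rewrite [leRHS]big_mkcond [leLHS]big_mkcond; apply: ler_sum => A' _.
    have h1 := phase_correlation A A' po.
    have aa0 : 0 <= a A * a A' by rewrite mulr_ge0.
    have N0 : 0 <= a A ^+ 2 * k.+1%:R ^+ #|I| by rewrite mulr_ge0 ?sqr_ge0 ?exprn_ge0 ?ler0n.
    case: (key A' == b); last by case: ifP.
    rewrite cmodM cmod_real (ger0_norm aa0).
    apply: le_trans (ler_wpM2l aa0 h1) _.
    case: ifP => [ll|_]; last by rewrite mul0r mulr0.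
    by rewrite (aE _ _ ll) mul1r expr2.
  rewrite sumr_const; move: (card_same_letters A).
  have N0 : 0 <= a A ^+ 2 * k.+1%:R ^+ #|I| by rewrite mulr_ge0 ?sqr_ge0 ?exprn_ge0 ?ler0n.
  move: N0; move: (a A ^+ 2) (k.+1%:R ^+ #|I|) => X N0 XN0 hc.
  rewrite -[leLHS]mulr_natr (_ : N0 * (k ^ k)%:R * X = X * N0 * (k ^ k)%:R); last by ring.
  by apply: ler_wpM2l => //; rewrite ler_nat; exact: hc.
(* If every phase exceeded the bound, so would the average. Keys with [W' b = 0] contribute 0 to the
   sum because the inverse of 0 is 0. *)
have [e he] : exists e : phase, \sum_b cmod (c e b) ^+ 2 / W' b <= (k ^ k * #|B|)%:R.
  apply: contrapT => /forallNP h.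
  have h1 : \sum_(e : phase) (k ^ k * #|B|)%:R < \sum_(e : phase) \sum_b cmod (c e b) ^+ 2 / W' b.
    apply: ltr_sum => [|e _]; last by rewrite ltNge; apply/negP; exact: h.
    by apply/hasP; exists [ffun=> ord0]; rewrite ?mem_index_enum.
  move: h1; rewrite sumr_const card_ffun card_ord exchange_big ltNge => /negP; apply.
  apply: (@le_trans _ _ (\sum_(b : B) (k.+1%:R ^+ #|I| * (k ^ k)%:R : R))).
    apply: ler_sum => b _; rewrite -mulr_suml.
    have [->|w0] := eqVneq (W' b) 0; first by rewrite invr0 mulr0 mulr_ge0 ?exprn_ge0 ?ler0n.
    rewrite ler_pdivrMr; last by rewrite lt_neqAle eq_sym w0 W'0.
    by rewrite -mulrA.
  rewrite sumr_const -[leLHS]mulr_natr -[leRHS]mulr_natr natrM (natrX _ k.+1).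
  move: (k.+1%:R ^+ #|I|) ((k ^ k)%:R) (#|B|%:R) => u v w.
  by rewrite (_ : u * v * w = v * w * u) //; ring.
exists (fun i => om ^+ e i); split=> [i|x y xy xW].
  by rewrite cmodX (cmod_prim po) expr1n.
set f := \sum_i _.
have fk : f ^+ k = \sum_b c e b * y b.
  rewrite -[in LHS](card_ord k) -prodr_const bigA_distr_bigA (partition_big key xpredT) //=.
  apply: eq_bigr => b _; rewrite mulr_suml; apply: eq_bigr => A /eqP <-.
  by rewrite -xy /ep /a rmorph_prod -!big_split.
rewrite mulnC exprM -cmodX fk.
(* Cauchy-Schwarz with the weights [W']: one factor is the quantity just bounded, the other is the
   [k]-th power of the sum assumed to be at most 1. *)
have cs : \sum_b c e b * y b = \sum_b (c e b / (Num.sqrt (W' b))%:C) * ((Num.sqrt (W' b))%:C * y b).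
  apply: eq_bigr => b _; have [w0|w0] := eqVneq (W' b) 0.
    suff -> : c e b = 0 by rewrite !mul0r.
    rewrite /c big1 // => A kA.
    have := psumr_eq0P (fun A _ => sqr_ge0 (a A)) w0 kA.
    by move=> /eqP; rewrite expf_eq0 => /eqP ->; rewrite mulr0.
  rewrite mulrA divfK //; apply/eqP => /(@complexI R) /eqP; rewrite sqrtr_eq0 leNgt.
  by rewrite lt_neqAle eq_sym w0 W'0.
rewrite cs; apply: le_trans (sum_cauchy_schwarz _ _) _.
rewrite -[leRHS]mulr1; apply: ler_pM.
- by apply: sumr_ge0 => b _; exact: sqr_ge0.
- by apply: sumr_ge0 => b _; exact: sqr_ge0.
- apply: le_trans he; apply: ler_sum => b _.
  by rewrite cmodM cmodV cmod_real exprMn exprVn real_normK ?num_real // sqr_sqrtr.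
have -> : \sum_b cmod ((Num.sqrt (W' b))%:C * y b) ^+ 2 = (\sum_i W i * cmod (x i) ^+ 2) ^+ k.
  rewrite -[in RHS](card_ord k) -prodr_const bigA_distr_bigA (partition_big key xpredT) //=.
  apply: eq_bigr => b _; rewrite cmodM cmod_real exprMn real_normK ?num_real // sqr_sqrtr //.
  rewrite mulr_suml; apply: eq_bigr => A /eqP <-.
  by rewrite [in RHS]big_split /= -a2 -xy cmod_prod; congr (_ * _); rewrite -prodrXl.
apply: exprn_ile1 => //; apply: sumr_ge0 => i _; by rewrite mulr_ge0 ?sqr_ge0.
Qed.

End RandomPhases.

(** * Homogeneous polynomials in the first row *)

Section Multinomial.
Variables (s n : nat).
Local Notation multi := {ffun 'I_s -> 'I_n.+1}.
Implicit Types (al ga : multi).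

Definition monomial (T : comPzRingType) (z : 'I_s -> T) al := \prod_i z i ^+ al i.
Definition mdegree al : nat := (\sum_i al i)%N.
(** Exponents are capped at [n] to form a finite type. [inord] does not alter the counts as long as
    [m <= n], hence that hypothesis in the lemmas. *)
Definition content m (t : {ffun 'I_m -> 'I_s}) : multi := [ffun i => inord (letters t i)].
(** The multinomial coefficient as a number of words; for [m <= n] it is 0 unless [al] has degree
    [m]. *)
Definition multinomial m al : nat := #|[pred t : {ffun 'I_m -> 'I_s} | content t == al]|.

Lemma contentE m (t : {ffun 'I_m -> 'I_s}) i : (m <= n)%N -> content t i = letters t i :> nat.
Proof. by move=> mn; rewrite ffunE inordK // ltnS (leq_trans (letters_le t i)). Qed.

Lemma multinomial_expansion (T : comPzRingType) (z : 'I_s -> T) m : (m <= n)%N ->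
  (\sum_i z i) ^+ m = \sum_al (multinomial m al)%:R * monomial z al.
Proof.
move=> mn; rewrite -[in LHS](card_ord m) -prodr_const bigA_distr_bigA.
rewrite (partition_big (@content m) xpredT) //=; apply: eq_bigr => al _.
rewrite (eq_bigr (fun=> monomial z al)) => [|t /eqP <-].
  by rewrite sumr_const mulr_natl.
by rewrite prod_word; apply: eq_bigr => i _; rewrite contentE.
Qed.

Lemma multinomial_degree m al : (m <= n)%N -> multinomial m al != 0%N -> mdegree al = m.
Proof.
move=> mn; rewrite -lt0n => /card_gt0P[t /eqP <-]; rewrite /mdegree.
rewrite (eq_bigr (fun i => letters t i)) => [|i _]; last by rewrite contentE.
rewrite -[RHS]card_ord -sum1_card (partition_big t xpredT) //=.
by apply: eq_bigr => i _; rewrite ffunE -sum1_card.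
Qed.

(** The witness is the word that lists each [i] exactly [al i] times. *)
Lemma multinomial_gt0 al : (mdegree al <= n)%N -> (0 < multinomial (mdegree al) al)%N.
Proof.
move=> an; pose l := flatten [seq nseq (al i) i | i <- enum 'I_s].
have szl : size l == mdegree al.
  rewrite size_flatten /shape -map_comp sumnE big_map big_enum /=.
  by apply/eqP; apply: eq_bigr => i _; rewrite size_nseq.
apply/card_gt0P; exists [ffun j => tnth (Tuple szl) j]; apply/eqP/ffunP => i.
apply: val_inj; rewrite /= contentE // ffunE.
have -> : nat_of_ord (al i) = count_mem i l.
  rewrite count_flatten -map_comp sumnE big_map big_enum /= (bigD1 i) //= big1 => [|j ji].
    by rewrite count_nseq /= eqxx mul1n addn0.
  by rewrite count_nseq /= (negbTE ji) mul0n.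
rewrite -sum1_count -[l]/(tval (Tuple szl)) big_tuple -sum1_card.
by apply: eq_bigl => j; rewrite !inE ffunE.
Qed.

End Multinomial.

Lemma card_degree s n :
  ('C(s + n, n) <= #|[pred al : {ffun 'I_s.+1 -> 'I_n.+1} | mdegree al == n]|)%N.
Proof.
have -> : 'C(s + n, n) = 'C(s + n, s) by rewrite -[RHS]bin_sub ?leq_addr // addKn.
rewrite -card_ord_partitions.
pose f (t : s.+1.-tuple 'I_n.+1) : {ffun 'I_s.+1 -> 'I_n.+1} := [ffun i => tnth t i].
have fI : injective f.
  by move=> t u e; apply: eq_from_tnth => i; have /ffunP /(_ i) := e; rewrite !ffunE.
rewrite -(fintype.card_image fI); apply: fintype.subset_leq_card; apply/fintype.subsetP => g.
move=> /fintype.imageP[t]; rewrite inE => /eqP tn ->; rewrite inE /mdegree -[X in _ == X]tn big_tuple.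
by apply/eqP; apply: eq_bigr => i _; rewrite ffunE.
Qed.

(** This identifies the number of exponents of degree [n] in [s + 1] variables with a coefficient of
    the same family as those of the kernel. *)
Lemma rising_bin (R : realType) s n : rising (s.+1%:R : R) n = ('C(s + n, n))%:R.
Proof.
elim: n => [|n IH]; first by rewrite /rising big_ord0 bin0.
rewrite /rising big_ord_recr -/(rising _ n) IH /=.
have n0 : (n.+1%:R : R) != 0 by rewrite pnatr_eq0.
apply: (mulIf n0); rewrite mulrA divfK // -natrD -!natrM addnS; congr (_%:R).
by rewrite mulnC addSn mul_bin_diag /= mulnC.
Qed.

(** * Discrete Fourier weights extracting the coefficients of degree [n] *)

Section TestWeights.
Context {R : realType} {s n : nat}.
Local Notation C := R[i].
Local Notation multi := {ffun 'I_s -> 'I_n.+1}.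
Variables (om : C) (rho : R) (b : multi -> C).
Hypothesis prim_om : n.+1.-primitive_root om.
Hypothesis rho_gt0 : 0 < rho.
Hypothesis b_homog : forall al, b al != 0 -> mdegree al = n.
Implicit Types (al ga : multi).

Definition node (g : multi) : 'rV[C]_s := \row_i (rho%:C * om ^+ g i).
(** Discrete Fourier inversion on the grid of nodes: the combination of point evaluations with these
    weights sends the monomial [al] to [b al]. It is exact for the exponents at most [n] in each
    variable. *)
Definition weight (g : multi) : C :=
  (rho ^- n)%:C * ((n.+1%:R ^- s)%:C * \sum_ga b ga * (monomial (fun i => om ^+ g i) ga)^*%R).

Lemma cmod_node g i : cmod (node g 0 i) = rho.
Proof.
by rewrite mxE cmodM cmod_real cmodX (cmod_prim prim_om) expr1n mulr1 gtr0_norm.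
Qed.

Lemma monomial_node g al :
  monomial (node g 0) al = (rho ^+ mdegree al)%:C * monomial (fun i => om ^+ g i) al.
Proof.
rewrite /monomial /mdegree rmorphXn -prodrXr -big_split; apply: eq_bigr => i _.
by rewrite mxE exprMn.
Qed.

Lemma weight_monomial al : \sum_g weight g * monomial (node g 0) al = b al.
Proof.
have -> : \sum_g weight g * monomial (node g 0) al =
    (rho ^- n)%:C * (rho ^+ mdegree al)%:C * (n.+1%:R ^- s)%:C *
    \sum_ga b ga * \sum_(g : multi) monomial (fun i => om ^+ g i) al *
      (monomial (fun i => om ^+ g i) ga)^*%R.
  under [in RHS]eq_bigr => ga _ do rewrite mulr_sumr.
  rewrite exchange_big mulr_sumr; apply: eq_bigr => g _.
  rewrite /weight monomial_node.
  have -> : \sum_ga b ga * (monomial (fun i => om ^+ g i) al *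
      (monomial (fun i => om ^+ g i) ga)^*%R) = monomial (fun i => om ^+ g i) al *
      \sum_ga b ga * (monomial (fun i => om ^+ g i) ga)^*%R.
    by rewrite mulr_sumr; apply: eq_bigr => ga _; rewrite mulrCA.
  have alg (a c d e f : C) : a * (c * d) * (e * f) = a * e * c * (f * d) by ring.
  exact: alg.
have orth ga : \sum_(g : multi) monomial (fun i => om ^+ g i) al *
      (monomial (fun i => om ^+ g i) ga)^*%R = (ga == al)%:R * n.+1%:R ^+ s.
  have := phase_orthogonality prim_om (fun i => ltn_ord (al i)) (fun i => ltn_ord (ga i)).
  rewrite card_ord => e; apply: etrans e _; case: eqP => [->|ne].
    by rewrite mul1r ifT //; apply/forallP => i.
  rewrite mul0r ifF //; apply/negP => /forallP h; apply: ne.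
  by apply/ffunP => i; apply/val_inj/esym/eqP/h.
rewrite (eq_bigr _ (fun ga _ => congr1 (fun x => b ga * x) (orth ga))).
rewrite (bigD1 al) //= big1 ?addr0 => [|ga /negbTE ->]; last by rewrite mul0r mulr0.
rewrite eqxx mul1r; have [->|/b_homog ->] := eqVneq (b al) 0; first by rewrite mul0r mulr0.
have h1 : (rho ^- n)%:C * (rho ^+ n)%:C = 1 :> C.
  by rewrite -realCM mulVf // expf_neq0 // gt_eqF.
have h2 : (n.+1%:R ^- s)%:C * n.+1%:R ^+ s = 1 :> C.
  rewrite -(rmorph_nat (real_complex R)) -(rmorphXn (real_complex R)) /= -realCM.
  by rewrite mulVf // expf_neq0 // pnatr_eq0.
by rewrite h1 mul1r mulrCA h2 mulr1.
Qed.

(** The growth [rho ^- n] fixes the accuracy needed for the kernel: two weights and an error of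
    order [2 n + 2] leave [rho ^+ 2]. *)
Lemma cmod_weight g : cmod (weight g) <= rho ^- n * \sum_ga cmod (b ga).
Proof.
rewrite /weight !cmodM !cmod_real gtr0_norm ?invr_gt0 ?exprn_gt0 //.
apply: ler_wpM2l; first by rewrite invr_ge0 exprn_ge0 // ltW.
apply: (@le_trans _ _ (1 * \sum_ga cmod (b ga))); last by rewrite mul1r.
apply: ler_pM; rewrite ?cmod_ge0 //.
  rewrite gtr0_norm ?invr_gt0 ?exprn_gt0 ?ltr0n // invf_le1 ?exprn_gt0 ?ltr0n //.
  by rewrite exprn_ege1 // ler1n.
apply: le_trans (cmod_sum _ _ _) _; apply: ler_sum => ga _.
rewrite cmodM cmod_conj cmod_prod big1 ?mulr1 // => i _.
by rewrite !cmodX (cmod_prim prim_om) !expr1n.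
Qed.

End TestWeights.

(** * Lower bound for multipliers *)

Section WeightGram.
Context {R : realType} {s n : nat}.
Local Notation C := R[i].
Local Notation multi := {ffun 'I_s -> 'I_n.+1}.
Variables (om : C) (rho : R) (b : multi -> C).
Hypothesis prim_om : n.+1.-primitive_root om.
Hypothesis rho_gt0 : 0 < rho.
Hypothesis b_homog : forall al, b al != 0 -> mdegree al = n.

(** The power of the scalar product expands into monomials at the two nodes, and each sum over nodes
    then returns a coefficient [b al]. *)
Lemma weight_gram m : (m <= n)%N ->
  \sum_(g : multi) \sum_(h : multi) (weight om rho b g)^*%R * weight om rho b h *
     dotr (node om rho h) (node om rho g) ^+ m =
  (\sum_al (multinomial m al)%:R * cmod (b al) ^+ 2)%:C.
Proof.
move=> mn.
have e (g h : multi) : dotr (node om rho h) (node om rho g) ^+ m =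
    \sum_(al : multi) (multinomial m al)%:R *
      (monomial (node om rho h 0) al * (monomial (node om rho g 0) al)^*%R).
  rewrite dotrE (multinomial_expansion _ mn); apply: eq_bigr => al _; congr (_ * _).
  rewrite /monomial rmorph_prod -big_split; apply: eq_bigr => i _.
  by rewrite exprMn rmorphXn.
transitivity (\sum_(al : multi) (multinomial m al)%:R *
   ((\sum_h weight om rho b h * monomial (node om rho h 0) al) *
    (\sum_g weight om rho b g * monomial (node om rho g 0) al)^*%R)).
  rewrite (eq_bigr (fun g => \sum_(al : multi) (multinomial m al)%:R *
     ((\sum_h weight om rho b h * monomial (node om rho h 0) al) *
      (weight om rho b g * monomial (node om rho g 0) al)^*%R))) => [|g _].
    rewrite exchange_big; apply: eq_bigr => al _.
    by rewrite -mulr_sumr; congr (_ * _); rewrite -mulr_sumr rmorph_sum.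
  rewrite (eq_bigr (fun h => \sum_(al : multi) (multinomial m al)%:R *
     ((weight om rho b h * monomial (node om rho h 0) al) *
      (weight om rho b g * monomial (node om rho g 0) al)^*%R))) => [|h _].
    rewrite exchange_big; apply: eq_bigr => al _.
    by rewrite -mulr_sumr; congr (_ * _); rewrite -mulr_suml.
  rewrite e mulr_sumr; apply: eq_bigr => al _.
  rewrite [(weight om rho b g * _)^*%R]rmorphM.
  have alg (u v w x y : C) : u * v * (w * (x * y)) = w * (v * x * (u * y)) by ring.
  exact: alg.
rewrite rmorph_sum; apply: eq_bigr => al _.
rewrite !(weight_monomial prim_om rho_gt0 b_homog) mulC_conj -[RHS]/((_ * _)%:C).
rewrite (realCM (multinomial m al)%:R (cmod (b al) ^+ 2)).
by congr (_ * _); apply/esym; exact: (rmorph_nat (real_complex R)).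
Qed.

End WeightGram.

Section FirstRowPolynomial.
Context {R : realType} {r s n : nat}.
Local Notation C := R[i].
Local Notation multi := {ffun 'I_s -> 'I_n.+1}.

Definition row_poly (coef : multi -> C) (Z : 'M[C]_(r.+1, s)) : C :=
  \sum_al coef al * monomial (Z 0) al.

Lemma row_poly_holo coef : holo_nbhd_closure (row_poly coef).
Proof.
exists setT; split=> [||Z _]; [exact: openT|by []|].
apply: fun_diff_sum => al _; apply: fun_diffM; first exact: fun_diff_cst.
apply: fun_diff_prod => i _; apply: fun_diffX.
exact: differentiable_coord.
Qed.

End FirstRowPolynomial.

(** * Inner products of kernel functions *)

Section RKHS.
Context {R : realType} {r s : nat}.
Local Notation C := R[i].
Local Notation M := 'M[C]_(r, s).
Variables (K : M -> M -> C) (H : holo_rkhs K).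
Local Notation "<< x , y >>" := (fhs_dot H x y).

Lemma fhs_dot_ge0 (x : H) : 0 <= << x, x >>.
Proof. exact: dnorm_ge0. Qed.

Lemma fhs_dot_real (x : H) : << x, x >> = (Re << x, x >>)%:C.
Proof. by have := fhs_dot_ge0 x; case: << x, x >> => a b; rewrite lecE /= => /andP[/eqP -> _]. Qed.

Lemma fhs_dot_conj (x y : H) : << y, x >> = (<< x, y >>)^*%R.
Proof. by rewrite hermC expr0 mul1r. Qed.

Lemma fhs_dotZl a (x y : H) : << a *: x, y >> = a * << x, y >>.
Proof. exact: linearZl_LR. Qed.

Lemma fhs_dotZr a (x y : H) : << x, a *: y >> = a^*%R * << x, y >>.
Proof. exact: linearZr_LR. Qed.

Lemma fhs_dotBl (x y z : H) : << x - y, z >> = << x, z >> - << y, z >>.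
Proof. exact: linearBl. Qed.

Lemma fhs_dotBr (x y z : H) : << x, y - z >> = << x, y >> - << x, z >>.
Proof. exact: linearBr. Qed.

Lemma fhs_dot_suml (I : finType) (F : I -> H) (y : H) :
  << \sum_i F i, y >> = \sum_i << F i, y >>.
Proof. exact: linear_sumlz. Qed.

Lemma fhs_dot_sumr (I : finType) (F : I -> H) (x : H) :
  << x, \sum_i F i >> = \sum_i << x, F i >>.
Proof. exact: linear_sumr. Qed.

Lemma fhs_cauchy_schwarz (x y : H) :
  cmod << x, y >> ^+ 2 <= Re << x, x >> * Re << y, y >>.
Proof.
have [->|y0] := eqVneq y 0.
  have d0 (z : H) : << z, 0 >> = 0 by rewrite linear0r.
  by rewrite !d0 cmod0 expr0n [Re 0]/(0 : R) mulr0.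
have q0 : 0 < << y, y >> by rewrite dnorm_gt0.
have h := fhs_dot_ge0 (<< y, y >> *: x - << x, y >> *: y).
have e : << << y, y >> *: x - << x, y >> *: y, << y, y >> *: x - << x, y >> *: y >> =
    << y, y >> * (<< x, x >> * << y, y >> - << x, y >> * << x, y >>^*%R).
  rewrite fhs_dotBl !fhs_dotBr !fhs_dotZl !fhs_dotZr.
  have -> : (<< y, y >>)^*%R = << y, y >> by rewrite -fhs_dot_conj.
  by rewrite (fhs_dot_conj x y); ring.
rewrite e pmulr_rge0 // mulC_conj fhs_dot_real (fhs_dot_real y) -realCM -rmorphB in h.
by rewrite -subr_ge0 -ler0c.
Qed.

(** The product is conjugate linear in its second argument, so the coefficients are conjugated in
    advance. *)
Lemma fhs_dot_test (I : finType) (Z : I -> M) (c : I -> C) (h : H) :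
  (forall i, matrix_ball (Z i)) ->
  << h, \sum_i (c i)^*%R *: fhs_ker H (Z i) >> = \sum_i c i * fhs_eval h (Z i).
Proof.
move=> bZ; rewrite fhs_dot_sumr; apply: eq_bigr => i _.
by rewrite fhs_dotZr conjCK -fhs_reproducing.
Qed.

Lemma fhs_dot_testE (I : finType) (Z : I -> M) (c : I -> C) :
  (forall i, matrix_ball (Z i)) ->
  let x := \sum_i (c i)^*%R *: fhs_ker H (Z i) in
  << x, x >> = \sum_i \sum_j (c i)^*%R * c j * K (Z j) (Z i).
Proof.
move=> bZ x; rewrite {1}/x fhs_dot_suml; apply: eq_bigr => i _.
rewrite fhs_dotZl fhs_dot_test // mulr_sumr; apply: eq_bigr => j _.
by rewrite fhs_kerE // mulrA.
Qed.

End RKHS.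

Section MultiplierLowerBound.
Context {R : realType} {r s : nat}.
Local Notation C := R[i].
Local Notation M := 'M[C]_(r.+1, s).
Variables (lambda : R) (K : M -> M -> C) (n : nat).
Hypothesis K_polar : is_polarization (bergman_diag_pow lambda) K.
Let nu := lambda * (r.+1 + s)%:R.
Local Notation multi := {ffun 'I_s -> 'I_n.+1}.

Lemma le_of_small (a b c d : R) : 0 < d ->
  (forall rho, 0 < rho <= d -> a <= b + c * rho) -> a <= b.
Proof.
move=> d0 h; rewrite leNgt; apply/negP => ba.
pose t := Num.min d ((a - b) / (2 * (`|c| + 1))).
have c1 : 0 < `|c| + 1 by rewrite ltr_wpDl.
have t0 : 0 < t by rewrite lt_min d0 divr_gt0 ?subr_gt0 // mulr_gt0.
have td : t <= d by rewrite ge_min lexx.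
have ht : t <= (a - b) / (2 * (`|c| + 1)) by rewrite ge_min lexx orbT.
have h1 : c * t <= (a - b) / 2.
  apply: le_trans (_ : (`|c| + 1) * t <= _).
    by apply: ler_wpM2r; [exact: ltW|apply: le_trans (ler_norm c) _; rewrite lerDl].
  apply: le_trans (ler_wpM2l (ltW c1) ht) _.
  by rewrite invfM mulrCA [(`|c| + 1) * _]mulrCA mulfV ?gt_eqF // mulr1.
have := h t; rewrite t0 td => /(_ isT); lra.
Qed.

Lemma sqr_le_of_le_add (a x d : R) : a <= x + d -> 0 <= d -> 0 <= a -> 0 <= x ->
  a ^+ 2 <= x ^+ 2 + 2 * a * d.
Proof.
move=> lo d0 a0 x0; have [xa|ax] := leP x a.
  have : (a - x) * (a + x) <= d * (2 * a) by apply: ler_pM; lra.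
  nra.
nra.
Qed.

Definition homogeneous_count : nat := #|[pred al : multi | mdegree al == n]|.

(** With [A] the number of exponents, the pairing with the test vector tends to [A] and the squared
    norm of that vector to [rising nu n * A]. Since [K 0 0 = 1], Cauchy-Schwarz gives
    [A^2 <= S^2 rising nu n A] in the limit. *)
Lemma multiplier_lower_bound (H : holo_rkhs K) (eps : multi -> C) (S : R) : 0 <= nu ->
  (forall al, cmod (eps al) = 1) -> 0 <= S ->
  mult_bounded_by H
    (row_poly (fun al => eps al * (Num.sqrt (multinomial n al)%:R)%:C)) S ->
  homogeneous_count%:R <= S ^+ 2 * rising nu n.
Proof.
move=> nu0 e1 S0 mb.
set coef := fun al => _ in mb; set f := row_poly coef in mb.
pose sW (al : multi) : R := Num.sqrt (multinomial n al)%:R.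
pose A : R := homogeneous_count%:R.
(* This choice makes both [coef al * b al] and [multinomial n al * |b al|^2] equal to 1 in degree
   [n]. In other degrees the square root is 0, and so is its inverse. *)
pose b (al : multi) : C := (eps al)^*%R * ((sW al)^-1)%:C.
have sW0 (al : multi) : mdegree al = n -> sW al != 0.
  move=> dn; have := @multinomial_gt0 s n al; rewrite dn => /(_ (leqnn n)) W0.
  by rewrite gt_eqF // sqrtr_gt0 ltr0n.
have Wz (al : multi) : mdegree al != n -> multinomial n al = 0%N.
  by move=> dn; apply/eqP; apply: contraNT dn => /multinomial_degree -> //.
have sWz (al : multi) : mdegree al != n -> sW al = 0 by move=> /Wz e; rewrite /sW e sqrtr0.
have b_homog (al : multi) : b al != 0 -> mdegree al = n.
  by move=> b0; apply/eqP; apply: contra_neqT b0 => /sWz e; rewrite /b e invr0 mulr0.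
have AE : A = \sum_(al : multi | mdegree al == n) 1.
  by rewrite /A sumr_const.
have sum1 : \sum_al coef al * b al = A%:C.
  rewrite AE rmorph_sum [RHS]big_mkcond; apply: eq_bigr => al _.
  case: ifPn => [/eqP dn|dn]; last by rewrite /b sWz // invr0 !mulr0.
  rewrite /coef /b -/(sW al) mulrACA mulC_conj e1 expr1n mul1r -realCM.
  by rewrite mulfV ?sW0.
have sum2 : \sum_al (multinomial n al)%:R * cmod (b al) ^+ 2 = A.
  rewrite AE [RHS]big_mkcond; apply: eq_bigr => al _.
  case: ifPn => [/eqP dn|dn]; last by rewrite Wz // mul0r.
  rewrite /b cmodM cmod_conj e1 mul1r cmod_real real_normK ?num_real // exprVn.
  by rewrite /sW sqr_sqrtr // mulfV // -(sqr_sqrtr (ler0n R _)) expf_neq0 // -/(sW al) sW0.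
have [om po] := primitive_root_exists (R[i]) (ltn0Sn n).
have [dK dK0 [A0 A00 hK]] := kernel_estimate K_polar n nu0.
(* For [rho <= 1 / (s + 1)] the nodes have squared norm at most [s rho^2 < 1], so they lie in the
   ball. *)
pose d0 := Num.min dK (s.+1%:R^-1).
have d00 : 0 < d0 by rewrite lt_min dK0 invr_gt0 ltr0n.
pose D : R := \sum_ga cmod (b ga).
pose F : R := \sum_al cmod (coef al).
pose T : R := #|multi|%:R.
have D0 : 0 <= D by apply: sumr_ge0 => ? _; exact: cmod_ge0.
have F0 : 0 <= F by apply: sumr_ge0 => ? _; exact: cmod_ge0.
pose E1 : R := T * (D * (F * A0)).
pose E2 : R := T * (T * (D * D * A0)).
suff main : A ^+ 2 <= S ^+ 2 * (rising nu n * A).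
  have [A1|A1] := eqVneq A 0.
    by rewrite -/A A1 mulr_ge0 ?sqr_ge0 // prodr_ge0 // => j _; rewrite divr_ge0 ?addr_ge0 ?ler0n.
  have Ap : 0 < A by rewrite lt_neqAle eq_sym A1 ler0n.
  by rewrite mulrA expr2 ler_pM2r in main.
apply: (@le_of_small _ _ (2 * A * E1 + S ^+ 2 * E2) _ d00) => rho /andP[rho0 rhod].
have rhoK : 0 < rho <= dK by rewrite rho0 (le_trans rhod) // ge_min lexx.
have rhos : rho <= s.+1%:R^-1 by rewrite (le_trans rhod) // ge_min lexx orbT.
have rho_s : s%:R * rho < 1.
  move: rhos; rewrite -[_^-1]mul1r ler_pdivlMr ?ltr0n // -natr1 mulrDr mulr1 mulrC.
  by move: (s%:R * rho) rho0 => y; lra.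
have rho1 : rho <= 1 by apply: le_trans rhos _; rewrite invf_le1 ?ltr0n // ler1n.
pose Z (g : multi) : M := frow (node om rho g).
pose wt := weight om rho b.
have nodele (g : multi) j : cmod (node om rho g 0 j) <= rho by rewrite (cmod_node po rho0).
have bZ g : matrix_ball (Z g).
  apply: frow_ball; apply: le_lt_trans (nrm2_le (nodele g)) _.
  apply: le_lt_trans rho_s; apply: ler_wpM2l; first exact: ler0n.
  by rewrite expr2; apply: ler_piMl => //; exact: ltW.
have b0 : matrix_ball (0 : M) := ball0.
have wtle g : cmod (wt g) <= rho ^- n * D by exact: (cmod_weight b po rho0 g).
have [g [gE gS]] := mb (fhs_ker H 0).
pose x := \sum_g (wt g)^*%R *: fhs_ker H (Z g).
have fZ (h : multi) : f (Z h) = \sum_al coef al * monomial (node om rho h 0) al.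
  rewrite /f /row_poly; apply: eq_bigr => al _; congr (_ * _).
  by apply: eq_bigr => i _; rewrite frowE mul1r.
have gx : fhs_dot H g x = \sum_h wt h * (f (Z h) * K (Z h) 0).
  rewrite /x (fhs_dot_test _ _ bZ); apply: eq_bigr => h _.
  by rewrite (gE _ (bZ h)) (fhs_kerE H (bZ h) b0).
have main1 : \sum_h wt h * f (Z h) = A%:C.
  rewrite -sum1; under eq_bigr => h _ do rewrite fZ mulr_sumr.
  rewrite exchange_big; apply: eq_bigr => al _.
  rewrite -(weight_monomial po rho0 b_homog al) mulr_sumr; apply: eq_bigr => h _.
  by rewrite mulrCA.
have fle (h : multi) : cmod (f (Z h)) <= F.
  rewrite fZ; apply: le_trans (cmod_sum _ _ _) _; apply: ler_sum => al _.
  rewrite cmodM; apply: ler_piMr; first exact: cmod_ge0.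
  rewrite cmod_prod; apply: prodr_ile1 => i _.
  rewrite cmodX (cmod_node po rho0) exprn_ge0 ?(ltW rho0) //=.
  by apply: exprn_ile1 => //; exact: ltW.
have Kest0 (h : multi) : cmod (K (Z h) 0 - 1) <= A0 * rho ^+ (2 * n.+1).
  have n0 j : cmod ((0 : 'rV[C]_s) 0 j) <= rho by rewrite mxE cmod0 ltW.
  have := hK rho _ _ rhoK (nodele h) n0; rewrite frow0.
  have -> // : \sum_(m < n.+1) (rising nu m)%:C * dotr (node om rho h) 0 ^+ m = 1 :> C.
  have -> : dotr (node om rho h) 0 = 0 by rewrite dotrE big1 // => j _; rewrite [X in X^*%R]mxE conjC0 mulr0.
  rewrite big_ord_recl big1 ?addr0 => [|j _]; last by rewrite expr0n mulr0.
  by rewrite expr0 mulr1 /rising big_ord0.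
(* One weight meets the kernel error in the pairing and two meet it in the norm; a positive power of
   [rho] is left in both cases. *)
have rexp : rho ^- n * rho ^+ (2 * n.+1) = rho ^+ n.+2.
  have -> : (2 * n.+1 = n + n.+2)%N by rewrite mul2n -addnn addSnnS.
  by rewrite exprD mulKf // expf_neq0 // gt_eqF.
have rexp2 : (rho ^- n * rho ^- n) * rho ^+ (2 * n.+1) = rho ^+ 2.
  rewrite -mulrA rexp -addn2 exprD mulKf // expf_neq0 // gt_eqF //.
have rle m : rho ^+ m.+1 <= rho.
  by rewrite exprS; apply: ler_piMr; [exact: ltW|apply: exprn_ile1 => //; exact: ltW].
have T0 : 0 <= T by exact: ler0n.
have err1 : cmod (fhs_dot H g x - A%:C) <= E1 * rho.
  rewrite gx -main1 -sumrB; apply: le_trans (cmod_sum _ _ _) _.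
  apply: (@le_trans _ _ (\sum_(h : multi) (rho ^- n * D) * (F * (A0 * rho ^+ (2 * n.+1))))).
    apply: ler_sum => h _.
    have -> : wt h * (f (Z h) * K (Z h) 0) - wt h * f (Z h) = wt h * (f (Z h) * (K (Z h) 0 - 1)).
      by move: (wt h) (f (Z h)) (K _ _) => u v w; ring.
    rewrite (cmodM (wt h)) (cmodM (f (Z h))); apply: ler_pM.
    - exact: cmod_ge0.
    - by rewrite mulr_ge0 // cmod_ge0.
    - exact: wtle.
    - by apply: ler_pM; [exact: cmod_ge0|exact: cmod_ge0|exact: fle|exact: Kest0].
  rewrite sumr_const -[leLHS]mulr_natl -/T.
  have -> : rho ^- n * D * (F * (A0 * rho ^+ (2 * n.+1))) =
      D * (F * A0) * (rho ^- n * rho ^+ (2 * n.+1)).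
    by move: (rho ^- n) (rho ^+ _) => u v; ring.
  rewrite rexp (_ : T * (D * (F * A0) * rho ^+ n.+2) = E1 * rho ^+ n.+2); last by rewrite /E1 !mulrA.
  by apply: ler_wpM2l; [rewrite !mulr_ge0|exact: rle].
(* The terms with [m < n] vanish, because [multinomial m] lives in degree [m] and [b] in degree
   [n]. *)
have main2 : \sum_g \sum_h (wt g)^*%R * wt h *
    \sum_(m < n.+1) (rising nu m)%:C * dotr (node om rho h) (node om rho g) ^+ m =
   (rising nu n * A)%:C.
  transitivity (\sum_(m < n.+1) (rising nu m)%:C *
     (\sum_(al : multi) (multinomial m al)%:R * cmod (b al) ^+ 2)%:C).
    rewrite (eq_bigr (fun g => \sum_(m < n.+1) (rising nu m)%:C *
       \sum_h (wt g)^*%R * wt h * dotr (node om rho h) (node om rho g) ^+ m)) => [|g' _].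
      rewrite exchange_big; apply: eq_bigr => m _.
      by rewrite -mulr_sumr (weight_gram po rho0 b_homog) // -ltnS.
    rewrite (eq_bigr (fun h => \sum_(m < n.+1) (rising nu m)%:C *
       ((wt g')^*%R * wt h * dotr (node om rho h) (node om rho g') ^+ m))) => [|h _].
      by rewrite exchange_big; apply: eq_bigr => m _; rewrite mulr_sumr.
    by rewrite mulr_sumr; apply: eq_bigr => m _; rewrite mulrCA.
  rewrite big_ord_recr /= sum2 big1 ?add0r => [|m _]; first by rewrite realCM.
  rewrite (_ : \sum_al _ = 0) ?mulr0 // big1 // => al _.
  have [W0|W0] := eqVneq (multinomial m al) 0%N; first by rewrite W0 mul0r.
  have dm := multinomial_degree (ltnW (ltn_ord m)) W0.
  have -> : b al = 0; last by rewrite cmod0 expr0n mulr0.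
  by apply/eqP/negPn/negP => /b_homog; rewrite dm => e; have := ltn_ord m; rewrite e ltnn.
have err2 : Re (fhs_dot H x x) <= rising nu n * A + E2 * rho.
  have h2 : cmod (fhs_dot H x x - (rising nu n * A)%:C) <= E2 * rho.
    rewrite -main2 /x (fhs_dot_testE H _ bZ) -sumrB; apply: le_trans (cmod_sum _ _ _) _.
    apply: (@le_trans _ _ (\sum_(g' : multi) \sum_(h : multi)
       (rho ^- n * D) * (rho ^- n * D) * (A0 * rho ^+ (2 * n.+1)))).
      apply: ler_sum => g' _; rewrite -sumrB; apply: le_trans (cmod_sum _ _ _) _.
      apply: ler_sum => h _; rewrite -mulrBr (cmodM ((wt g')^*%R * wt h)) (cmodM ((wt g')^*%R)) cmod_conj.
      apply: ler_pM.
      - by rewrite mulr_ge0 // cmod_ge0.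
      - exact: cmod_ge0.
      - by apply: ler_pM; [exact: cmod_ge0|exact: cmod_ge0|exact: wtle|exact: wtle].
      - exact: hK rhoK (nodele h) (nodele g').
    rewrite sumr_const sumr_const -[X in X *+ _]mulr_natl -[leLHS]mulr_natl -/T.
    have -> : rho ^- n * D * (rho ^- n * D) * (A0 * rho ^+ (2 * n.+1)) =
        D * D * A0 * (rho ^- n * rho ^- n * rho ^+ (2 * n.+1)).
      by move: (rho ^- n) (rho ^+ _) => u v; ring.
    rewrite rexp2 (_ : T * (T * (D * D * A0 * rho ^+ 2)) = E2 * rho ^+ 2); last by rewrite /E2 !mulrA.
    by apply: ler_wpM2l; [rewrite !mulr_ge0|exact: rle].
  have := le_trans (le_trans (ler_norm _) (Re_le_cmod _)) h2.
  by rewrite Re_add Re_opp lerBlDl.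
have gg : Re (fhs_dot H g g) <= S ^+ 2.
  have h1 : `|fhs_ker H 0| ^+ 2 = 1.
    rewrite fhs_normE -(fhs_reproducing _ b0) (fhs_kerE H b0 b0) (K_polar.2 _ b0).
    have := bergman_diag_frow (r := r) lambda (z := 0 : 'rV[C]_s).
    by rewrite nrm20 frow0 => /(_ ltr01) ->; rewrite subr0 powR1.
  have h2 : `|g| ^+ 2 <= S%:C ^+ 2.
    rewrite -[X in _ <= X]mulr1 -h1 -exprMn; apply: lerXn2r => //; rewrite nnegrE //.
    by rewrite mulr_ge0 // lecR.
  by rewrite -lecR -fhs_dot_real -fhs_normE rmorphXn.
have cs := fhs_cauchy_schwarz g x.
have up : cmod (fhs_dot H g x) ^+ 2 <= S ^+ 2 * (rising nu n * A + E2 * rho).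
  apply: le_trans cs _; apply: ler_pM => //.
    by rewrite -ler0c -fhs_dot_real fhs_dot_ge0.
  by rewrite -ler0c -fhs_dot_real fhs_dot_ge0.
have lo : A <= cmod (fhs_dot H g x) + E1 * rho.
  have e : A%:C = fhs_dot H g x - (fhs_dot H g x - A%:C) by rewrite subKr.
  have A0' : 0 <= A by exact: ler0n.
  rewrite -[leLHS](ger0_norm A0') -cmod_real e; apply: le_trans (cmodB _ _) _.
  by rewrite lerD2l.
have E10 : 0 <= E1 * rho by rewrite !mulr_ge0 // ltW.
have A0' : 0 <= A by exact: ler0n.
have X0 := cmod_ge0 (fhs_dot H g x).
have key : A ^+ 2 <= cmod (fhs_dot H g x) ^+ 2 + 2 * A * (E1 * rho).
  exact: sqr_le_of_le_add.
apply: le_trans key _; apply: le_trans (lerD up (lexx _)) _.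
have alg (u v w y z t : R) : u * (v + z * t) + 2 * w * (y * t) = u * v + (2 * w * y + u * z) * t.
  by ring.
by rewrite alg.
Qed.

End MultiplierLowerBound.

(** * Growth of multiplier norms *)

Section SupNormBound.
Context {R : realType} {r s : nat}.
Local Notation C := R[i].
Local Notation M := 'M[C]_(r.+1, s).

Lemma sup_normX_le (f : M -> C) (k : nat) (B : R) : (0 < k)%N -> 0 <= B ->
  (forall Z, matrix_ball Z -> cmod (f Z) ^+ k <= B) -> 0 <= sup_norm f /\ sup_norm f ^+ k <= B.
Proof.
move=> k0 B0 h; pose c := B `^ (k%:R^-1).
have ck : c ^+ k = B.
  by rewrite -powR_mulrn ?powR_ge0 // -powRrM mulVf ?powRr1 // pnatr_eq0 -lt0n.
have c0 : 0 <= c := powR_ge0 _ _.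
have fc Z : matrix_ball Z -> cmod (f Z) <= c.
  by move=> bZ; rewrite -(ler_pXn2r k0) ?nnegrE ?cmod_ge0 // ck h.
have b0 : matrix_ball (0 : M) := ball0.
have sc : sup_norm f <= c.
  apply: ge_sup; first by exists (cmod (f 0)), 0.
  by move=> _ [Z bZ <-]; exact: fc.
have s0 : 0 <= sup_norm f.
  apply: (le_trans (cmod_ge0 (f 0))); apply: ub_le_sup; last by exists 0.
  by exists c => _ [Z bZ <-]; exact: fc.
by split=> //; rewrite -ck; apply: lerXn2r.
Qed.

(** By the multinomial theorem the squared moduli of the monomials with these weights sum to
    [|z|^(2 n)], at most 1 since the first row of a matrix in the ball has norm below 1. This is the
    normalization required by [random_phases]. *)
Lemma small_polynomial (n k : nat) : (0 < k)%N ->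
  exists eps : {ffun 'I_s -> 'I_n.+1} -> C, (forall al, cmod (eps al) = 1) /\
  let f : M -> C := row_poly (fun al => eps al * (Num.sqrt (multinomial n al)%:R)%:C) in
  0 <= sup_norm f /\ sup_norm f ^+ (2 * k) <= (k ^ k * (n * k).+1 ^ s)%:R.
Proof.
move=> k0; pose multi := {ffun 'I_s -> 'I_n.+1}.
pose B := {ffun 'I_s -> 'I_(n * k).+1}.
(* The exponent of the product of the [k] monomials of a word. Each component is at most [n k],
   which gives the count [(n k + 1) ^ s]. *)
pose key (A : {ffun 'I_k -> multi}) : B := [ffun i => inord (\sum_j A j i)].
have keyE A i : key A i = (\sum_j A j i)%N :> nat.
  rewrite ffunE inordK // ltnS mulnC; apply: (@leq_trans (\sum_(j < k) n)).
    by apply: leq_sum => j _; rewrite -ltnS.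
  by rewrite sum_nat_const card_ord.
have [eps [e1 h]] := @random_phases R multi k B (fun al => (multinomial n al)%:R) key
  (fun al => ler0n _ _).
exists eps; split=> //; apply: sup_normX_le => [|//|Z bZ]; first by rewrite muln_gt0.
have cB : #|B| = ((n * k).+1 ^ s)%N by rewrite card_ffun !card_ord.
rewrite -cB; apply: (h (fun al => monomial (Z 0) al) (fun be => \prod_i Z 0 i ^+ be i)).
  move=> A; rewrite /monomial exchange_big; apply: eq_bigr => i _.
  by rewrite keyE prodrXr.
have n1 := ball_row0 bZ.
have -> : \sum_(al : multi) (multinomial n al)%:R * cmod (monomial (Z 0) al) ^+ 2 =
   (nrm2 (row 0 Z)) ^+ n.
  have -> : nrm2 (row 0 Z) = \sum_i cmod (Z 0 i) ^+ 2 by apply: eq_bigr => i _; rewrite mxE.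
  rewrite (multinomial_expansion _ (leqnn n)); apply: eq_bigr => al _; congr (_ * _).
  rewrite cmod_prod -prodrXl; apply: eq_bigr => i _.
  by rewrite cmodX -!exprM mulnC.
by apply: exprn_ile1; [exact: nrm2_ge0|exact: ltW].
Qed.

End SupNormBound.

Section Growth.
Context {R : realType}.

Lemma bernoulli (x : R) m : 0 <= x -> 1 + m%:R * x <= (1 + x) ^+ m.
Proof.
move=> x0; elim: m => [|m IH]; first by rewrite mul0r addr0 expr0.
rewrite exprS; apply: (@le_trans _ _ ((1 + x) * (1 + m%:R * x))); last first.
  by apply: ler_wpM2l => //; rewrite addr_ge0.
have : 0 <= m%:R * x * x by rewrite !mulr_ge0 // ler0n.
by rewrite -natr1; nra.
Qed.

Lemma rising_gt0 (nu : R) n : 0 < nu -> 0 < rising nu n.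
Proof.
move=> nu0; apply: prodr_gt0 => j _; rewrite divr_gt0 ?ltr0n //.
by rewrite ltr_wpDr ?ler0n.
Qed.

(** Each factor [1 + (t - nu) / (nu + j)] of the quotient has an [m]-th power at least
    [1 + 1 / (nu + j)] by Bernoulli's inequality, and these lower bounds telescope. *)
Lemma rising_ratio_growth (nu t : R) m n : 0 < nu -> nu <= t -> 1 <= m%:R * (t - nu) ->
  (nu + n%:R) / nu <= (rising t n / rising nu n) ^+ m.
Proof.
move=> nu0 nt mt; elim: n => [|n IH].
  by rewrite addr0 /rising !big_ord0 !divff ?gt_eqF // expr1n.
have a0 : 0 < nu + n%:R by rewrite ltr_wpDr ?ler0n.
have t0 : 0 < t + n%:R by rewrite ltr_wpDr ?ler0n //; lra.
have n0 : (n.+1%:R : R) != 0 by rewrite pnatr_eq0.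
have -> : rising t n.+1 / rising nu n.+1 =
    rising t n / rising nu n * (1 + (t - nu) / (nu + n%:R)).
  rewrite /rising !big_ord_recr /= -!/(rising _ _).
  have := rising_gt0 n nu0; move: (rising nu n) (rising t n) (n%:R : R) (n.+1%:R : R) a0 n0.
  move=> u v w y a0 y0 u0; field.
  by rewrite y0 !gt_eqF.
rewrite exprMn.
have -> : (nu + n.+1%:R) / nu = (nu + n%:R) / nu * (1 + 1 / (nu + n%:R)).
  by rewrite -natr1; field; rewrite !gt_eqF.
apply: ler_pM => //.
- by rewrite divr_ge0 // ltW.
- by rewrite addr_ge0 // divr_ge0 // ltW.
apply: le_trans (bernoulli _ _); last by rewrite divr_ge0 ?(ltW a0) // subr_ge0.
rewrite lerD2l mulrA ler_pM2r ?invr_gt0 //.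
Qed.

End Growth.

Section NotContractive.
Context {R : realType} {r s : nat}.
Local Notation C := R[i].
Local Notation M := 'M[C]_(r.+1, s.+1).

Theorem multiplication_not_contractive (lambda : R) (K : M -> M -> C) (H : holo_rkhs K) :
  is_polarization (bergman_diag_pow lambda) K ->
  0 < lambda * (r.+1 + s.+1)%:R < s.+1%:R -> ~ mult_hom_contractive H.
Proof.
move=> K_polar /andP[nu0 nus] hc.
set nu := lambda * _ in nu0 nus.
have d0 : 0 < s.+1%:R - nu by rewrite subr_gt0.
pose m := Num.bound (s.+1%:R - nu)^-1.
have hm : (s.+1%:R - nu)^-1 < m%:R by apply: archi_boundP; rewrite invr_ge0 ltW.
have m1 : 1 <= m%:R * (s.+1%:R - nu) by rewrite -ler_pdivrMr // div1r ltW.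
have m0 : (0 < m)%N by rewrite -(ltr0n R); apply: lt_trans hm; rewrite invr_gt0.
(* There are [s + 1] columns here. The lower bound gets degree [s + 2] in [n] against degree [s + 1]
   in the upper bound. *)
pose k := (m * s.+2)%N.
have k0 : (0 < k)%N by rewrite muln_gt0 m0.
(* [Q] gathers the constants, using [nu < s + 1] and [n k + 1 <= n (k + 1)]. The two bounds then
   force [n <= Q], which [n = Q + 1] violates. *)
pose Q := (s.+1 ^ s.+2 * k ^ k * k.+1 ^ s.+1)%N.
pose n := Q.+1.
have [eps [e1 [S0 Sk]]] := @small_polynomial R r s.+1 n k k0.
set f := row_poly _ in S0 Sk.
have mb : mult_bounded_by H f (sup_norm f) by apply: hc; exact: row_poly_holo.
have lb := multiplier_lower_bound K_polar (ltW nu0) e1 S0 mb.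
have p0 := rising_gt0 n nu0.
have s0 : 0 < rising (s.+1%:R : R) n by apply: rising_gt0; rewrite ltr0n.
have Lle : rising s.+1%:R n / rising nu n <= sup_norm f ^+ 2.
  rewrite ler_pdivrMr //; apply: le_trans lb; rewrite rising_bin ler_nat.
  exact: card_degree.
have big := rising_ratio_growth n nu0 (ltW nus) m1.
have n0 : (0 : R) < n%:R by rewrite ltr0n.
have h1 : ((nu + n%:R) / nu) ^+ s.+2 <= (k ^ k * (n * k).+1 ^ s.+1)%:R.
  apply: le_trans Sk; rewrite exprM.
  apply: (@le_trans _ _ ((rising s.+1%:R n / rising nu n) ^+ k)).
    rewrite /k exprM; apply: lerXn2r big; rewrite nnegrE.
      by rewrite divr_ge0 ?addr_ge0 ?ltW.
    by rewrite exprn_ge0 // divr_ge0 ?ltW.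
  by apply: lerXn2r => //; rewrite nnegrE ?sqr_ge0 // divr_ge0 ?ltW.
have h2 : (n%:R / s.+1%:R : R) ^+ s.+2 <= (k ^ k * (n * k.+1) ^ s.+1)%:R.
  apply: (@le_trans _ _ (((nu + n%:R) / nu) ^+ s.+2)).
    apply: lerXn2r; rewrite ?nnegrE ?divr_ge0 ?addr_ge0 ?(ltW nu0) ?ler0n //.
    apply: ler_pM; rewrite ?invr_ge0 ?ler0n //; first by rewrite lerDr ltW.
    by rewrite lef_pV2 ?posrE ?ltr0n // ltW.
  apply: le_trans h1 _; rewrite ler_nat leq_mul2l; apply/orP; right.
  by rewrite leq_exp2r // mulnS -addn1 addnC leq_add2r.
have : (n ^ s.+2 <= Q * n ^ s.+1)%N.
  move: h2; rewrite expr_div_n ler_pdivrMr ?exprn_gt0 ?ltr0n // -!natrX -natrM ler_nat => h2.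
  apply: leq_trans h2 _; rewrite /Q expnMn.
  move: (k ^ k)%N (n ^ s.+1)%N (k.+1 ^ s.+1)%N (s.+1 ^ s.+2)%N => u v w y.
  by rewrite (_ : (u * (v * w) * y = y * u * w * v)%N) //; ring.
by rewrite expnS leq_pmul2r ?expn_gt0 // ltnn.
Qed.

End NotContractive.

Theorem mainTheorem5 (R : realType) (r s : nat) (lambda : R)
    (K : 'M[R[i]%C]_(r, s) -> 'M[R[i]%C]_(r, s) -> R[i]%C)
    (r_ge1 : (1 <= r)%N) (s_ge1 : (1 <= s)%N)
    (lambda_gt0 : 0 < lambda)
    (K_polar : is_polarization (bergman_diag_pow lambda) K)
    (K_pd : positive_definite_kernel K)
    (nu_ge1 : 1 <= lambda * (r + s)%:R)
    (nu_lts : lambda * (r + s)%:R < s%:R) :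
  (forall w : 'M[R[i]%C]_(r, s), matrix_ball w ->
     forall A : 'M[R[i]%C]_(r * s), curvature_factor lambda w A ->
     rho_contractive A w)
  /\ (forall H : holo_rkhs K, ~ mult_hom_contractive H).
Proof.
split=> [w bw A hA|]; first exact: rho_contractive_ball nu_ge1 bw hA.
(* The successor forms provide a first row and at least one variable in it. *)
case: r s r_ge1 s_ge1 K K_polar nu_ge1 nu_lts {K_pd} => [//|r] [//|s] _ _ K K_polar nu1 nus H.
by apply: multiplication_not_contractive K_polar _; rewrite nus (lt_le_trans ltr01).
Qed.
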